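(* Let $(\lambda_k)_{k\ge 1}$ be a strictly increasing sequence of positive real numbers such that $\lambda_k \sim k^2$ as $k\to+\infty$. Then $$ \sup_{\substack{f\in C^2_b(\mathbb{R}^m)\\ \|f\|_\infty\le 1}} \Big\{\sum_{k=1}^m \lambda_k\,(D_k u^f(0))^2\Big\} \to \infty \quad\text{as } m\to\infty, $$ where $u^f\in C^2_b(\mathbb{R}^m)$ is the unique bounded classical solution of $$ u(x)-\frac12\sum_{k=1}^m D^2_{kk}u(x)+\sum_{k=1}^m \lambda_k x_k D_k u(x)=f(x),\qquad x\in\mathbb{R}^m; $$ that is, in explicit form, $$ \sup_{m\in\mathbb{N}}\ \sup_{\substack{f\in C^2_b(\mathbb{R}^m)\\ \|f\|_\infty\le 1}}\ \sum_{k=1}^m\left(\int_0^\infty \frac{\lambda_k e^{-t}e^{-\lambda_k t}}{(1-e^{-2\lambda_k t})^{1/2}}\,\frac{1}{\sqrt{(2\pi)^m}}\int_{\mathbb{R}^m} f(c_1(t)x_1,\ldots,c_m(t)x_m)\,x_k\,e^{-\frac{|x|^2}{2}}\,dx\,dt\right)^2=+\infty, $$ where $c_k(t)=\left(\frac{1-e^{-2\lambda_k t}}{2\lambda_k}\right)^{1/2}$ for $k\in\{1,\ldots,m\}$ and $t\ge 0$.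
   Context: $\lambda_k\sim k^2$ means $\lambda_k/k^2\to 1$ as $k\to\infty$. $C^2_b(\mathbb{R}^m)$ is the space of bounded $C^2$ functions $f:\mathbb{R}^m\to\mathbb{R}$ whose first and second partial derivatives are all bounded; $\|f\|_\infty=\sup_{x\in\mathbb{R}^m}|f(x)|$. $D_k$ and $D^2_{kk}$ denote the first and second partial derivatives in the $k$-th coordinate direction, and $|\cdot|$ is the Euclidean norm. Let $A_m=\mathrm{diag}(-\lambda_1,\ldots,-\lambda_m)$. For $f\in C^2_b(\mathbb{R}^m)$ the bounded classical solution $u^f$ of the equation is given by $u^f(x)=\int_0^\infty e^{-t}(P^m_tf)(x)\,dt$, where $P_t^mf(x)=\int_{\mathbb{R}^m} f(e^{tA_m}x+y)\,N(0,Q^m_t)(dy)$, $Q^m_t=(-2A_m)^{-1}(I_m-e^{2tA_m})$, and $N(0,Q)$ is the centered Gaussian measure on $\mathbb{R}^m$ with covariance matrix $Q$. The $k$-th summand in the explicit form equals $\lambda_k (D_ku^f(0))^2$. *)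

(* Defs.v *)
From HB Require Import structures.
From mathcomp Require Import all_boot all_order all_algebra.
From mathcomp Require Import all_classical all_reals all_analysis.
Set Implicit Arguments.
Unset Strict Implicit.
Unset Printing Implicit Defensive.
Import Order.TTheory GRing.Theory Num.Theory.
Import numFieldNormedType.Exports.
Local Open Scope classical_set_scope.
Local Open Scope ring_scope.

Section lebesgue_tuple.
Context (R : realType).
Local Notation RT := (measurableTypeR R).

Definition tuple_cons n (p : RT * n.-tuple RT) : n.+1.-tuple RT :=
  [tuple of p.1 :: p.2].

Lemma measurable_tuple_cons n : measurable_fun [set: _] (@tuple_cons n).
Proof. exact: measurable_cons. Qed.

Section step.
Context (n : nat) (mu : {sigma_finite_measure set (n.-tuple RT) -> \bar R}).

Definition lebesgue_cons : set (n.+1.-tuple RT) -> \bar R :=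
  pushforward (@lebesgue_measure R \x mu)%E (@tuple_cons n).

Let lebesgue_cons0 : lebesgue_cons set0 = 0%E.
Proof. by rewrite /lebesgue_cons /pushforward preimage_set0 measure0. Qed.

Let lebesgue_cons_ge0 A : (0 <= lebesgue_cons A)%E.
Proof. exact: (@measure_ge0 _ _ _ (@lebesgue_measure R \x mu)%E). Qed.

Let lebesgue_cons_sigma_additive : semi_sigma_additive lebesgue_cons.
Proof.
exact: (@measure_semi_sigma_additive _ _ _
  (measure_function_pushforward__canonical__measure_function_Measure
     (@lebesgue_measure R \x mu)%E (@measurable_tuple_cons n))).
Qed.

HB.instance Definition _ := isMeasure.Build _ _ _ lebesgue_cons
  lebesgue_cons0 lebesgue_cons_ge0 lebesgue_cons_sigma_additive.

Let lebesgue_cons_sigma_finite : sigma_finite setT lebesgue_cons.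
Proof.
have /sigma_finiteP[F [FT ndF Foo]] := sigma_finiteT (@lebesgue_measure R).
have /sigma_finiteP[G [GT ndG Goo]] := sigma_finiteT mu.
pose s (x : n.+1.-tuple RT) := (thead x, [tuple of behead x] : n.-tuple RT).
have ms : measurable_fun setT s.
  apply: measurable_fun_pair => /=; first exact: measurable_tnth.
  exact: measurable_behead.
exists (fun i => s @^-1` (F i `*` G i)) => [|i].
  apply/esym; rewrite -subTset => x _.
  have [i _ Fi] : (\bigcup_k F k) (thead x) by rewrite -FT.
  have [j _ Gj] : (\bigcup_k G k) [tuple of behead x] by rewrite -GT.
  exists (maxn i j) => //; split => /=.
    by move: (thead x) Fi; exact/subsetPset/ndF/leq_maxl.
  by move: [tuple of behead x] Gj; exact/subsetPset/ndG/leq_maxr.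
have [mF Fi] := Foo i; have [mG Gi] := Goo i.
split; first by rewrite -[X in measurable X]setTI; apply: ms => //; exact: measurableX.
rewrite /lebesgue_cons /pushforward -comp_preimage.
rewrite (_ : s \o _ = id) ?preimage_id.
  by rewrite product_measure1E// lte_mul_pinfty// ge0_fin_numE.
by apply/funext => -[x t]; congr pair => //=; exact/val_inj.
Qed.

HB.instance Definition _ := Measure_isSigmaFinite.Build _ _ _ lebesgue_cons
  lebesgue_cons_sigma_finite.

End step.

(* Lebesgue measure on R^n, as the n-fold product of the one-dimensional one *)
Fixpoint lebesgue_tuple n : {sigma_finite_measure set (n.-tuple RT) -> \bar R} :=
  if n is n'.+1 then lebesgue_cons (lebesgue_tuple n')
  else \d_[tuple].

Lemma lebesgue_tuple_box n (A : 'I_n -> set RT) :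
    (forall i, measurable (A i)) ->
  lebesgue_tuple n [set x | forall i, A i (tnth x i)] =
  (\prod_(i < n) lebesgue_measure (A i))%E.
Proof.
elim: n => [|n IH] in A * => mA.
  by rewrite big_ord0 /= diracE mem_set//= => -[].
rewrite big_ord_recl -IH// -product_measure1E//=; last first.
  rewrite [X in measurable X](_ : _ =
      \big[setI/setT]_(i < n) (fun x : n.-tuple RT => tnth x i) @^-1`
        A (lift ord0 i)); last first.
    rewrite -bigcap_seq /=; apply/seteqP; split=> x /= h i => [_|]; first exact: h.
    by apply: h; rewrite /= mem_index_enum.
  apply: bigsetI_measurable => i _.
  by rewrite -[X in measurable X]setTI; exact: measurable_tnth.
rewrite /lebesgue_cons /pushforward; congr product_measure1.
apply/seteqP; split=> -[x t] /=.
  move=> h; split; first exact: (h ord0).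
  by move=> i; have := h (lift ord0 i); rewrite tnthS.
by move=> [hx ht] i; case: (unliftP ord0 i) => [j ->|-> //]; rewrite tnthS.
Qed.

End lebesgue_tuple.

Section functions_on_Rm.
Context (R : realType) (m : nat).
Implicit Types f u : 'rV[R]_m -> R.

Definition partial (k : 'I_m) f : 'rV[R]_m -> R :=
  fun x => 'D_(delta_mx 0 k) f x.

Definition C1 f := continuous f /\
  forall k, (forall x, derivable f x (delta_mx 0 k)) /\ continuous (partial k f).

Definition C2 f := C1 f /\ forall k, C1 (partial k f).

Definition C2b f := [/\ C2 f, bounded_fun f,
  forall k, bounded_fun (partial k f) &
  forall j k, bounded_fun (partial j (partial k f))].

Definition sup_norm f : R := sup (range (fun x => `|f x|)).

Definition C2b_unit_ball : set ('rV[R]_m -> R) :=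
  [set f | C2b f /\ sup_norm f <= 1].

End functions_on_Rm.

(* The sequence (lambda_k)_(k >= 1) is lam 1, lam 2, ...; the value lam 0 is
   irrelevant. The coordinate i : 'I_m goes with lambda_(i + 1). *)
Section ornstein_uhlenbeck.
Context (R : realType) (lam : nat -> R) (m : nat).

Definition bounded_classical_solution (f u : 'rV[R]_m -> R) :=
  [/\ C2 u, bounded_fun u &
  forall x, u x - 2^-1 * (\sum_(k < m) partial k (partial k u) x)
            + \sum_(k < m) lam k.+1 * x 0 k * partial k u x = f x].

(* u^f; the default value is used only if there is no solution *)
Definition OU_solution (f : 'rV[R]_m -> R) : 'rV[R]_m -> R :=
  xget (fun=> 0) [set u | bounded_classical_solution f u].

Definition gradient_sum (f : 'rV[R]_m -> R) : R :=
  \sum_(k < m) lam k.+1 * partial k (OU_solution f) 0 ^+ 2.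

Definition OU_scale (t : R) (k : 'I_m) : R :=
  Num.sqrt ((1 - expR (- (2 * lam k.+1 * t))) / (2 * lam k.+1)).

Definition gaussian_moment (f : 'rV[R]_m -> R) (t : R) (k : 'I_m) : R :=
  (Num.sqrt ((2 * pi) ^+ m))^-1 *
  \int[lebesgue_tuple R m]_x
    (f (\row_(i < m) (OU_scale t i * tnth x i)) * tnth x k *
     expR (- (\sum_(i < m) tnth x i ^+ 2) / 2)).

(* At t = 0 the first quotient is a division by 0, with value 0; this is
   a null set for the integral. With this customary constant the
   k-th summand is lambda_k * (D_k u^f(0))^2 / 2. *)
Definition explicit_sum (f : 'rV[R]_m -> R) : R :=
  \sum_(k < m)
    (\int[lebesgue_measure]_(t in `[0, +oo[)
       (lam k.+1 * expR (- t) * expR (- (lam k.+1 * t)) /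
        Num.sqrt (1 - expR (- (2 * lam k.+1 * t))) *
        gaussian_moment f t k)) ^+ 2.

End ornstein_uhlenbeck.

(* Main.v *)
(* Fix J and put N = 8 J. Since the eigenvalues are unbounded, one can choose
   disjoint blocks B_j of N coordinates and further single coordinates k_j, j < J,
   such that, with La_j an upper bound of the eigenvalues in B_j and
   mu_j = lambda_(k_j), one has N La_j <= mu_j and 4 mu_j <= La_i for i > j.
   Writing E_j(x) = exp(- La_j |x_(B_j)|^2), take
     f(x) = sum_j sqrt(mu_j) x_(k_j) exp(- mu_j x_(k_j)^2 / 2) E_j(x)
                  prod_(i > j) (1 - E_i(x)).
   The Gaussian factors are at most 1 and sum_j E_j prod_(i > j) (1 - E_i)
   telescopes, so |f| <= 1. The part of f that is odd in x_(k_j) is its j-th term.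
   On the half space x_(k_j) > 0 an explicit function, a multiple of the j-th term
   with the product replaced by 1 - c sum_(i > j) E_i / La_i, is a subsolution for
   this odd part: the diffusion in a block of N coordinates yields
   L E_i <= La_i (4 - N E_i), and the sum of the E_i that 1 - prod (1 - E_i) loses
   is paid for by the term - N E_i. The maximum principle gives
   mu_j (D_(k_j) u(0))^2 >= 1/324 for every j, so the sum is at least J / 324.

   Existence: u = int_0^oo e^-t P_t f dt can be differentiated under the integral,
   and d/dt P_t f = L P_t f with the y-derivatives removed by Gaussian integration
   by parts, so u - L u = - int d/dt (e^-t P_t f) = f. Uniqueness is the maximum
   principle again. One more integration by parts turns the explicit kernel into
   sqrt(lambda_k / 2) e^-t e^(- lambda_k t) P_t (D_k f)(0), which is where the
   factor 1/2 between the two sums comes from. *)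
Require Import Defs.
From mathcomp Require Import all_boot all_order all_algebra.
From mathcomp Require Import all_classical all_reals all_analysis.
From mathcomp Require Import measurable_realfun ring lra zify.
Import Order.TTheory GRing.Theory Num.Theory.
Import numFieldNormedType.Exports.
Set Implicit Arguments.
Unset Strict Implicit.
Unset Printing Implicit Defensive.
Local Open Scope classical_set_scope.
Local Open Scope ring_scope.

(** * Calculus of bounded C^2 functions *)

(** The scales come from the process X generated by L and started at 0. At 0 all E_i equal 1, so to
    first order f shows only its last term; the others reach D u(0) only because u averages f over
    time. For the direction k_j the relevant time is 1 / mu_j. By then |X|^2 on the block B_j is of
    order at most N / mu_j, so N La_j <= mu_j keeps E_j of order one. On a faster block, i > j, La_i
    |X|^2 is large after a time of order 1 / (N La_i), which is at most 1 / (4 N mu_j). So E_i is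
    negligible outside a fraction of order 1 / N of the relevant time, and with N = 8 J all J such
    losses together stay small. Single coordinates in place of blocks would not do: La_i |X|^2 would
    stay of order one even in equilibrium and E_i would never become small. The corrector 1 - c sum
    E_i / La_i expresses this loss estimate without a stochastic process, since 1 / La_i sets the
    time scale on which E_i is lost. *)

Section calculus.
Context {R : realType} {m : nat}.
Implicit Types (f g u : 'rV[R]_m -> R) (x v : 'rV[R]_m).

Lemma is_derive_comp1 (F G : R -> R) (t a b : R) :
  is_derive (G t) 1 F a -> is_derive t 1 G b ->
  is_derive t 1 (fun s => F (G s)) (a * b).
Proof.
move=> [dF <-] [dG <-].
have dF' : differentiable F (G t) := (derivable1_diffP F (G t)).1 dF.
have dG' : differentiable G t := (derivable1_diffP G t).1 dG.
apply: DeriveDef.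
  apply: (derivable1_diffP (F \o G) t).2.
  exact: (differentiable_comp dG' dF').
have := derive1_comp dG dF.
by rewrite (derive1E (F \o G)) (derive1E F) (derive1E G).
Qed.

(** Together with the converse [is_derive_line0], this reduces directional derivatives to functions
    of one real variable, where the mean value theorem and differentiation under the integral
    apply. *)
Lemma is_derive_line f x v d h :
  is_derive (h *: v + x) v f d -> is_derive h 1 (fun s => f (s *: v + x)) d.
Proof.
move=> [df dE].
have E : (fun k => k^-1 *: (((fun s => f (s *: v + x)) \o shift h) (k *: 1) -
             f (h *: v + x))) =
         (fun k => k^-1 *: ((f \o shift (h *: v + x)) (k *: v) - f (h *: v + x))).
  apply/funext => k /=; congr (_ *: (f _ - _)).
  by rewrite scalerDl addrA [k *: 1]mulr1.
by apply: DeriveDef; [rewrite /derivable E|rewrite -dE /derive E].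
Qed.

Lemma is_derive_line0 f x v d :
  is_derive (0 : R) 1 (fun s => f (s *: v + x)) d -> is_derive x v f d.
Proof.
move=> [df dE].
have E : (fun k => k^-1 *: (((fun s => f (s *: v + x)) \o shift (0 : R)) (k *: 1) -
             f (0 *: v + x))) =
         (fun k => k^-1 *: ((f \o shift x) (k *: v) - f x)).
  apply/funext => k /=; congr (_ *: (f _ - f _)).
    by rewrite addr0 [k *: 1]mulr1.
  by rewrite scale0r add0r.
by apply: DeriveDef; [rewrite /derivable -E|rewrite -dE /derive -E].
Qed.

Lemma is_derive_dirZ f x v c d :
  is_derive x v f d -> is_derive x (c *: v) f (d * c).
Proof.
move=> df; apply: is_derive_line0.
rewrite (_ : (fun _ => _) = (fun s => f ((s * c) *: v + x))); last first.
  by apply/funext => s; rewrite scalerA.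
apply: (@is_derive_comp1 (fun r => f (r *: v + x)) (fun s => s * c)).
  by apply: is_derive_line; rewrite mul0r scale0r add0r.
have -> : (fun s => s * c) = (id : R -> R) * cst c by [].
by apply: is_derive_eq; rewrite scaler0 add0r [_ *: _]mulr1.
Qed.

Lemma is_derive_coord k (g : R -> R) (d : R) j x :
  is_derive (x 0 k) 1 g d ->
  is_derive x (delta_mx 0 j) (fun y => g (y 0 k)) (d *+ (k == j)).
Proof.
move=> dg; apply: is_derive_line0.
rewrite (_ : (fun _ => _) = (fun s => g (s * (k == j)%:R + x 0 k))); last first.
  by apply/funext => s; rewrite !mxE eqxx.
rewrite -(mulr_natr d); apply: (@is_derive_comp1 g (fun s => s * (k == j)%:R + x 0 k)).
  by rewrite mul0r add0r.
have -> : (fun s => s * (k == j)%:R + x 0 k) = (id : R -> R) * cst (k == j)%:R + cst (x 0 k) by [].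
by apply: is_derive_eq; rewrite scaler0 add0r addr0 [_ *: _]mulr1.
Qed.

Lemma bounded_fctP (T : Type) (f : T -> R) :
  bounded_fun f <-> exists M, forall y, `|f y| <= M.
Proof.
split.
  move=> [M [Mr H]]; exists (M + 1) => x.
  by apply: (H (M + 1)) => //; rewrite ltrDl.
move=> [M H]; exists M; split; first exact: num_real.
by move=> N MN y _; exact: le_trans (H y) (ltW MN).
Qed.

Lemma bounded_fctD (T : Type) (f g : T -> R) :
  bounded_fun f -> bounded_fun g -> bounded_fun (f + g).
Proof.
move=> /bounded_fctP[M hM] /bounded_fctP[N hN]; apply/bounded_fctP.
by exists (M + N) => y; apply: le_trans (ler_normD _ _) _; rewrite lerD.
Qed.

Lemma bounded_fctM (T : Type) (f g : T -> R) :
  bounded_fun f -> bounded_fun g -> bounded_fun (f * g).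
Proof.
move=> /bounded_fctP[M hM] /bounded_fctP[N hN]; apply/bounded_fctP.
by exists (M * N) => y; rewrite normrM ler_pM.
Qed.

Lemma bounded_fct_cst (T : Type) (c : R) : bounded_fun (cst c : T -> R).
Proof. by apply/bounded_fctP; exists `|c| => y. Qed.

Fact pd_key : unit. Proof. exact: tt. Qed.

(* Sealing [partial] keeps failing unification problems from unfolding
   derivatives into limits of difference quotients. *)
Definition pd : 'I_m -> ('rV[R]_m -> R) -> 'rV[R]_m -> R :=
  locked_with pd_key (@partial R m).

Lemma pdE : pd = @partial R m.
Proof. exact: locked_withE. Qed.

Definition C1s : ('rV[R]_m -> R) -> Prop := locked_with pd_key (@C1 R m).
Definition C2s : ('rV[R]_m -> R) -> Prop := locked_with pd_key (@C2 R m).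
Definition C2bs : ('rV[R]_m -> R) -> Prop := locked_with pd_key (@C2b R m).

Lemma C1sE : C1s = @C1 R m. Proof. exact: locked_withE. Qed.
Lemma C2sE : C2s = @C2 R m. Proof. exact: locked_withE. Qed.
Lemma C2bsE : C2bs = @C2b R m. Proof. exact: locked_withE. Qed.

Lemma C2P f : C2s f <-> C1s f /\ forall k, C1s (pd k f).
Proof. by rewrite C2sE C1sE pdE. Qed.

Lemma C2bP f : C2bs f <-> [/\ C2s f, bounded_fun f,
  forall k, bounded_fun (pd k f) & forall j k, bounded_fun (pd j (pd k f))].
Proof. by rewrite C2bsE C2sE pdE. Qed.

Lemma C1_continuous f : C1s f -> continuous f.
Proof. by rewrite C1sE => -[]. Qed.

Lemma C1_continuous_pd f k : C1s f -> continuous (pd k f).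
Proof. by rewrite C1sE pdE => -[_ /(_ k)[]]. Qed.

Lemma C1_is_derive f k x : C1s f -> is_derive x (delta_mx 0 k) f (pd k f x).
Proof. by rewrite C1sE pdE => -[_ /(_ k)[df _]]; exact/derivableP. Qed.

(** Regularity and the values of the partial derivatives are returned together: the first component
    feeds closure lemmas, the second serves as a rewriting rule for [pd]. *)
Lemma C1I f (d : 'I_m -> 'rV[R]_m -> R) : continuous f ->
  (forall k x, is_derive x (delta_mx 0 k) f (d k x)) ->
  (forall k, continuous (d k)) -> C1s f /\ forall k, pd k f = d k.
Proof.
move=> cf df cd.
have E k : pd k f = d k.
  by rewrite pdE; apply/funext => x; exact: (@derive_val _ _ _ _ _ _ _ (df k x)).
split=> //; rewrite C1sE; split=> // k; split; last by rewrite -pdE E.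
by move=> x; exact: (@ex_derive _ _ _ _ _ _ _ (df k x)).
Qed.

Lemma C1_cst c : C1s (cst c : 'rV[R]_m -> R) /\
  forall k, pd k (cst c : 'rV[R]_m -> R) = cst 0.
Proof.
by apply: (C1I (d := fun=> cst 0)) => *; exact: cst_continuous.
Qed.

Lemma C1D f g : C1s f -> C1s g ->
  C1s (f + g) /\ forall k, pd k (f + g) = pd k f + pd k g.
Proof.
move=> f1 g1; apply: C1I.
- by move=> x; apply: continuousD; [exact: C1_continuous|exact: C1_continuous].
- move=> k x; have := C1_is_derive k x f1; have := C1_is_derive k x g1.
  by move=> dg df; exact: is_deriveD df dg.
- by move=> k x; apply: continuousD; [exact: C1_continuous_pd|exact: C1_continuous_pd].
Qed.

Lemma C1M f g : C1s f -> C1s g ->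
  C1s (f * g) /\ forall k, pd k (f * g) = f * pd k g + g * pd k f.
Proof.
move=> f1 g1; apply: C1I.
- by move=> x; apply: continuousM; [exact: C1_continuous|exact: C1_continuous].
- move=> k x; have := C1_is_derive k x f1; have := C1_is_derive k x g1.
  by move=> dg df; exact: is_deriveM df dg.
- move=> k x; apply: continuousD; apply: continuousM;
   [exact: C1_continuous|exact: C1_continuous_pd|exact: C1_continuous|exact: C1_continuous_pd].
Qed.

Lemma C2_cst c : C2s (cst c : 'rV[R]_m -> R).
Proof. by apply/C2P; split=> [|k]; [|rewrite (C1_cst c).2]; exact: (C1_cst _).1. Qed.

Lemma C2D f g : C2s f -> C2s g -> C2s (f + g).
Proof.
move=> /C2P[f1 f2] /C2P[g1 g2]; apply/C2P; split=> [|k]; first exact: (C1D f1 g1).1.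
by rewrite (C1D f1 g1).2; exact: (C1D (f2 k) (g2 k)).1.
Qed.

Lemma C2M f g : C2s f -> C2s g -> C2s (f * g).
Proof.
move=> /C2P[f1 f2] /C2P[g1 g2]; apply/C2P; split=> [|k]; first exact: (C1M f1 g1).1.
rewrite (C1M f1 g1).2; apply: (C1D _ _).1; apply: (C1M _ _).1 => //.
Qed.

Lemma C2b_cst c : C2bs (cst c : 'rV[R]_m -> R).
Proof.
apply/C2bP; split; first exact: C2_cst.
- exact: bounded_fct_cst.
- by move=> k; rewrite (C1_cst c).2; exact: bounded_fct_cst.
- by move=> j k; rewrite (C1_cst c).2 (C1_cst 0).2; exact: bounded_fct_cst.
Qed.

Lemma C2bD f g : C2bs f -> C2bs g -> C2bs (f + g).
Proof.
move=> /C2bP[f2 bf bf1 bf2] /C2bP[g2 bg bg1 bg2].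
have /C2P[f1 f1'] := f2; have /C2P[g1 g1'] := g2.
apply/C2bP; split; first exact: C2D.
- exact: bounded_fctD.
- by move=> k; rewrite (C1D f1 g1).2; exact: bounded_fctD.
- move=> j k; rewrite (C1D f1 g1).2 (C1D (f1' k) (g1' k)).2; exact: bounded_fctD.
Qed.

Lemma C2bM f g : C2bs f -> C2bs g -> C2bs (f * g).
Proof.
move=> /C2bP[f2 bf bf1 bf2] /C2bP[g2 bg bg1 bg2].
have /C2P[f1 f1'] := f2; have /C2P[g1 g1'] := g2.
apply/C2bP; split; first exact: C2M.
- exact: bounded_fctM.
- by move=> k; rewrite (C1M f1 g1).2; apply: bounded_fctD; exact: bounded_fctM.
- move=> j k; rewrite (C1M f1 g1).2.
  rewrite (C1D (C1M f1 (g1' k)).1 (C1M g1 (f1' k)).1).2.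
  rewrite (C1M f1 (g1' k)).2 (C1M g1 (f1' k)).2.
  by do 2!apply: bounded_fctD; exact: bounded_fctM.
Qed.

Lemma C2b_sum (I : Type) (s : seq I) (F : I -> 'rV[R]_m -> R) (P : pred I) :
  (forall i, P i -> C2bs (F i)) -> C2bs (\sum_(i <- s | P i) F i).
Proof.
move=> h; apply: (@big_ind _ C2bs) h; last by move=> f g; exact: C2bD.
exact: (C2b_cst 0).
Qed.

Lemma C2b_prod (I : Type) (s : seq I) (F : I -> 'rV[R]_m -> R) (P : pred I) :
  (forall i, P i -> C2bs (F i)) -> C2bs (\prod_(i <- s | P i) F i).
Proof.
move=> h; apply: (@big_ind _ C2bs) h; last by move=> f g; exact: C2bM.
exact: (C2b_cst 1).
Qed.

End calculus.

(** * The Ornstein-Uhlenbeck operator and its maximum principle *)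

Section maxprinciple.
Context {R : realType} {m : nat}.
Implicit Types (f g u w : 'rV[R]_m -> R) (x v : 'rV[R]_m).

Lemma is_derive_affine (c a b t : R) : is_derive t 1 (fun h => c * (a * h + b)) (c * a).
Proof.
have -> : (fun h => c * (a * h + b)) = cst c * (cst a * (id : R -> R) + cst b) by [].
pose D1 := @is_derive_id R R t 1.
pose D2 := is_deriveD (is_deriveM (is_derive_cst a t 1) D1) (is_derive_cst b t 1).
apply: (@is_derive_eq _ _ _ _ _ _ _ _ (is_deriveM (is_derive_cst c t 1) D2)).
by rewrite /cst/= !scaler0 !addr0 /GRing.scale/= mulr1.
Qed.

Lemma is_derive_quadratic (c b d t : R) :
  is_derive t 1 (fun h => c * (h ^+ 2 + h * b + d)) (c * (2 * t + b)).
Proof.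
have -> : (fun h => c * (h ^+ 2 + h * b + d)) =
  cst c * ((id : R -> R) ^+ 2 + (id : R -> R) * cst b + cst d) by [].
pose D1 := @is_derive_id R R t 1.
pose D2 := is_deriveX 2 D1.
pose D3 := is_deriveM D1 (is_derive_cst b t 1).
pose D4 := is_deriveD (is_deriveD D2 D3) (is_derive_cst d t 1).
apply: (@is_derive_eq _ _ _ _ _ _ _ _ (is_deriveM (is_derive_cst c t 1) D4)).
by rewrite /cst/= !scaler0 !addr0 add0r /GRing.scale/= expr1 !mulr1.
Qed.

Lemma local_max_derive2 (F dF : R -> R) (d2 : R) :
  (forall t : R, is_derive t 1 F (dF t)) -> is_derive (0 : R) 1 dF d2 ->
  (\forall h \near (0 : R), F h <= F 0) -> dF 0 = 0 /\ d2 <= 0.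
Proof.
move=> FdF dFd2 /nbhs_ballP[e /= e0 Fmax].
have Fle h : `|h| < e -> F h <= F 0.
  by move=> he; apply: Fmax; rewrite /ball/= sub0r normrN.
have dF0 : dF 0 = 0.
  have H : is_derive (0:R) 1 F 0.
    apply: (@derive1_at_max _ F (- e) e).
    - by rewrite ge0_cp// ltW.
    - by move=> t _; have [] := FdF t.
    - by rewrite in_itv/= oppr_lt0 e0.
    - by move=> t; rewrite in_itv/= => te; apply: Fle; rewrite ltr_norml.
  by have [_ <-] := FdF 0; have [_ ->] := H.
(* If d2 > 0, then dF > 0 just to the right of 0, and the mean value theorem gives F h > F 0 for
   some small h > 0. *)
split=> //; rewrite leNgt; apply/negP => d2gt0.
have [dd dE] := dFd2.
move: dd; rewrite /derivable => /cvg_ex[l /= cl].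
have lE : l = d2 by rewrite -dE; apply/esym/cvg_lim.
move: cl; rewrite lE => /cvgrPdist_lt/(_ _ d2gt0).
move=> /nbhs_ballP[d /= d0 H].
pose h := Num.min e d / 2.
have med : 0 < Num.min e d by rewrite lt_min e0 d0.
have h0 : 0 < h by rewrite divr_gt0.
have hlt : h < Num.min e d by rewrite ltr_pdivrMr// ltr_pMr// ltr1n.
have [he hd] : h < e /\ h < d by move: hlt; rewrite lt_min => /andP[].
have dFpos c : 0 < c -> c <= h -> 0 < dF c.
  move=> c0 ch.
  have := H c; rewrite /= /ball/= sub0r normrN gtr0_norm// => /(_ (le_lt_trans ch hd)).
  move=> /(_ (lt0r_neq0 c0)); rewrite addr0 dF0 subr0 [c *: 1]mulr1 => H1.
  have := ltr_normlW H1; rewrite ltrBlDr ltrDl /GRing.scale/= pmulr_rgt0// invr_gt0//.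
have [c] := @MVT R F dF 0 h h0 (fun t _ => FdF t)
  (@derivable_within_continuous _ _ F _ (fun t _ => @ex_derive _ _ _ _ _ _ _ (FdF t))).
rewrite in_itv/= => /andP[c0 ch] E.
have := Fle h; rewrite gtr0_norm// => /(_ he); rewrite -subr_le0 E subr0.
by rewrite leNgt mulr_gt0// dFpos// ltW.
Qed.

(** The norm of ['rV[R]_m] is the maximum norm; the penalty in the maximum principle has to be
    smooth. *)
Definition sqn x : R := \sum_k x 0 k ^+ 2.

Lemma sqn_ge0 x : 0 <= sqn x.
Proof. by apply: sumr_ge0 => k _; exact: sqr_ge0. Qed.

Lemma continuous_coord k : continuous (fun x : 'rV[R]_m => x 0 k).
Proof. exact: coord_continuous. Qed.

Lemma continuous_sqn : continuous sqn.
Proof.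
have -> : sqn = \sum_k (fun x => x 0 k ^+ 2).
  by apply/funext => x; rewrite fct_sumE.
elim/big_ind: _ => [x|f g cf cg x|k _ x].
- exact: cst_continuous.
- by apply: continuousD; [exact: cf|exact: cg].
- apply: (@continuous_comp _ _ _ (fun x => x 0 k) (fun t => t ^+ 2)).
    exact: continuous_coord.
  exact: exprn_continuous.
Qed.

Lemma sqn_line k h x : sqn (h *: delta_mx 0 k + x) = h ^+ 2 + h * (2 * x 0 k) + sqn x.
Proof.
rewrite /sqn (bigD1 k)//= [X in _ = _ + X](bigD1 k)//= [RHS]addrA.
congr (_ + _); first by rewrite !mxE !eqxx/= mulr1; ring.
apply: eq_bigr => j jk; rewrite !mxE eqxx (negbTE jk)/=; congr (_ ^+ 2); ring.
Qed.

Variable lam : nat -> R.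

Definition OU u x : R := 2^-1 * (\sum_(k < m) pd k (pd k u) x)
  - \sum_(k < m) lam k.+1 * x 0 k * pd k u x.

Hypothesis lam_ge0 : forall k : 'I_m, 0 <= lam k.+1.

Lemma norm_le_sqn x K : sqn x <= K -> `|x| <= 1 + K.
Proof.
move=> xK; have K0 : 0 <= K by rewrite (le_trans (sqn_ge0 x)).
rewrite [`|x|]mx_normrE; apply/bigmax_leP; split => [|[i k] _ /=].
  by rewrite addr_ge0.
rewrite ord1.
have : x 0 k ^+ 2 <= K.
  rewrite (le_trans _ xK)// /sqn (bigD1 k)//= lerDl.
  by apply: sumr_ge0 => j _; exact: sqr_ge0.
rewrite -real_normK ?num_real//.
have := sqr_ge0 (`|x 0 k| - 1); rewrite sqrrB1.
by move: (`|x 0 k|) => t; rewrite -mulr_natr; lra.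
Qed.

(* [w - eps |x|^2] attains its maximum, and [L] applied to [|x|^2] is at most [m]. *)
Lemma max_principle w (D : set 'rV[R]_m) : C2s w -> bounded_fun w -> closed D ->
  (forall x, D x -> 0 < w x -> nbhs x D /\ w x <= OU w x) ->
  forall x, D x -> w x <= 0.
Proof.
move=> /C2P[w1 w2] /bounded_fctP[M wM] cD H x0 Dx0; rewrite leNgt; apply/negP => wx0.
have M0 : 0 <= M by rewrite (le_trans _ (wM x0)).
(* Small enough that w - eps |x|^2 still exceeds eps m at x0, where eps m is the bound that L w
   satisfies at the maximum point. *)
pose eps := w x0 / (2 * (m%:R + sqn x0 + 1)).
have den : 0 < m%:R + sqn x0 + 1 :> R by rewrite ltr_wpDl// addr_ge0// sqn_ge0.
have eps0 : 0 < eps by rewrite divr_gt0// mulr_gt0.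
have epsE : eps * (m%:R + sqn x0) < w x0.
  have -> : w x0 = eps * (2 * (m%:R + sqn x0 + 1)).
    by rewrite divfK// gt_eqF// mulr_gt0.
  by rewrite ltr_pM2l//; have := sqn_ge0 x0; have : 0 <= m%:R :> R by []; lra.
pose g x := w x - eps * sqn x.
(* Where |x|^2 > K the penalty exceeds M, so g <= 0 there, and a maximum over the compact part of D
   is a maximum over D. *)
pose K := sqn x0 + M / eps.
have cg : continuous g.
  move=> x; have wx : w y @[y --> x] --> w x by exact: C1_continuous.
  have sx : eps * sqn y @[y --> x] --> eps * sqn x.
    exact: (cvgM (cvg_cst eps) (@continuous_sqn x)).
  exact: cvgB wx sx.
pose A := D `&` [set x | sqn x <= K].
have cA : compact A.
  apply: bounded_closed_compact.
    exists (1 + K); split; first exact: num_real.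
    by move=> N KN x [_ /=] /norm_le_sqn xK; rewrite (le_trans xK)// ltW.
  apply: closedI => //.
  apply: (@preimage_closed _ _ sqn [set t | t <= K]); first by move=> x _; exact: continuous_sqn.
  exact: closed_le.
have Ax0 : A x0 by split=> //=; rewrite lerDl divr_ge0// ltW.
have [y /set_mem[Dy Ky] ymax] :=
  @EVT_max_rV R m g A (ex_intro _ _ Ax0) cA (continuous_subspaceT cg).
have gx0 : eps * m%:R < g x0 by rewrite /g ltrBrDr -mulrDr.
have gy : eps * m%:R < g y by rewrite (lt_le_trans gx0)// ymax// inE.
have gmax z : D z -> g z <= g y.
  move=> Dz; have [zK|zK] := lerP (sqn z) K; first by apply: ymax; rewrite inE.
  rewrite ltW// (le_lt_trans _ gy)//.
  have : eps * sqn x0 + M < eps * sqn z.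
    rewrite (_ : _ + M = eps * K) ?ltr_pM2l// /K mulrDr; congr (_ + _).
    by rewrite mulrC divfK// gt_eqF.
  have := wM z; have := ler_norm (w z); have := sqn_ge0 x0.
  rewrite /g => ? ? ? ?; have : 0 <= eps * sqn x0 by rewrite mulr_ge0// ltW.
  have : 0 <= eps * m%:R by rewrite mulr_ge0// ltW.
  lra.
have wy : eps * m%:R < w y.
  by rewrite (lt_le_trans gy)// /g gerBl mulr_ge0 ?sqn_ge0// ltW.
(* That positive points of D are interior plays the role of a boundary condition w <= 0; it makes
   the first and second order conditions available at y. *)
have [nyD wOU] : nbhs y D /\ w y <= OU w y.
  by apply: H => //; rewrite (le_lt_trans _ wy)// mulr_ge0// ltW.
have key k : pd k w y = 2 * eps * y 0 k /\ pd k (pd k w) y <= 2 * eps.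
  pose G h := w (h *: delta_mx 0 k + y) - eps * (h ^+ 2 + h * (2 * y 0 k) + sqn y).
  pose dG h := pd k w (h *: delta_mx 0 k + y) - eps * (2 * h + 2 * y 0 k).
  have [] := @local_max_derive2 G dG (pd k (pd k w) y - eps * 2).
  - move=> h; rewrite /G /dG.
    apply: is_deriveB; first by apply: is_derive_line; exact: C1_is_derive.
    exact: is_derive_quadratic.
  - rewrite /dG; apply: is_deriveB.
      apply: is_derive_line; rewrite scale0r add0r; exact: C1_is_derive.
    exact: is_derive_affine.
  - have cl : (h *: delta_mx 0 k + y : 'rV[R]_m) @[h --> (0:R)] --> y.
      rewrite -{2}[y]add0r -(scale0r (delta_mx 0 k)).
      by apply: cvgD; [apply: cvgZr_tmp; exact: cvg_id|exact: cvg_cst].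
    have clD : \forall h \near (0 : R), D (h *: delta_mx 0 k + y) := cl D nyD.
    apply: filterS clD => h /gmax.
    by rewrite /g /G !sqn_line !scale0r !add0r expr0n/= !mul0r !add0r.
  rewrite /dG scale0r add0r mulr0 add0r => /eqP; rewrite subr_eq0 => /eqP ->.
  by rewrite subr_le0 => h2; split; [ring|rewrite mulrC].
(* The second derivatives contribute at most eps m, and each drift term - lam_k y_k (2 eps y_k) is
   nonpositive. This contradicts eps m < w y <= L w y. *)
have : OU w y <= eps * m%:R.
  rewrite /OU.
  have h1 : \sum_(k < m) pd k (pd k w) y <= 2 * eps * m%:R.
    rewrite mulr_natr -[X in _ *+ X](card_ord m) -sumr_const.
    by apply: ler_sum => k _; have [] := key k.
  have h2 : 0 <= \sum_(k < m) lam k.+1 * y 0 k * pd k w y.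
    apply: sumr_ge0 => k _; rewrite (key k).1.
    rewrite (_ : _ * _ = lam k.+1 * (2 * eps) * y 0 k ^+ 2); last by ring.
    by rewrite mulr_ge0 ?sqr_ge0// mulr_ge0// mulr_ge0// ltW.
  by move: h1 h2; set s1 := \sum_(_ < _) _; set s2 := \sum_(_ < _) _; lra.
by move=> /(le_trans wOU); rewrite leNgt wy.
Qed.

End maxprinciple.

(** * Gaussian monomials t^n exp(- a t^2), a family whose derivatives are combinations of its
    members *)

Section gaussian_monomials.
Context {R : realType}.
Variable a : R.

Definition gmono n (t : R) := t ^+ n * expR (- (a * t ^+ 2)).

(** For n = 0 the predecessor [n.-1] is again 0, but its coefficient [n%:R] vanishes. *)
Lemma is_derive_gmono n (t : R) :
  is_derive t 1 (gmono n) (n%:R * gmono n.-1 t - 2 * a * gmono n.+1 t).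
Proof.
pose D1 := @is_derive_id R R t 1.
pose Dq := is_derive_quadratic (- a) 0 0 t.
have De : is_derive t 1 (fun s => expR (- (a * s ^+ 2))) (expR (- (a * t ^+ 2)) * (- a * (2 * t))).
  have -> : (fun s => expR (- (a * s ^+ 2))) = (fun s => expR (- a * (s ^+ 2 + s * 0 + 0))).
    by apply/funext => s; rewrite mulr0 !addr0 mulNr.
  apply: (@is_derive_eq _ _ _ _ _ _ _ _ (is_derive_comp1 (is_derive_expR _) Dq)).
  by rewrite !addr0 mulr0 addr0 mulNr.
have -> : gmono n = (id : R -> R) ^+ n * (fun s => expR (- (a * s ^+ 2))).
  by apply/funext => s; rewrite /gmono fctE exprfctE.
apply: (@is_derive_eq _ _ _ _ _ _ _ _ (is_deriveM (is_deriveX n D1) De)).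
rewrite /gmono exprfctE /GRing.scale/= [t ^+ n.+1]exprS; ring.
Qed.

Lemma continuous_gmono n : continuous (gmono n).
Proof.
move=> t; apply: differentiable_continuous; apply/derivable1_diffP.
by have [] := is_derive_gmono n t.
Qed.

Hypothesis a_gt0 : 0 < a.

(** For n > 0, |t|^n <= 1 + t^(2n), and t^(2n) exp(- a t^2) <= n! / a^n by keeping one term of the
    exponential series. *)
Lemma bounded_gmono n : bounded_fun (gmono n).
Proof.
case: n => [|n].
  apply/bounded_fctP; exists 1 => t.
  rewrite /gmono mul1r ger0_norm ?expR_ge0// -[leRHS]expR0 ler_expR oppr_le0.
  by exact: mulr_ge0 (ltW a_gt0) (sqr_ge0 _).
apply/bounded_fctP; exists (1 + n.+1`!%:R / a ^+ n.+1) => t.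
rewrite /gmono normrM [`|expR _|]ger0_norm ?expR_ge0// normrX.
set s := `|t|; have s0 : 0 <= s by exact: normr_ge0.
have -> : t ^+ 2 = s ^+ 2 by rewrite real_normK ?num_real.
have h1 : s ^+ n.+1 <= 1 + (s ^+ 2) ^+ n.+1.
  rewrite exprAC; move: (exprn_ge0 n.+1 s0); set y := s ^+ n.+1 => y0.
  by have := sqr_ge0 (y - 1); rewrite sqrrB1 -mulr_natr; lra.
have e1 : expR (- (a * s ^+ 2)) <= 1.
  by rewrite -[leRHS]expR0 ler_expR oppr_le0 (mulr_ge0 (ltW a_gt0) (sqr_ge0 _)).
have h2 : (s ^+ 2) ^+ n.+1 * expR (- (a * s ^+ 2)) <= n.+1`!%:R / a ^+ n.+1.
  have := expR_ge1Dxn n (mulr_ge0 (ltW a_gt0) (sqr_ge0 s)).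
  rewrite exprMn expRN => h.
  rewrite ler_pdivrMr ?expR_gt0// mulrAC ler_pdivlMr ?exprn_gt0//.
  rewrite mulrC [leRHS]mulrC -ler_pdivrMr ?ltr0n ?fact_gt0//.
  by rewrite (le_trans _ h)// lerDr.
rewrite (le_trans (ler_wpM2r (expR_ge0 _) h1))// mulrDl mul1r lerD//.
Qed.

End gaussian_monomials.

Section functions.
Context {R : realType} {m : nat}.
Implicit Types (f g u w : 'rV[R]_m -> R) (x v : 'rV[R]_m).

Lemma C1_comp_coord k (g0 g1 : R -> R) : continuous g1 ->
  (forall t : R, is_derive t 1 g0 (g1 t)) ->
  C1s (fun x : 'rV[R]_m => g0 (x 0 k)) /\
  forall j, pd j (fun x : 'rV[R]_m => g0 (x 0 k)) =
    cst (k == j)%:R * (fun x => g1 (x 0 k)).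
Proof.
move=> c1 d0.
have cc (g : R -> R) : continuous g -> continuous (fun x : 'rV[R]_m => g (x 0 k)).
  move=> cg x; apply: (@continuous_comp _ _ _ (fun x : 'rV[R]_m => x 0 k) g); last exact: cg.
  exact: continuous_coord.
apply: C1I.
- apply: cc => t; apply: differentiable_continuous; apply/derivable1_diffP.
  by have [] := d0 t.
- move=> j x; apply: (@is_derive_eq _ _ _ _ _ _ _ _ (is_derive_coord j (d0 (x 0 k)))).
  by rewrite -[LHS]mulr_natl.
- move=> j x; apply: continuousM; [exact: cst_continuous|exact: cc].
Qed.

Lemma C2b_comp_coord k (g0 g1 g2 : R -> R) :
  (forall t : R, is_derive t 1 g0 (g1 t)) ->
  (forall t : R, is_derive t 1 g1 (g2 t)) ->
  continuous g2 -> bounded_fun g0 -> bounded_fun g1 -> bounded_fun g2 ->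
  C2bs (fun x : 'rV[R]_m => g0 (x 0 k)).
Proof.
move=> d0 d1 c2 b0 b1 b2.
have c1 : continuous g1.
  move=> t; apply: differentiable_continuous; apply/derivable1_diffP.
  by have [] := d1 t.
have bc (g : R -> R) : bounded_fun g -> bounded_fun (fun x : 'rV[R]_m => g (x 0 k)).
  move=> /bounded_fctP[M hM]; apply/bounded_fctP; exists M => x; exact: hM.
have [f1 p1] := C1_comp_coord k c1 d0.
have [f2 p2] := C1_comp_coord k c2 d1.
have H j := C1M (C1_cst ((k == j)%:R)).1 f2.
apply/C2bP; split.
- by apply/C2P; split=> // j; rewrite p1; case: (H j).
- exact: bc.
- by move=> j; rewrite p1; apply: bounded_fctM; [exact: bounded_fct_cst|exact: bc].
- move=> i j; rewrite p1 (H j).2 p2 (C1_cst _).2.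
  by apply: bounded_fctD; do ?apply: bounded_fctM; do ?exact: bounded_fct_cst; exact: bc.
Qed.

Lemma C2b_gmono0 (a : R) k : 0 < a -> C2bs (fun x : 'rV[R]_m => gmono a 0 (x 0 k)).
Proof.
move=> a0.
pose g1 := cst (- (2 * a)) * gmono a 1.
pose g2 := cst (- (2 * a)) * (gmono a 0 + cst (- (2 * a)) * gmono a 2).
have d0 (t : R) : is_derive t 1 (gmono a 0) (g1 t).
  apply: (@is_derive_eq _ _ _ _ _ _ _ _ (is_derive_gmono a 0 t)).
  by rewrite /g1 !fctE; ring.
have d1 (t : R) : is_derive t 1 g1 (g2 t).
  have D := is_derive_gmono a 1 t.
  apply: (@is_derive_eq _ _ _ _ _ _ _ _ (is_deriveM (is_derive_cst (- (2 * a)) t 1) D)).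
  by rewrite /g2 !fctE /GRing.scale/=; ring.
apply: (C2b_comp_coord k d0 d1).
- move=> t; apply: continuousM; first exact: cst_continuous.
  apply: continuousD; first exact: continuous_gmono.
  by apply: continuousM; [exact: cst_continuous|exact: continuous_gmono].
- exact: bounded_gmono.
- by apply: bounded_fctM; [exact: bounded_fct_cst|exact: bounded_gmono].
- apply: bounded_fctM; first exact: bounded_fct_cst.
  apply: bounded_fctD; first exact: bounded_gmono.
  by apply: bounded_fctM; [exact: bounded_fct_cst|exact: bounded_gmono].
Qed.

Lemma C2b_gmono1 (a : R) k : 0 < a -> C2bs (fun x : 'rV[R]_m => gmono a 1 (x 0 k)).
Proof.
move=> a0.
pose g1 := gmono a 0 + cst (- (2 * a)) * gmono a 2.
pose g2 := cst (- (6 * a)) * gmono a 1 + cst (4 * a ^+ 2) * gmono a 3.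
have d0 (t : R) : is_derive t 1 (gmono a 1) (g1 t).
  apply: (@is_derive_eq _ _ _ _ _ _ _ _ (is_derive_gmono a 1 t)).
  by rewrite /g1 !fctE; ring.
have d1 (t : R) : is_derive t 1 g1 (g2 t).
  have D0 := is_derive_gmono a 0 t; have D2 := is_derive_gmono a 2 t.
  apply: (@is_derive_eq _ _ _ _ _ _ _ _
    (is_deriveD D0 (is_deriveM (is_derive_cst (- (2 * a)) t 1) D2))).
  by rewrite /g2 !fctE /GRing.scale/=; ring.
apply: (C2b_comp_coord k d0 d1).
- by move=> t; apply: continuousD; apply: continuousM;
    do ?exact: cst_continuous; exact: continuous_gmono.
- exact: bounded_gmono.
- apply: bounded_fctD; first exact: bounded_gmono.
  by apply: bounded_fctM; [exact: bounded_fct_cst|exact: bounded_gmono].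
- by apply: bounded_fctD; apply: bounded_fctM;
    do ?exact: bounded_fct_cst; exact: bounded_gmono.
Qed.

End functions.

(** * The operator L on sums, products and Gaussians of a block of coordinates *)

Section OU_calculus.
Context {R : realType} {m : nat}.
Variable lam : nat -> R.
Implicit Types (f g u w : 'rV[R]_m -> R) (x v : 'rV[R]_m).

Local Notation L := (OU lam).

Lemma pdD f g k x : C1s f -> C1s g ->
  pd k (f + g) x = pd k f x + pd k g x.
Proof. by move=> f1 g1; exact: (congr1 (@^~ x) ((C1D f1 g1).2 k)). Qed.

Lemma pdM f g k x : C1s f -> C1s g ->
  pd k (f * g) x = f x * pd k g x + g x * pd k f x.
Proof. by move=> f1 g1; exact: (congr1 (@^~ x) ((C1M f1 g1).2 k)). Qed.

Lemma pd2D f g k x : C2s f -> C2s g ->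
  pd k (pd k (f + g)) x =
  pd k (pd k f) x + pd k (pd k g) x.
Proof.
move=> /C2P[f1 f2] /C2P[g1 g2].
transitivity (pd k (pd k f + pd k g) x); last exact: pdD.
exact: (congr1 (fun h => pd k h x) ((C1D f1 g1).2 k)).
Qed.

Lemma pd2M f g k x : C2s f -> C2s g ->
  pd k (pd k (f * g)) x = f x * pd k (pd k g) x +
    g x * pd k (pd k f) x + 2 * (pd k f x * pd k g x).
Proof.
move=> /C2P[f1 f2] /C2P[g1 g2].
transitivity (pd k (f * pd k g + g * pd k f) x).
  exact: (congr1 (fun h => pd k h x) ((C1M f1 g1).2 k)).
transitivity (pd k (f * pd k g) x + pd k (g * pd k f) x).
  by apply: pdD; [case: (C1M f1 (g2 k))|case: (C1M g1 (f2 k))].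
transitivity ((f x * pd k (pd k g) x + pd k g x * pd k f x) +
              (g x * pd k (pd k f) x + pd k f x * pd k g x)).
  by congr (_ + _); exact: pdM.
move: (pd k (pd k g) x) (pd k (pd k f) x) (pd k f x).
by move: (pd k g x) (f x) (g x) => a b c d e h; ring.
Qed.

Lemma OU_D f g x : C2s f -> C2s g -> L (f + g) x = L f x + L g x.
Proof.
move=> f2 g2.
have E1 : \sum_k pd k (pd k (f + g)) x =
    \sum_k pd k (pd k f) x + \sum_k pd k (pd k g) x.
  by rewrite -big_split; apply: eq_bigr => k _; exact: pd2D.
have E2 : \sum_(k < m) lam k.+1 * x 0 k * pd k (f + g) x =
   (\sum_(k < m) lam k.+1 * x 0 k * pd k f x) +
   (\sum_(k < m) lam k.+1 * x 0 k * pd k g x).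
  rewrite -big_split; apply: eq_bigr => k _ /=; rewrite -mulrDr; congr (_ * _).
  by apply: pdD; [by case/C2P: f2|by case/C2P: g2].
apply: (etrans (congr2 (fun a b => 2^-1 * a - b) E1 E2)); rewrite /OU.
move=> {E1 E2}.
move: (\sum_k pd k (pd k f) x) (\sum_k pd k (pd k g) x) => a b.
move: (\sum_(k < m) lam k.+1 * x 0 k * pd k f x) => c.
by move: (\sum_(k < m) lam k.+1 * x 0 k * pd k g x) => d; ring.
Qed.

Lemma OU_M f g x : C2s f -> C2s g ->
  L (f * g) x = f x * L g x + g x * L f x + \sum_k pd k f x * pd k g x.
Proof.
move=> f2 g2.
have E1 : \sum_k pd k (pd k (f * g)) x =
    f x * (\sum_k pd k (pd k g) x) +
    g x * (\sum_k pd k (pd k f) x) +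
    2 * (\sum_k pd k f x * pd k g x).
  rewrite !mulr_sumr -!big_split; apply: eq_bigr => k _; exact: pd2M.
have E2 : \sum_(k < m) lam k.+1 * x 0 k * pd k (f * g) x =
   f x * (\sum_(k < m) lam k.+1 * x 0 k * pd k g x) +
   g x * (\sum_(k < m) lam k.+1 * x 0 k * pd k f x).
  rewrite !mulr_sumr -big_split; apply: eq_bigr => k _.
  rewrite pdM; [|by case/C2P: f2|by case/C2P: g2].
  by move: (pd k f x) (pd k g x) (f x) (g x) (x 0 k) => a b c d e /=; ring.
apply: (etrans (congr2 (fun a b => 2^-1 * a - b) E1 E2)); rewrite /OU.
move=> {E1 E2}.
move: (\sum_k pd k (pd k f) x) (\sum_k pd k (pd k g) x) => a b.
move: (\sum_(k < m) lam k.+1 * x 0 k * pd k f x) => c.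
move: (\sum_(k < m) lam k.+1 * x 0 k * pd k g x) => d.
by move: (\sum_k pd k f x * pd k g x) (f x) (g x) => e y z; field.
Qed.

Lemma OU_cst (c : R) x : L (cst c) x = 0.
Proof.
rewrite /OU [X in _ * X]big1 ?mulr0 => [|k _]; last first.
  by rewrite (C1_cst c).2 (C1_cst 0).2.
by rewrite big1 ?subr0// => k _; rewrite (C1_cst c).2 mulr0.
Qed.

Lemma OU_Z (c : R) f x : C2s f -> L (cst c * f) x = c * L f x.
Proof.
move=> f2; rewrite OU_M//; last exact: C2_cst.
by rewrite OU_cst mulr0 addr0 big1 ?addr0// => k _; rewrite (C1_cst c).2 mul0r.
Qed.

Lemma C2_sum (I : Type) (s : seq I) (F : I -> 'rV[R]_m -> R) (P : pred I) :
  (forall i, P i -> C2s (F i)) -> C2s (\sum_(i <- s | P i) F i).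
Proof.
move=> h; apply: (@big_ind _ (@C2s R m)) h; last by move=> f g; exact: C2D.
exact: (C2_cst 0).
Qed.

Lemma OU_sum (I : Type) (s : seq I) (F : I -> 'rV[R]_m -> R) x :
  (forall i, C2s (F i)) -> L (\sum_(i <- s) F i) x = \sum_(i <- s) L (F i) x.
Proof.
move=> h; elim: s => [|i s IH]; first by rewrite !big_nil; exact: (OU_cst 0).
by rewrite !big_cons OU_D ?IH//; exact: C2_sum.
Qed.

Lemma C2b_C2 f : C2bs f -> C2s f. Proof. by case/C2bP. Qed.

Lemma C1_coord k : C1s (fun x : 'rV[R]_m => x 0 k) /\
  forall j, pd j (fun x : 'rV[R]_m => x 0 k) = cst (k == j)%:R.
Proof.
have c1 : continuous (cst 1 : R -> R) by exact: cst_continuous.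
have [c p] := @C1_comp_coord R m k id (cst 1) c1 (fun t => is_derive_id t 1).
split=> // j; rewrite p; apply/funext => x; rewrite fctE; exact: mulr1.
Qed.

Lemma C2_coord k : C2s (fun x : 'rV[R]_m => x 0 k).
Proof.
apply/C2P; split=> [|j]; first by case: (C1_coord k).
by rewrite (C1_coord k).2; have [] := @C1_cst R m (k == j)%:R.
Qed.

Lemma OU_coord k x : L (fun x : 'rV[R]_m => x 0 k) x = - (lam k.+1 * x 0 k).
Proof.
rewrite /OU big1 ?mulr0 ?sub0r; last first.
  by move=> j _; rewrite (C1_coord k).2 (C1_cst _).2.
rewrite (bigD1 k)//= big1 ?addr0; first by rewrite (C1_coord k).2 eqxx mulr1.
by move=> j jk; rewrite (C1_coord k).2 eq_sym (negbTE jk) mulr0.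
Qed.

Definition blockq (B : pred 'I_m) x : R := \sum_(k | B k) x 0 k ^+ 2.

Lemma blockq_ge0 B x : 0 <= blockq B x.
Proof. by apply: sumr_ge0 => k _; exact: sqr_ge0. Qed.

Definition blockE (a : R) (B : pred 'I_m) x : R := expR (- (a * blockq B x)).

Lemma blockE_gt0 a B x : 0 < blockE a B x.
Proof. exact: expR_gt0. Qed.

Lemma blockE_le1 a B x : 0 < a -> blockE a B x <= 1.
Proof.
by move=> a0; rewrite -expR0 ler_expR oppr_le0 mulr_ge0// ?blockq_ge0// ltW.
Qed.

(** The product form inherits regularity from its one-coordinate factors; the exponential form
    serves the estimates. *)
Lemma blockE_prod a B : blockE a B = \prod_(k | B k) (fun x => gmono a 0 (x 0 k)).
Proof.
apply/funext => x; rewrite /blockE /blockq mulr_sumr -sumrN expR_sum fct_prodE.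
by apply: eq_bigr => k _; rewrite /gmono mul1r.
Qed.

Lemma C2b_blockE a B : 0 < a -> C2bs (blockE a B).
Proof. by move=> a0; rewrite blockE_prod; apply: C2b_prod => k _; exact: C2b_gmono0. Qed.

Lemma blockq_line B k (h : R) x :
  blockq B (h *: delta_mx 0 k + x) = (B k)%:R * (h ^+ 2 + h * (2 * x 0 k)) + blockq B x.
Proof.
rewrite /blockq; have [Bk|nBk] := boolP (B k); last first.
  rewrite mul0r add0r; apply: eq_bigr => j Bj; rewrite !mxE eqxx /=.
  have [jk|_] := eqVneq j k; first by rewrite -jk Bj in nBk.
  by rewrite mulr0 add0r.
rewrite mul1r (bigD1 k)//= [X in _ = _ + X](bigD1 k)//= [RHS]addrA.
congr (_ + _); first by rewrite !mxE !eqxx/= mulr1; ring.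
apply: eq_bigr => j /andP[_ jk]; rewrite !mxE eqxx (negbTE jk)/=; congr (_ ^+ 2); ring.
Qed.

Lemma is_derive_blockE a B k x : is_derive x (delta_mx 0 k) (blockE a B)
  (- (2 * a) * (B k)%:R * (x 0 k * blockE a B x)).
Proof.
apply: is_derive_line0.
have -> : (fun s => blockE a B (s *: delta_mx 0 k + x)) =
  (fun s => expR (- (a * (B k)%:R) * (s ^+ 2 + s * (2 * x 0 k) + 0) - a * blockq B x)).
  by apply/funext => s; rewrite /blockE blockq_line; congr expR; ring.
have Dq := is_derive_quadratic (- (a * (B k)%:R)) (2 * x 0 k) 0 0.
have Dc := is_deriveD Dq (is_derive_cst (- (a * blockq B x)) (0 : R) 1).
apply: (@is_derive_eq _ _ _ _ _ _ _ _ (is_derive_comp1 (is_derive_expR _) Dc)).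
rewrite !fctE /blockE (_ : _ - a * blockq B x = - (a * blockq B x)); last by ring.
ring.
Qed.

Lemma pd_blockE a B k : 0 < a ->
  pd k (blockE a B) = cst (- (2 * a) * (B k)%:R) * ((fun x => x 0 k) * blockE a B).
Proof.
move=> a0; rewrite pdE; apply/funext => x.
exact: (@derive_val _ _ _ _ _ _ _ (is_derive_blockE a B k x)).
Qed.

(** The term - a times the number of coordinates of B is what large blocks exploit. For positive
    eigenvalues the other two terms are nonnegative, and the factor [blockE a B x] damps them. *)
Lemma OU_blockE a B x : 0 < a ->
  L (blockE a B) x = blockE a B x * (- a * (\sum_(k | B k) 1) + 2 * a ^+ 2 * blockq B x
     + 2 * a * (\sum_(k | B k) lam k.+1 * x 0 k ^+ 2)).
Proof.
move=> a0; have /C2P[E1 E2] := C2b_C2 (C2b_blockE B a0).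
have P k : pd k (blockE a B) x = (B k)%:R * (- (2 * a) * (x 0 k * blockE a B x)).
  by rewrite pd_blockE// !fctE mulrA [X in X * _]mulrC -mulrA.
have P2 k : pd k (pd k (blockE a B)) x = (B k)%:R *
    (blockE a B x * (- (2 * a) * 1 + 4 * a ^+ 2 * x 0 k ^+ 2)).
  have X1 := (C1_coord k).1.
  rewrite pd_blockE// (C1M (C1_cst _).1 (C1M X1 E1).1).2 (C1M X1 E1).2 (C1_cst _).2.
  rewrite (C1_coord k).2 pd_blockE// eqxx !fctE.
  by rewrite /cst /=; case: (B k); rewrite /= ?mulr1n ?mulr0n; ring.
have big_if (F : 'I_m -> R) : \sum_k (B k)%:R * F k = \sum_(k | B k) F k.
  rewrite [RHS]big_mkcond/=; apply: eq_bigr => k _.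
  by case: ifPn => _; rewrite ?mul1r ?mul0r.
rewrite /OU; under eq_bigr do rewrite P2.
under [X in _ - X]eq_bigr do rewrite P mulrCA.
rewrite !big_if.
have -> : \sum_(k | B k) lam k.+1 * x 0 k * (- (2 * a) * (x 0 k * blockE a B x)) =
  - (2 * a) * blockE a B x * (\sum_(k | B k) lam k.+1 * x 0 k ^+ 2).
  by rewrite mulr_sumr; apply: eq_bigr => k _; ring.
rewrite -mulr_sumr big_split/= -!mulr_sumr -/(blockq B x).
by field.
Qed.

End OU_calculus.

(** * Reflections and comparison on a half space *)

Section reflection.
Context {R : realType} {m : nat}.
Variable lam : nat -> R.
Implicit Types (f g u w : 'rV[R]_m -> R) (x v : 'rV[R]_m).

Definition refl (k : 'I_m) x : 'rV[R]_m :=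
  \row_i ((-1) ^+ (i == k) * x 0 i).

Lemma cvg_row (T : Type) (Fl : set_system T) {FF : Filter Fl}
    (F : T -> 'rV[R]_m) (l : 'rV[R]_m) :
  (forall i, F s 0 i @[s --> Fl] --> l 0 i) -> F s @[s --> Fl] --> l.
Proof.
move=> cF A /nbhs_ballP[e /= e0 eA].
have H : \forall s \near Fl, forall i, `|l 0 i - F s 0 i| < e.
  by apply: filter_forall => i; move/cvgrPdist_lt : (cF i); apply.
by apply: filterS H => s H; apply: eA; split => // i j; rewrite ord1; exact: H.
Qed.

Lemma continuous_row (T : topologicalType) (F : T -> 'rV[R]_m) (t : T) :
  (forall i, {for t, continuous (fun s => F s 0 i)}) -> {for t, continuous F}.
Proof. by move=> cF; exact: cvg_row. Qed.

Lemma continuous_refl k : continuous (refl k).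
Proof.
move=> x; apply: continuous_row => i.
have -> : (fun s => refl k s 0 i) = (fun s => (-1) ^+ (i == k) * s 0 i).
  by apply/funext => s; rewrite mxE.
apply: (@continuousM _ _ (cst ((-1) ^+ (i == k))) (fun s : 'rV[R]_m => s 0 i)).
  exact: cst_continuous.
exact: continuous_coord.
Qed.

Lemma C1_refl k f : C1s f -> C1s (f \o refl k) /\
  forall j, pd j (f \o refl k) = cst ((-1) ^+ (j == k)) * (pd j f \o refl k).
Proof.
move=> f1; apply: C1I.
- by move=> x; apply: continuous_comp; [exact: continuous_refl|exact: C1_continuous].
- move=> j x; apply: is_derive_line0.
  have E : (fun s => (f \o refl k) (s *: delta_mx 0 j + x)) =
           (fun s => f (s *: ((-1) ^+ (j == k) *: delta_mx 0 j) + refl k x)).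
    apply/funext => s; congr f; apply/rowP => i; rewrite !mxE eqxx/=.
    by have [->|ij] := eqVneq i j; rewrite ?mulr1 ?mulr0 ?add0r// mulrDr mulrC.
  rewrite E; apply: is_derive_line; rewrite scale0r add0r.
  apply: (@is_derive_eq _ _ _ _ _ _ _ _ (is_derive_dirZ _ (C1_is_derive j (refl k x) f1))).
  by rewrite fctE/= mulrC.
- move=> j x; apply: continuousM; first exact: cst_continuous.
  by apply: continuous_comp; [exact: continuous_refl|exact: C1_continuous_pd].
Qed.

Lemma C2_refl k f : C2s f -> C2s (f \o refl k).
Proof.
move=> /C2P[f1 f2]; apply/C2P; split=> [|j]; first by have [] := C1_refl k f1.
rewrite (C1_refl k f1).2.
by have [] := C1M (C1_cst ((-1) ^+ (j == k))).1 (C1_refl k (f2 j)).1.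
Qed.

(** Second derivatives and the drift terms x_j D_j do not see the sign of a coordinate. Hence the
    odd part of u solves the equation whose right-hand side is the odd part of f. *)
Lemma OU_refl k f x : C2s f -> OU lam (f \o refl k) x = OU lam f (refl k x).
Proof.
move=> /C2P[f1 f2]; rewrite /OU; congr (_ * _ - _).
  apply: eq_bigr => j _; rewrite (C1_refl k f1).2.
  rewrite (C1M (C1_cst ((-1) ^+ (j == k))).1 (C1_refl k (f2 j)).1).2.
  rewrite (C1_refl k (f2 j)).2 (C1_cst _).2 !fctE/= mulr0 addr0 mulrA -expr2.
  by rewrite sqrr_sign mul1r.
apply: eq_bigr => j _; rewrite (C1_refl k f1).2 !fctE/= mxE.
by rewrite -!mulrA; congr (_ * _); rewrite mulrCA.
Qed.

Lemma refl_fixed k x : x 0 k = 0 -> refl k x = x.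
Proof.
move=> xk; apply/rowP => i; rewrite mxE.
by have [->|_] := eqVneq i k; rewrite ?mul1r// xk mulr0.
Qed.

End reflection.

Section comparison.
Context {R : realType} {m : nat}.
Variable lam : nat -> R.
Hypothesis lam_ge0 : forall k : 'I_m, 0 <= lam k.+1.
Implicit Types (f g u w : 'rV[R]_m -> R) (x v : 'rV[R]_m).

Lemma pd_le0 k w : C1s w -> w 0 = 0 ->
  (forall h : R, 0 < h -> w (h *: delta_mx 0 k) <= 0) -> pd k w 0 <= 0.
Proof.
move=> w1 w0 wle.
have [+ <-] := C1_is_derive k 0 w1; rewrite /derivable => cw.
rewrite /derive; rewrite (cvg_at_rightE _ _ cw).
apply: limr_le.
  rewrite -(cvg_at_rightE _ _ cw); apply: cvg_trans cw; apply: cvg_app.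
  move=> A [e egt0 Ae]; exists e => // x xe xgt0; apply: Ae => //.
  exact/lt0r_neq0.
near=> h; rewrite /= addr0 w0 subr0.
apply: mulr_ge0_le0; last by apply: wle; near: h; exact: nbhs_right_gt.
by rewrite invr_ge0 ltW//; near: h; exact: nbhs_right_gt.
Unshelve. all: by end_near. Qed.

(** Let z be w minus the part of u odd in x_k. It vanishes on x_k = 0 and satisfies z <= L z for x_k
    > 0, so z <= 0 on the half space and D_k z(0) <= 0. The odd part of u has the same k-th
    derivative at 0 as u. *)
Lemma odd_comparison k f u w : C2s u -> bounded_fun u ->
  (forall x, u x - OU lam u x = f x) -> C2s w -> bounded_fun w ->
  (forall x, x 0 k = 0 -> w x = 0) ->
  (forall x, 0 < x 0 k -> w x - OU lam w x <= 2^-1 * (f x - f (refl k x))) ->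
  pd k w 0 <= pd k u 0.
Proof.
move=> u2 bu uE w2 bw w0 wle.
pose z := w + (cst (- 2^-1) * u + cst (2^-1) * (u \o refl k)).
have ru2 := C2_refl k u2.
have c1 := C2M (C2_cst (- 2^-1)) u2.
have c2 := C2M (C2_cst (2^-1)) ru2.
have z2 : C2s z by exact: C2D w2 (C2D c1 c2).
have zE x : z x = w x - 2^-1 * u x + 2^-1 * u (refl k x).
  by rewrite /z !fctE; ring.
have bz : bounded_fun z.
  apply: bounded_fctD => //; apply: bounded_fctD; apply: bounded_fctM;
   do ?exact: bounded_fct_cst; first exact: bu.
  move/bounded_fctP : bu => [M uM]; apply/bounded_fctP; exists M => x; exact: uM.
have OUz x : OU lam z x = OU lam w x - 2^-1 * OU lam u x + 2^-1 * OU lam u (refl k x).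
  rewrite (OU_D _ _ w2 (C2D c1 c2)) (OU_D _ _ c1 c2) (OU_Z _ _ _ u2) (OU_Z _ _ _ ru2).
  rewrite OU_refl//; ring.
have zfix x : x 0 k = 0 -> z x = 0.
  move=> xk; rewrite zE w0// refl_fixed//; ring.
have zle0 x : 0 <= x 0 k -> z x <= 0.
  apply: (max_principle lam_ge0 z2 bz (D := [set x | 0 <= x 0 k])).
    apply: (@preimage_closed _ _ (fun x : 'rV[R]_m => x 0 k) [set t | 0 <= t]).
      by move=> y _; exact: continuous_coord.
    exact: closed_ge.
  move=> {}x /= xk zx.
  have {}xk : 0 < x 0 k.
    by rewrite lt_neqAle xk andbT; apply: contraTneq zx => /esym/zfix ->; rewrite ltxx.
  split.
    have : \forall y \near x, 0 < (y : 'rV[R]_m) 0 k.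
      by move/cvgr_gt : (@continuous_coord R m k x) => /(_ 0 xk).
    by apply: filterS => y /= /ltW.
  have := wle _ xk; have := uE x; have := uE (refl k x).
  rewrite OUz zE.
  move: (u x) (u (refl k x)) (OU lam u x) (OU lam u (refl k x)) (w x) (OU lam w x).
  by move: (f x) (f (refl k x)) => *; lra.
have [w1 u1 z1] : [/\ C1s w, C1s u & C1s z].
  by split; [case/C2P: w2|case/C2P: u2|case/C2P: z2].
have : pd k z 0 <= 0.
  apply: pd_le0 => //; first by apply: zfix; rewrite mxE.
  by move=> h h0; apply: zle0; rewrite !mxE !eqxx mulr1 ltW.
have [ru1 ruE] := C1_refl k u1.
have C1c (c : R) : C1s (cst c : 'rV[R]_m -> R) by have [] := @C1_cst R m c.
have d1 := C1M (C1c (- 2^-1)) u1; have d2 := C1M (C1c (2^-1)) ru1.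
have -> : pd k z 0 = pd k w 0 - pd k u 0; last by rewrite subr_le0.
have pc (c : R) : pd k (cst c : 'rV[R]_m -> R) = cst 0 by have [_ ->] := @C1_cst R m c.
rewrite (pdD _ _ w1 (C1D d1.1 d2.1).1) (pdD _ _ d1.1 d2.1).
rewrite (pdM _ _ (C1c _) u1) (pdM _ _ (C1c _) ru1) !pc ruE !fctE/= eqxx/=.
rewrite refl_fixed ?mxE//.
by move: (pd k w 0) (pd k u 0) => *; field.
Qed.

End comparison.

(** * Inequalities for products of factors 1 - e_i *)

Section real_facts.
Context {R : realType}.

(** The last bound is the Weierstrass product inequality; it stays true, with a negative left side,
    when the sum exceeds 1. *)
Lemma prod_onem_ge (I : eqType) (s : seq I) (e : I -> R) :
  (forall i, i \in s -> 0 <= e i <= 1) ->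
  [/\ 0 <= \prod_(i <- s) (1 - e i), \prod_(i <- s) (1 - e i) <= 1 &
  1 - \sum_(i <- s) e i <= \prod_(i <- s) (1 - e i)].
Proof.
elim: s => [|i s IH] h; first by rewrite !big_nil subr0.
have /andP[e0 e1] := h i (mem_head _ _).
have [|p0 p1 ps] := IH; first by move=> j js; apply: h; rewrite inE js orbT.
rewrite !big_cons; set p := \prod_(_ <- _) _ in p0 p1 ps *.
set q := \sum_(_ <- _) _ in ps *.
split; [by rewrite mulr_ge0// subr_ge0| |].
  have : 0 <= e i * p by rewrite mulr_ge0.
  by rewrite mulrBl mul1r; lra.
have : e i * p <= e i by rewrite ler_piMr.
by rewrite mulrBl mul1r; lra.
Qed.

(** The j-th summand is the probability that j is the last success among independent trials with
    success probabilities e_i. The sum is the probability of some success, 1 - prod (1 - e_i). *)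
Lemma telescope_cascade (J : nat) (e : nat -> R) :
  (forall i, (i < J)%N -> 0 <= e i <= 1) ->
  \sum_(0 <= j < J) e j * \prod_(j.+1 <= i < J) (1 - e i) <= 1.
Proof.
move=> h.
suff -> : \sum_(0 <= j < J) e j * \prod_(j.+1 <= i < J) (1 - e i) =
    1 - \prod_(0 <= i < J) (1 - e i).
  have [|p0 _ _] := @prod_onem_ge _ (index_iota 0 J) e.
    by move=> i; rewrite mem_index_iota => /h.
  by rewrite gerBl.
clear h; elim: J => [|J IH]; first by rewrite !big_geq// subrr.
rewrite big_nat_recr//= [\prod_(J.+1 <= i < J.+1) _]big_geq// mulr1.
rewrite [in RHS]big_nat_recr//=.
have -> : \sum_(0 <= i < J) e i * \prod_(i.+1 <= i0 < J.+1) (1 - e i0) =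
    (\sum_(0 <= j < J) e j * \prod_(j.+1 <= i < J) (1 - e i)) * (1 - e J).
  rewrite mulr_suml; apply: eq_big_nat => i /andP[_ iJ].
  by rewrite big_nat_recr//= mulrA.
rewrite IH; ring.
Qed.

Lemma mul_expRN_le1 (z : R) : z * expR (- z) <= 1.
Proof.
rewrite expRN ler_pdivrMr ?expR_gt0// mul1r.
by rewrite (le_trans _ (expR_ge1Dx z))// lerDr.
Qed.

End real_facts.

(** * The odd bump x_k exp(- mu x_k^2 / 2) *)

Section gbump.
Context {R : realType} {m : nat}.
Variable lam : nat -> R.
Implicit Types (f g u w : 'rV[R]_m -> R) (x v : 'rV[R]_m).

Lemma pd_sum (I : Type) (s : seq I) (F : I -> 'rV[R]_m -> R) k x :
  (forall i, C1s (F i)) ->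
  C1s (\sum_(i <- s) F i) /\ pd k (\sum_(i <- s) F i) x = \sum_(i <- s) pd k (F i) x.
Proof.
move=> h; elim: s => [|i s [IH1 IH2]].
  rewrite !big_nil; have [c1 /(_ k) c2] := @C1_cst R m 0.
  by split=> //; exact: (congr1 (@^~ x) c2).
rewrite !big_cons; split; first by have [] := C1D (h i) IH1.
by rewrite pdD// IH2.
Qed.

Lemma pd_blockE0 a (B : pred 'I_m) l x : 0 < a -> ~~ B l -> pd l (blockE a B) x = 0.
Proof.
by move=> a0 nBl; rewrite pd_blockE// !fctE (negbTE nBl) /= mulr0 mul0r.
Qed.

Definition gbump (mu : R) k x : R := gmono (mu / 2) 1 (x 0 k).

Lemma C2b_gbump mu k : 0 < mu -> C2bs (gbump mu k).
Proof. by move=> mu0; apply: C2b_gmono1; rewrite divr_gt0. Qed.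

Lemma gbumpE mu k : gbump mu k = (fun x => x 0 k) * blockE (mu / 2) (pred1 k).
Proof.
by apply/funext => x; rewrite fctE /gbump /gmono expr1 /blockE /blockq (big_pred1 k)//.
Qed.

Lemma gbump_ge0 mu k x : 0 <= x 0 k -> 0 <= gbump mu k x.
Proof. by move=> xk; rewrite /gbump /gmono mulr_ge0 ?expr1 ?expR_ge0. Qed.

(** With t = sqrt(mu) |x_k| this is t <= exp(t^2 / 2), which follows from t <= 1 + t^2 / 2. *)
Lemma gbump_le mu k x : 0 < mu -> `|Num.sqrt mu * gbump mu k x| <= 1.
Proof.
move=> mu0; rewrite /gbump /gmono expr1 mulrA normrM [X in _ * X]ger0_norm ?expR_ge0//.
rewrite expRN ler_pdivrMr ?expR_gt0// mul1r (le_trans _ (expR_ge1Dx _))//.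
rewrite -[X in X / 2](sqr_sqrtr (ltW mu0)).
rewrite mulrAC -exprMn -real_normK ?num_real//.
move: (`|_|) => t; have := sqr_ge0 (t - 1); rewrite sqrrB1 -mulr_natr; lra.
Qed.

Lemma pd_gbump mu k l x : 0 < mu ->
  pd l (gbump mu k) x = (k == l)%:R * ((1 - mu * x 0 k ^+ 2) * blockE (mu / 2) (pred1 k) x).
Proof.
move=> mu0; have mu2 : 0 < mu / 2 by rewrite divr_gt0.
have [c1 cE] := @C1_coord R m k.
have /C2P[E1 _] := C2b_C2 (@C2b_blockE R m (mu / 2) (pred1 k) mu2).
rewrite gbumpE (pdM _ _ c1 E1) cE pd_blockE// !fctE/= [l == k]eq_sym.
have [->|_] := eqVneq k l; rewrite /cst/= ?mulr1n ?mulr0n; by field.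
Qed.

(** Of the 5/2, half the second derivative contributes 3/2 and the drift contributes 1. The
    quadratic term has a favourable sign where x_k > 0. *)
Lemma OU_gbump (k : 'I_m) x : 0 < lam k.+1 -> OU lam (gbump (lam k.+1) k) x =
  gbump (lam k.+1) k x * (- (5 / 2) * lam k.+1 + 3 / 2 * lam k.+1 ^+ 2 * x 0 k ^+ 2).
Proof.
set mu := lam k.+1 => mu0; have mu2 : 0 < mu / 2 by rewrite divr_gt0.
have [c1 cE] := @C1_coord R m k.
have E2 := C2b_C2 (@C2b_blockE R m (mu / 2) (pred1 k) mu2).
rewrite gbumpE (OU_M lam x (C2_coord k) E2) OU_coord -/mu OU_blockE//.
have bp (F : 'I_m -> R) : \sum_(j | pred1 k j) F j = F k by exact: big_pred1_eq.
rewrite /blockq !bp -/mu (bigD1 k)//= big1; last first.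
  by move=> j jk; rewrite cE /cst eq_sym (negbTE jk) mul0r.
rewrite addr0 cE pd_blockE// !fctE/= eqxx/= mulr1n.
by move: (blockE _ _ x) (x 0 k) => *; field.
Qed.

End gbump.

(** * The test function and its subsolutions *)

Section cascade.
Context {R : realType} {m : nat}.
Variable lam : nat -> R.
Hypothesis lam_gt0 : forall k : 'I_m, 0 < lam k.+1.
Variables (J N : nat) (B : nat -> pred 'I_m) (kk : nat -> 'I_m) (La : nat -> R).
Local Notation mu j := (lam (kk j).+1).
Hypothesis N_ge : (8 * J <= N)%N.
Hypothesis N_gt0 : (0 < N)%N.
Hypothesis La_gt0 : forall i, 0 < La i.
Hypothesis cardB : forall j, (j < J)%N -> \sum_(k | B j k) 1 = N%:R :> R.
Hypothesis lamB : forall j l, (j < J)%N -> B j l -> lam l.+1 <= La j.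
Hypothesis disjB : forall i j l, (i < j < J)%N -> B i l -> ~~ B j l.
Hypothesis kkB : forall i j, (i < J)%N -> (j < J)%N -> ~~ B i (kk j).
Hypothesis kk_inj : forall i j, (i < J)%N -> (j < J)%N -> kk i = kk j -> i = j.
Hypothesis mu_ge1 : forall j, (j < J)%N -> 1 <= mu j.
Hypothesis mu_ge : forall j, (j < J)%N -> La j * N%:R <= mu j.
Hypothesis La_ge : forall i j, (j < i < J)%N -> 4 * mu j <= La i.
Implicit Types (f g u w : 'rV[R]_m -> R) (x v : 'rV[R]_m).

Definition block_gauss j : 'rV[R]_m -> R := blockE (La j) (B j).

(* Written as a product of functions, rather than pointwise, so that the closure
   lemmas for [C2bs] apply. *)
Definition outer_factor j : 'rV[R]_m -> R :=
  \prod_(j.+1 <= i < J) (cst 1 + cst (-1) * block_gauss i).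

Definition cascade_term j : 'rV[R]_m -> R :=
  cst (Num.sqrt (mu j)) * (gbump (mu j) (kk j) * (block_gauss j * outer_factor j)).

Definition cascade : 'rV[R]_m -> R := \sum_(0 <= j < J) cascade_term j.

Lemma block_gauss01 i x : 0 <= block_gauss i x <= 1.
Proof. by rewrite blockE_le1// ltW// blockE_gt0. Qed.

Lemma C2b_block_gauss j : C2bs (block_gauss j).
Proof. exact: C2b_blockE. Qed.

Lemma C2b_outer_factor j : C2bs (outer_factor j).
Proof.
apply: C2b_prod => i _; apply: C2bD; first exact: C2b_cst.
by apply: C2bM; [exact: C2b_cst|exact: C2b_block_gauss].
Qed.

Lemma outer_factorE j x : outer_factor j x = \prod_(j.+1 <= i < J) (1 - block_gauss i x).
Proof.
rewrite /outer_factor fct_prodE; apply: eq_bigr => i _.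
by rewrite !fctE mulN1r.
Qed.

Lemma C2b_cascade_term j : C2bs (cascade_term j).
Proof.
apply: C2bM; first exact: C2b_cst.
apply: C2bM; first exact: C2b_gbump.
by apply: C2bM; [exact: C2b_block_gauss|exact: C2b_outer_factor].
Qed.

Lemma C2b_cascade : C2bs cascade.
Proof. by apply: C2b_sum => j _; exact: C2b_cascade_term. Qed.

Lemma cascade_termE j x : cascade_term j x = Num.sqrt (mu j) * gbump (mu j) (kk j) x *
   (block_gauss j x * \prod_(j.+1 <= i < J) (1 - block_gauss i x)).
Proof. by rewrite /cascade_term !fctE outer_factorE; exact: mulrA. Qed.

Lemma cascadeE x : cascade x = \sum_(0 <= j < J) cascade_term j x.
Proof. by rewrite /cascade fct_sumE. Qed.

Lemma outer_factor_bounds j x : [/\ 0 <= \prod_(j.+1 <= i < J) (1 - block_gauss i x),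
  \prod_(j.+1 <= i < J) (1 - block_gauss i x) <= 1 &
  1 - \sum_(j.+1 <= i < J) block_gauss i x <= \prod_(j.+1 <= i < J) (1 - block_gauss i x)].
Proof. by apply: prod_onem_ge => i _; exact: block_gauss01. Qed.

Lemma cascade_le1 x : `|cascade x| <= 1.
Proof.
rewrite cascadeE (le_trans (ler_norm_sum _ _ _))//.
apply: le_trans (@telescope_cascade R J (fun j => block_gauss j x) _); last first.
  by move=> i _; exact: block_gauss01.
apply: ler_sum => j _; rewrite cascade_termE normrM.
have [p0 _ _] := outer_factor_bounds j x; have /andP[e0 _] := block_gauss01 j x.
rewrite [X in _ * X]ger0_norm; last exact: mulr_ge0.
by rewrite ler_piMl ?mulr_ge0// gbump_le.
Qed.

Lemma blockE_refl a (A : pred 'I_m) k x : blockE a A (refl k x) = blockE a A x.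
Proof.
rewrite /blockE /blockq; congr (expR (- (a * _))); apply: eq_bigr => i _.
by rewrite mxE exprMn sqrr_sign mul1r.
Qed.

Lemma gbump_refl b i k x : gbump b i (refl k x) = (-1) ^+ (i == k) * gbump b i x.
Proof.
rewrite /gbump /gmono mxE !expr1; have := @sqrr_sign R (i == k).
by move: ((-1) ^+ _) => s s2; rewrite [in LHS]exprMn s2 mul1r -[LHS]mulrA.
Qed.

(** Block Gaussians are even in every coordinate and the [kk i] are distinct for i < J, so only the
    j-th bump changes sign and all other terms cancel. *)
Lemma cascade_refl j x : (j < J)%N ->
  2^-1 * (cascade x - cascade (refl (kk j) x)) = cascade_term j x.
Proof.
move=> jJ; rewrite !cascadeE -sumrB.
have jin : j \in index_iota 0 J by rewrite mem_index_iota.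
rewrite (bigD1_seq j jin (iota_uniq _ _))/=.
have tl i : cascade_term i (refl (kk j) x) = (-1) ^+ (kk i == kk j) * cascade_term i x.
  rewrite !cascade_termE gbump_refl /block_gauss blockE_refl.
  under eq_bigr do rewrite blockE_refl.
  rewrite -[RHS]/(_ * (_ * _ * (blockE (La i) (B i) x * _))).
  move: ((-1) ^+ _) (Num.sqrt _) (gbump _ _ x) (blockE _ _ x) => s a b c.
  by move: (\prod_(_ <= _ < _) _) => d; ring.
rewrite big_seq_cond big1 => [|i /andP[iin ij]].
  by rewrite tl eqxx/= addr0; field.
rewrite mem_index_iota/= in iin.
rewrite tl; have [kij|_] := eqVneq (kk i) (kk j); last by rewrite mul1r subrr.
by rewrite (kk_inj iin jJ kij) eqxx in ij.
Qed.

(** Inside the block the eigenvalues are at most La_i, so with z = La_i |x_B|^2 the two positive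
    terms of [OU_blockE], after division by La_i, are at most 4 z exp(- z) <= 4. *)
Lemma OU_block_gauss_le i x : (i < J)%N ->
  (La i)^-1 * OU lam (block_gauss i) x <= 4 - N%:R * block_gauss i x.
Proof.
move=> iJ; rewrite OU_blockE// cardB//.
set E := blockE _ _ _; have E0 : 0 <= E by rewrite ltW// blockE_gt0.
set q := blockq _ _.
have qle : \sum_(k < m | B i k) lam k.+1 * x 0 k ^+ 2 <= La i * q.
  rewrite /q /blockq mulr_sumr; apply: ler_sum => l Bl.
  by rewrite ler_wpM2r ?sqr_ge0// lamB.
have z1 : La i * q * E <= 1 by exact: mul_expRN_le1.
have L0 := La_gt0 i.
rewrite -/(block_gauss i x) (_ : block_gauss i x = E)//.
apply: (@le_trans _ _ ((La i)^-1 *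
  (E * (- La i * N%:R + 2 * La i ^+ 2 * q + 2 * La i * (La i * q))))).
  by rewrite ler_pM2l ?invr_gt0// ler_wpM2l// lerD2l ler_pM2l// mulr_gt0.
have -> : (La i)^-1 * (E * (- La i * N%:R + 2 * La i ^+ 2 * q + 2 * La i * (La i * q))) =
    4 * (La i * q * E) - N%:R * E.
  move: L0; rewrite lt0r => /andP[Ln0 _]; clearbody E q.
  by move: (La i) (N%:R : R) Ln0 => L n Ln0; field.
by lra.
Qed.

(** Drops the two nonnegative terms of [OU_blockE]. What remains is a decay rate N La_j, hence at
    most mu_j. *)
Lemma OU_block_gauss_ge j x : (j < J)%N ->
  - (La j * N%:R) * block_gauss j x <= OU lam (block_gauss j) x.
Proof.
move=> jJ; rewrite OU_blockE// cardB//.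
have E0 : 0 <= blockE (La j) (B j) x by rewrite ltW// blockE_gt0.
have q0 : 0 <= blockq (B j) x by exact: blockq_ge0.
have S0 : 0 <= \sum_(k < m | B j k) lam k.+1 * x 0 k ^+ 2.
  by apply: sumr_ge0 => k _; rewrite mulr_ge0 ?sqr_ge0// ltW.
have L0 := La_gt0 j.
rewrite /block_gauss; move: (blockE _ _ _) (blockq _ _) (\sum_(_ | _) _) E0 q0 S0 => E q S E0 q0 S0.
rewrite -subr_ge0.
have -> : E * (- La j * N%:R + 2 * La j ^+ 2 * q + 2 * La j * S) - - (La j * N%:R) * E =
    E * (2 * La j ^+ 2 * q + 2 * La j * S) by ring.
by rewrite mulr_ge0// addr_ge0// mulr_ge0// mulr_ge0 ?sqr_ge0// ltW.
Qed.

Section barrier_estimates.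
Variable j : nat.
Hypothesis jJ : (j < J)%N.

(* On the half space [0 < x_(k_j)], [L (g E_j) >= (1 - barrier_rate) g E_j] for the
   bump [g]: the bump contributes [5/2 mu_j] and the block [N La_j]. *)
Definition barrier_rate : R := 1 + 5 / 2 * mu j + La j * N%:R.
(** Scaled so that the terms - N E_i in the bounds for L E_i / La_i become - 2 [barrier_rate] E_i,
    which is what replacing prod (1 - E_i) by 1 - sum E_i costs in [barrier_subsolution]. *)
Definition corrector_coef : R := 2 * barrier_rate / N%:R.
Definition corrector_sum : 'rV[R]_m -> R := \sum_(j.+1 <= i < J) (cst (La i)^-1 * block_gauss i).
Definition corrector : 'rV[R]_m -> R := cst 1 + cst (- corrector_coef) * corrector_sum.
(** The normalization 1 / (2 [barrier_rate]) pays once for the decay of bump and block under L and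
    once for the constant term in the bound on - L [corrector]. *)
Definition barrier : 'rV[R]_m -> R :=
  cst ((2 * barrier_rate)^-1 * Num.sqrt (mu j)) *
  (gbump (mu j) (kk j) * (block_gauss j * corrector)).

Lemma barrier_rate_gt0 : 0 < barrier_rate.
Proof.
rewrite /barrier_rate; have := mu_ge1 jJ; have : 0 <= La j * N%:R by rewrite mulr_ge0// ltW.
by lra.
Qed.

Lemma barrier_rate_le : barrier_rate <= 9 / 2 * mu j.
Proof. by rewrite /barrier_rate; have := mu_ge1 jJ; have := mu_ge jJ; lra. Qed.

Lemma C2b_corrector_sum : C2bs corrector_sum.
Proof.
by apply: C2b_sum => i _; apply: C2bM; [exact: C2b_cst|exact: C2b_block_gauss].
Qed.

Lemma C2b_corrector : C2bs corrector.
Proof.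
apply: C2bD; first exact: C2b_cst.
by apply: C2bM; [exact: C2b_cst|exact: C2b_corrector_sum].
Qed.

Lemma C2b_barrier : C2bs barrier.
Proof.
apply: C2bM; first exact: C2b_cst.
apply: C2bM; first exact: C2b_gbump.
by apply: C2bM; [exact: C2b_block_gauss|exact: C2b_corrector].
Qed.

Lemma corrector_sumE x : corrector_sum x = \sum_(j.+1 <= i < J) (La i)^-1 * block_gauss i x.
Proof. by rewrite /corrector_sum fct_sumE. Qed.

Lemma correctorE x : corrector x = 1 - corrector_coef * corrector_sum x.
Proof. by rewrite /corrector !fctE mulNr. Qed.

Lemma natN_gt0 : 0 < N%:R :> R. Proof. by rewrite ltr0n. Qed.

Lemma sum_nat_leJ (c : R) : 0 <= c -> \sum_(j.+1 <= i < J) c <= c * J%:R.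
Proof.
move=> c0; rewrite big_const_nat iter_addr_0 -[leLHS]mulr_natr ler_wpM2l// ler_nat.
exact: leq_subr.
Qed.

Lemma natJ_le : 8 * J%:R <= N%:R :> R.
Proof. by rewrite -natrM ler_nat. Qed.

(** Each La_i is at least 4 mu_j, so the subtracted part is at most (2 [barrier_rate] / N) J / (4
    mu_j) <= 9 J / (4 N) <= 9/32. *)
Lemma corrector_bounds x : 2^-1 <= corrector x <= 1.
Proof.
have T0 := barrier_rate_gt0; have N0 := natN_gt0.
have C0 : 0 < corrector_coef by rewrite /corrector_coef divr_gt0// mulr_gt0.
have H0 : 0 <= corrector_sum x.
  rewrite corrector_sumE; apply: sumr_ge0 => i _; rewrite mulr_ge0 ?invr_ge0 ?(ltW (La_gt0 i))//.
  by have /andP[] := block_gauss01 i x.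
have mu0 := lam_gt0 (kk j).
have H1 : corrector_sum x <= (4 * mu j)^-1 * J%:R.
  apply: le_trans (sum_nat_leJ _); last by rewrite invr_ge0 mulr_ge0// ltW.
  rewrite corrector_sumE big_nat_cond [leRHS]big_nat_cond.
  apply: ler_sum => i /andP[/andP[ji iJ] _].
  have /andP[e0 e1] := block_gauss01 i x.
  apply: (@le_trans _ _ (La i)^-1); first by rewrite ler_piMr// invr_ge0 ltW.
  by rewrite lef_pV2 ?posrE ?mulr_gt0// La_ge// ji iJ.
rewrite correctorE gerBl (mulr_ge0 (ltW C0) H0) andbT lerBrDr -lerBrDl.
apply: (@le_trans _ _ (corrector_coef * ((4 * mu j)^-1 * J%:R))); first by rewrite ler_pM2l.
rewrite /corrector_coef (_ : _ * _ = (barrier_rate * J%:R) / (2 * mu j * N%:R)); last first.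
  by field; rewrite ?gt_eqF.
rewrite ler_pdivrMr ?mulr_gt0//.
have := barrier_rate_le; have := natJ_le; have J0 : 0 <= J%:R :> R by [].
by move: T0 N0 mu0 J0; set T := barrier_rate; set b := lam _; nra.
Qed.

(** The at most J constants 4 from [OU_block_gauss_le] add up, after scaling, to 8 J [barrier_rate]
    / N, and 8 J <= N. *)
Lemma OU_corrector x : - OU lam corrector x <=
  barrier_rate - 2 * barrier_rate * \sum_(j.+1 <= i < J) block_gauss i x.
Proof.
have T0 := barrier_rate_gt0; have N0 := natN_gt0.
have cE2 i := C2b_C2 (C2b_block_gauss i).
have -> : OU lam corrector x =
    - corrector_coef * \sum_(j.+1 <= i < J) (La i)^-1 * OU lam (block_gauss i) x.
  rewrite /corrector (OU_D _ _ (C2_cst _) (C2M (C2_cst _) (C2b_C2 C2b_corrector_sum))).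
  rewrite OU_cst add0r (OU_Z _ _ _ (C2b_C2 C2b_corrector_sum)); congr (_ * _).
  rewrite /corrector_sum OU_sum; last by move=> i; apply: C2M; [exact: C2_cst|exact: cE2].
  by apply: eq_bigr => i _; rewrite OU_Z.
rewrite mulNr opprK.
have C0 : 0 < corrector_coef by rewrite /corrector_coef divr_gt0// mulr_gt0.
apply: (@le_trans _ _ (corrector_coef * (4 * J%:R - N%:R * \sum_(j.+1 <= i < J) block_gauss i x))).
  rewrite ler_pM2l//.
  apply: (@le_trans _ _ (\sum_(j.+1 <= i < J) (4 - N%:R * block_gauss i x))).
    rewrite big_nat_cond [leRHS]big_nat_cond; apply: ler_sum => i /andP[/andP[ji iJ] _].
    exact: OU_block_gauss_le.
  by rewrite sumrB mulr_sumr lerD2r sum_nat_leJ.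
rewrite mulrBr [corrector_coef * (N%:R * _)]mulrA.
rewrite (_ : corrector_coef * N%:R = 2 * barrier_rate); last by rewrite /corrector_coef divfK// gt_eqF.
rewrite lerD2r /corrector_coef mulrAC ler_pdivrMr//.
have := natJ_le; move: T0 N0; set T := barrier_rate; nra.
Qed.

Lemma C2b_C1 f : C2bs f -> C1s f.
Proof. by move=> /C2b_C2 /C2P[]. Qed.

Lemma pd_corrector0 l x : (forall i, (j < i < J)%N -> ~~ B i l) -> pd l corrector x = 0.
Proof.
move=> nB.
have cE1 i := C2b_C1 (C2b_block_gauss i).
have H1 := C2b_C1 C2b_corrector_sum.
have C1c (c : R) : C1s (cst c : 'rV[R]_m -> R) by have [] := @C1_cst R m c.
have pc (c : R) y : pd l (cst c : 'rV[R]_m -> R) y = 0.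
  by have [_ ->] := @C1_cst R m c.
have c1 : C1s (cst (- corrector_coef) * corrector_sum).
  by have [] := C1M (C1c (- corrector_coef)) H1.
rewrite /corrector (pdD _ _ (C1c _) c1) (pdM _ _ (C1c _) H1) !pc mulr0 addr0 add0r.
have [|_ ->] := @pd_sum R m nat (index_iota j.+1 J) (fun i => cst (La i)^-1 * block_gauss i) l x.
  by move=> i; have [] := C1M (C1c (La i)^-1) (cE1 i).
rewrite big_nat_cond big1 ?mulr0// => i /andP[ij _].
by rewrite (pdM _ _ (C1c _) (cE1 i)) pc mulr0 addr0 pd_blockE0 ?mulr0// nB.
Qed.

(** The gradient product vanishes because block j shares no coordinate with the later blocks. *)
Lemma OU_block_gaussM x : OU lam (block_gauss j * corrector) x =
  block_gauss j x * OU lam corrector x + corrector x * OU lam (block_gauss j) x.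
Proof.
rewrite (OU_M _ _ (C2b_C2 (C2b_block_gauss j)) (C2b_C2 C2b_corrector)) big1 ?addr0// => l _.
have [Bl|nBl] := boolP (B j l); last by rewrite pd_blockE0 ?mul0r.
by rewrite pd_corrector0 ?mulr0// => i /disjB; apply.
Qed.

Lemma pd_block_gaussM0 x : pd (kk j) (block_gauss j * corrector) x = 0.
Proof.
rewrite (pdM _ _ (C2b_C1 (C2b_block_gauss j)) (C2b_C1 C2b_corrector)) pd_corrector0; last first.
  by move=> i /andP[_ iJ]; exact: kkB.
by rewrite pd_blockE0 ?mulr0 ?addr0//; exact: kkB.
Qed.

(** Write T for [barrier_rate] and M for [corrector]. Up to common nonnegative factors the claim is
    M T - L M <= 2 T prod (1 - E_i). *)
Lemma barrier_subsolution x : 0 < x 0 (kk j) -> barrier x - OU lam barrier x <= cascade_term j x.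
Proof.
move=> xk; have T0 := barrier_rate_gt0.
have b2 := C2b_C2 (C2b_gbump (kk j) (lam_gt0 (kk j))).
have EM2 := C2b_C2 (C2bM (C2b_block_gauss j) C2b_corrector).
rewrite /barrier (OU_Z _ _ _ (C2M b2 EM2)) (OU_M _ _ b2 EM2) OU_block_gaussM OU_gbump//.
rewrite (bigD1 (kk j))//= big1 => [|l lk]; last first.
  by rewrite pd_gbump// eq_sym (negbTE lk) mul0r mul0r.
rewrite pd_block_gaussM0 mulr0 !addr0 cascade_termE !fctE.
have /andP[M0 M1] := corrector_bounds x; have /andP[E0 E1] := block_gauss01 j x.
have [_ _ P] := outer_factor_bounds j x.
have b0 := gbump_ge0 (mu j) (ltW xk).
have s0 : 0 <= Num.sqrt (mu j) by exact: sqrtr_ge0.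
have OM := OU_corrector x; have OE := OU_block_gauss_ge x jJ.
move: M0 M1 E0 E1 P b0 s0 OM OE.
set M := corrector x; set E := block_gauss j x; set p := \prod_(_ <= _ < _) _.
set S := \sum_(_ <= _ < _) _; set b := gbump _ _ x; set s := Num.sqrt _.
move: (OU lam corrector x) (OU lam (block_gauss j) x) => OM OE M0 M1 E0 E1 P b0 s0 hM hE.
have MM : 0 <= M by rewrite (le_trans _ M0)// invr_ge0.
have cs0 : 0 <= (2 * barrier_rate)^-1 * s by rewrite mulr_ge0// invr_ge0 mulr_ge0// ltW.
have X0 : 0 <= 3 / 2 * mu j ^+ 2 * x 0 (kk j) ^+ 2.
  by rewrite mulr_ge0 ?sqr_ge0// mulr_ge0 ?sqr_ge0.
(* Bump and block decay at rate at most T - 1, and the term u of u - L u supplies the 1. The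
   nonnegative slack consists of the quadratic term of [OU_gbump] and the gap in
   [OU_block_gauss_ge]. *)
apply: (@le_trans _ _ ((2 * barrier_rate)^-1 * s * (b * (E * (M * barrier_rate - OM))))).
  rewrite -subr_ge0; move: hE cs0 X0; rewrite /barrier_rate.
  set X := (3 / 2 * mu j ^+ 2 * x 0 (kk j) ^+ 2).
  move: X => X; move: (La j * N%:R) (mu j) => l t.
  move: ((2 * _)^-1 * s) => cs hE cs0 X0.
  set d := _ - _.
  have -> : d = cs * (b * (E * M * X + M * (OE - - l * E))) by rewrite /d; ring.
  have h1 : 0 <= E * M * X by rewrite mulr_ge0// mulr_ge0.
  have h2 : 0 <= M * (OE - - l * E) by rewrite mulr_ge0// subr_ge0.
  by rewrite (mulr_ge0 cs0)// (mulr_ge0 b0)// addr_ge0.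
have -> : (2 * barrier_rate)^-1 * s * (b * (E * (M * barrier_rate - OM))) =
    s * b * (E * ((M * barrier_rate - OM) / (2 * barrier_rate))).
  by field; rewrite gt_eqF.
(* Since M <= 1, [OU_corrector] gives M T - L M <= 2 T (1 - sum E_i), and the Weierstrass inequality
   [P] concludes. *)
apply: (ler_wpM2l (mulr_ge0 s0 b0)); apply: (ler_wpM2l E0).
rewrite (le_trans _ P)// ler_pdivrMr ?mulr_gt0//.
have : M * barrier_rate <= barrier_rate by rewrite ler_piMl// ltW.
by move: hM; lra.
Qed.

Lemma barrier_eq0 x : x 0 (kk j) = 0 -> barrier x = 0.
Proof. by move=> xk; rewrite /barrier !fctE /gbump /gmono xk expr1 mul0r mul0r mulr0. Qed.

(** The bump vanishes at 0 with derivative 1 and E_j(0) = 1, so the derivative is sqrt(mu_j) M(0) /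
    (2 T), with T = [barrier_rate] and M = [corrector]. Then M(0) >= 1/2 and T <= 9/2 mu_j give 18 =
    4 * 9/2. *)
Lemma pd_barrier : (18 * Num.sqrt (mu j))^-1 <= pd (kk j) barrier 0.
Proof.
have b1 := C2b_C1 (C2b_gbump (kk j) (lam_gt0 (kk j))).
have EM1 := C2b_C1 (C2bM (C2b_block_gauss j) C2b_corrector).
have bEM1 := (C1M b1 EM1).1.
have [c1 pcE] := @C1_cst R m ((2 * barrier_rate)^-1 * Num.sqrt (mu j)).
have := corrector_bounds 0; have T0 := barrier_rate_gt0;
have Tle := barrier_rate_le; have mu0 := lam_gt0 (kk j).
rewrite /barrier (pdM _ _ c1 bEM1) pcE (pdM _ _ b1 EM1) pd_block_gaussM0 pd_gbump// eqxx.
rewrite !fctE /cst/= mxE expr0n/= !mulr0 subr0 add0r addr0 !mul1r.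
have B0 a (A : pred 'I_m) : blockE a A 0 = 1.
  rewrite /blockE /blockq big1 ?mulr0 ?oppr0 ?expR0// => i _.
  by rewrite mxE expr0n.
rewrite /block_gauss !B0 mul1r mulr1 => /andP[M0 _].
set s := Num.sqrt _; have s0 : 0 < s by rewrite sqrtr_gt0.
have s2 : s ^+ 2 = mu j by rewrite sqr_sqrtr// ltW.
apply: (@le_trans _ _ ((2 * barrier_rate)^-1 * s * 2^-1)); last first.
  by rewrite ler_pM2l// mulr_gt0// invr_gt0 mulr_gt0.
rewrite (_ : _ * 2^-1 = s / (4 * barrier_rate)); last by field; rewrite gt_eqF.
rewrite ler_pdivlMr ?mulr_gt0// mulrC ler_pdivrMr ?mulr_gt0//.
by move: Tle; rewrite -s2; lra.
Qed.

End barrier_estimates.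

(** Here 324 = 18^2. As the [kk j] are distinct, the J lower bounds concern different summands of a
    sum of nonnegative terms. *)
Lemma sum_pd_ge u : C2s u -> bounded_fun u ->
  (forall x, u x - OU lam u x = cascade x) ->
  J%:R / 324 <= \sum_(k < m) lam k.+1 * pd k u 0 ^+ 2.
Proof.
move=> u2 bu uE.
have key j : (j < J)%N -> 324^-1 <= mu j * pd (kk j) u 0 ^+ 2.
  move=> jJ.
  have /C2bP[v2 bv _ _] := C2b_barrier j.
  have h : pd (kk j) (barrier j) 0 <= pd (kk j) u 0.
    apply: (odd_comparison _ u2 bu uE v2 bv).
    - by move=> k; rewrite ltW.
    - exact: barrier_eq0.
    - by move=> x xk; rewrite cascade_refl//; exact: barrier_subsolution.
  have {}h := le_trans (pd_barrier jJ) h.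
  have mu0 := lam_gt0 (kk j).
  set s := Num.sqrt (mu j) in h; have s0 : 0 < s by rewrite sqrtr_gt0.
  have s2 : s ^+ 2 = mu j by rewrite sqr_sqrtr// ltW.
  rewrite (_ : 324^-1 = mu j * (18 * s)^-1 ^+ 2); last first.
    by rewrite -s2; field; rewrite gt_eqF.
  rewrite ler_pM2l// lerXn2r// ?nnegrE ?invr_ge0 ?mulr_ge0 ?ltW//.
  by rewrite (lt_le_trans _ h)// invr_gt0 mulr_gt0.
pose h (i : 'I_J) := kk i.
have hinj : injective h.
  by move=> a b ab; apply/val_inj; exact: (kk_inj (ltn_ord a) (ltn_ord b) ab).
pose F (k : 'I_m) := lam k.+1 * pd k u 0 ^+ 2.
have F0 k : 0 <= F k by rewrite mulr_ge0 ?sqr_ge0// ltW.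
apply: (@le_trans _ _ (\sum_(i < J) F (h i))).
  rewrite -[J in leLHS]card_ord mulrC mulr_natr -sumr_const.
  by apply: ler_sum => i _; exact: key.
have -> : \sum_(i < J) F (h i) = \sum_(i in [set: 'I_J]%SET) F (h i).
  by apply: eq_bigl => i; rewrite finset.in_setT.
rewrite -(big_imset (h := h) (A := [set: 'I_J]%SET) F)/=; last by move=> a b _ _; exact: hinj.
rewrite [leRHS](bigID [in [set h i | i in [set: 'I_J]]%SET])/= lerDl.
by apply: sumr_ge0 => i _; exact: F0.
Qed.

End cascade.

(** * Integrals depending on a parameter *)

Section measurability.
Context {R : realType} {m : nat}.

(** An open set of row vectors is a countable union of boxes with rational centre and radius, and
    the preimage of a box is a finite intersection of preimages under the X_i. *)
Lemma measurable_fun_row d (T : measurableType d) (X : 'I_m -> T -> R)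
    (f : 'rV[R]_m -> R) : (forall i, measurable_fun setT (X i)) -> continuous f ->
  measurable_fun setT (fun w => f (\row_i X i w)).
Proof.
move=> mX cf.
have openU (U : set 'rV[R]_m) : open U -> measurable [set w | U (\row_i X i w)].
  move=> oU.
  pose box (p : {ffun 'I_m -> rat} * rat) : set 'rV[R]_m :=
    [set z | forall i, `|ratr (p.1 i) - z 0 i| < ratr p.2].
  (* Rational boxes are enumerated by their codes; codes of boxes that leave U, and numbers that
     code nothing, contribute the empty set. *)
  pose A n : set T := if unpickle n is Some p then
    if `[< box p `<=` U >] then [set w | box p (\row_i X i w)] else set0 else set0.
  have -> : [set w | U (\row_i X i w)] = \bigcup_n A n.
    apply/seteqP; split => [w Uw|w [n _]]; last first.
      rewrite /A; case: (unpickle n) => // p.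
      by case: ifPn => // /asboolP pU pw; exact: pU.
    have /nbhs_ballP[e /= e0 eU] := open_nbhs_nbhs (conj oU Uw).
    have [q] := @rat_in_itvoo R 0 (e / 2) (divr_gt0 e0 (ltr0n _ 2)).
    rewrite in_itv/= => /andP[q0 qe].
    have H i : exists c : rat, `|ratr c - X i w| < ratr q.
      have [|c] := @rat_in_itvoo R (X i w - ratr q) (X i w + ratr q).
        by rewrite ltrD2l gt0_cp.
      by rewrite in_itv/= => h; exists c; rewrite ltr_distl.
    have /choice[c hc] := H.
    pose p := ([ffun i => c i] : {ffun 'I_m -> rat}, q).
    exists (pickle p) => //; rewrite /A pickleK.
    have pU : box p `<=` U.
      move=> z pz; apply: eU; split => // i j.
      rewrite ord1 /ball/= mxE.
      have := pz j; have := hc j; rewrite /= ffunE => h1 h2.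
      have h3 := ler_distD (ratr (c j)) (X j w) (z 0 j).
      rewrite distrC in h1; rewrite (le_lt_trans h3)//.
      by apply: lt_le_trans (ltrD h1 h2) _; move: qe; set Q : R := ratr q; lra.
    rewrite (asboolT pU) /= => i; rewrite ffunE mxE; exact: hc.
  apply: bigcupT_measurable => n; rewrite /A; case: (unpickle n) => // p.
  case: ifP => // _.
  rewrite [X in measurable X](_ : _ = \big[setI/setT]_(i < m)
      (X i @^-1` [set t | `|ratr (p.1 i) - t| < ratr p.2])); last first.
    rewrite -bigcap_seq /=; apply/seteqP; split=> w /= h i => [_|].
      by have := h i; rewrite mxE.
    by rewrite mxE; apply: h; rewrite /= mem_index_enum.
  apply: bigsetI_measurable => i _.
  rewrite -[X in measurable X]setTI; apply: mX => //.
  rewrite [X in measurable X](_ : _ =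
      `](ratr (p.1 i) - ratr p.2), (ratr (p.1 i) + ratr p.2)[%classic).
    exact: measurable_itv.
  by apply/seteqP; split => t /=; rewrite in_itv/= distrC ltr_distl.
apply: (measurability _ (measurable_realfun.RGenOInfty.measurableE R)) => _ [_ [r ->] <-].
rewrite setTI; apply: (openU (f @^-1` `]r, +oo[%classic)).
by apply: open_comp => [x _|]; [exact: cf|exact: interval_open].
Qed.

End measurability.

Section under_integral.
Context {R : realType}.

(** Brings continuity in a parameter to the sequential form of dominated convergence. If convergence
    failed, each ball of radius 1/(n+1) would contain a bad point, and these form a violating
    sequence. *)
Lemma cvg_seqP (V : pseudoMetricType R) (f : V -> R) (p : V) (l : R) :
  (forall u : nat -> V, u n @[n --> \oo] --> p -> f (u n) @[n --> \oo] --> l) ->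
  f x @[x --> p] --> l.
Proof.
move=> H; apply/cvgrPdist_lt => e e0; apply: contrapT => nH.
have K (n : nat) : exists x, ball p (n.+1%:R^-1) x /\ e <= `|l - f x|.
  apply: contrapT => /forallNP h; apply: nH.
  apply/nbhs_ballP; exists (n.+1%:R^-1) => /= [|x px]; first by rewrite invr_gt0.
  by rewrite ltNge; apply/negP => ex; apply: (h x).
have /choice[u hu] := K.
have up : u n @[n --> \oo] --> p.
  apply/cvg_ballP => r r0; near=> n.
  apply: (@le_ball _ _ _ (n.+1%:R^-1)); last by have [] := hu n.
  by rewrite ltW//; near: n; exact: near_infty_natSinv_lt (PosNum r0).
have /cvgrPdist_lt/(_ e e0)[N _ hN] := H u up.
by have := hN N (leqnn N); rewrite ltNge; have [_ ->] := hu N.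
Unshelve. all: by end_near. Qed.

Context d (T : measurableType d) (mu : {measure set T -> \bar R}).

Lemma integrable_dom (D : set T) (f g : T -> R) : measurable D ->
  measurable_fun D f -> mu.-integrable D (EFin \o g) ->
  (forall x, D x -> `|f x| <= g x) -> mu.-integrable D (EFin \o f).
Proof.
move=> mD mf ig fg; apply: (le_integrable mD _ _ ig); first exact/measurable_EFinP.
by move=> x Dx /=; rewrite lee_fin (le_trans (fg x Dx))// ler_norm.
Qed.

Lemma continuous_Rintegral (V : pseudoMetricType R) (D : set T) (F : V -> T -> R)
    (G : T -> R) (p : V) : measurable D ->
  (forall v, measurable_fun D (F v)) -> mu.-integrable D (EFin \o G) ->
  (forall v w, D w -> `|F v w| <= G w) ->
  (forall w, D w -> {for p, continuous (fun v => F v w)}) ->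
  {for p, continuous (fun v => (\int[mu]_(w in D) F v w)%R)}.
Proof.
move=> mD mF iG FG cF; apply: cvg_seqP => u up.
have iF v : mu.-integrable D (EFin \o F v) by exact: integrable_dom iG (FG v).
apply: fine_cvg; rewrite fineK; last exact: (integrable_fin_num mD (iF p)).
apply: (@dominated_cvg _ _ _ mu D mD (fun n w => (F (u n) w)%:E) _ (EFin \o G)) => //.
- by move=> n; exact/measurable_EFinP.
- move=> w Dw; apply: cvg_EFin; first exact: nearW.
  exact: (cvg_comp _ _ up (cF w Dw)).
- by move=> n w Dw; rewrite /= lee_fin FG.
Qed.

End under_integral.

(** * Averages of a function over random affine images of its argument *)

Section averages.
Context {R : realType} {m : nat} d (T : measurableType d).
Variable mu : {measure set T -> \bar R}.
Variables a b : 'I_m -> T -> R.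
Hypothesis ma : forall i, measurable_fun setT (a i).
Hypothesis mb : forall i, measurable_fun setT (b i).
Hypothesis a_le1 : forall i w, `|a i w| <= 1.
Implicit Types (W : T -> R) (g : 'rV[R]_m -> R) (x : 'rV[R]_m).

(** Models the Mehler formula: there w = (t, y), the contraction a_i is e^(- lam t) and the shift
    b_i is the scaled Gaussian coordinate. *)
Definition affine x w : 'rV[R]_m := \row_i (a i w * x 0 i + b i w).

Definition average W g x : R := (\int[mu]_w (W w * g (affine x w)))%R.

Lemma continuous_affine w : continuous (affine ^~ w).
Proof.
move=> x; apply: continuous_row => i.
have -> : (fun s => affine s w 0 i) = cst (a i w) * (fun s : 'rV[R]_m => s 0 i) + cst (b i w).
  by apply/funext => s; rewrite mxE.
apply: continuousD; last exact: cst_continuous.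
by apply: continuousM; [exact: cst_continuous|exact: continuous_coord].
Qed.

Lemma measurable_affine g x : continuous g ->
  measurable_fun setT (fun w => g (affine x w)).
Proof.
move=> cg; apply: (@measurable_fun_row _ _ _ _ (fun i w => a i w * x 0 i + b i w)) => // i.
apply: measurable_funD => //; apply: measurable_funM => //.
Qed.

Lemma integrable_measurable W : mu.-integrable setT (EFin \o W) -> measurable_fun setT W.
Proof. by move=> /integrableP[/measurable_EFinP]. Qed.

Lemma integrable_dom_average W M : mu.-integrable setT (EFin \o W) ->
  mu.-integrable setT (EFin \o (fun w => M * `|W w|)).
Proof.
move=> iW; have := integrableZl measurableT M (integrable_norm iW).
by apply: eq_integrable.
Qed.

Lemma integrable_average W g x : mu.-integrable setT (EFin \o W) ->
  continuous g -> bounded_fun g ->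
  mu.-integrable setT (EFin \o (fun w => W w * g (affine x w))).
Proof.
move=> iW cg /bounded_fctP[M gM].
apply: (integrable_dom measurableT _ (integrable_dom_average M iW)).
  by apply: measurable_funM; [exact: integrable_measurable|exact: measurable_affine].
by move=> w _; rewrite normrM mulrC ler_wpM2r.
Qed.

Lemma continuous_average W g : mu.-integrable setT (EFin \o W) ->
  continuous g -> bounded_fun g -> continuous (average W g).
Proof.
move=> iW cg /bounded_fctP[M gM] x.
apply: (continuous_Rintegral measurableT (F := fun x w => W w * g (affine x w))
  _ (integrable_dom_average M iW)).
- by move=> v; apply: measurable_funM; [exact: integrable_measurable|exact: measurable_affine].
- by move=> v w _; rewrite normrM mulrC ler_wpM2r.
- move=> w _; apply: (@continuousM _ _ (cst (W w)) (fun v => g (affine v w))).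
    exact: cst_continuous.
  by apply: continuous_comp; [exact: continuous_affine|exact: cg].
Qed.

Lemma bounded_average W g : mu.-integrable setT (EFin \o W) ->
  continuous g -> bounded_fun g -> bounded_fun (average W g).
Proof.
move=> iW cg bg; have /bounded_fctP[M gM] := bg.
apply/bounded_fctP; exists (\int[mu]_w (M * `|W w|))%R => x.
apply: le_trans (le_normr_Rintegral measurableT (integrable_average x iW cg bg)) _.
apply: le_Rintegral => //.
- exact: integrable_norm (integrable_average x iW cg bg).
- exact: integrable_dom_average.
- by move=> w _; rewrite normrM mulrC ler_wpM2r.
Qed.

Lemma affine_line x k h w :
  affine (h *: delta_mx 0 k + x) w = h *: (a k w *: delta_mx 0 k) + affine x w.
Proof.
apply/rowP => i; rewrite !mxE eqxx/=.
by have [->|_] := eqVneq i k; rewrite ?mulr1 ?mulr0 ?add0r// mulrDr addrA [a k w * h]mulrC.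
Qed.

Lemma integrable_weight W k : mu.-integrable setT (EFin \o W) ->
  mu.-integrable setT (EFin \o (fun w => W w * a k w)).
Proof.
move=> iW; apply: (integrable_dom measurableT _ (integrable_dom_average 1 iW)).
  by apply: measurable_funM; [exact: integrable_measurable|exact: ma].
by move=> w _; rewrite normrM mul1r ler_piMr.
Qed.

(** The chain rule only multiplies the weight by a_k, and |a_k| <= 1 keeps it integrable. The result
    is again an average, so the lemma can be iterated. *)
Lemma is_derive_average W g k x : mu.-integrable setT (EFin \o W) ->
  C1s g -> bounded_fun g -> bounded_fun (pd k g) ->
  is_derive x (delta_mx 0 k) (average W g)
    (average (fun w => W w * a k w) (pd k g) x).
Proof.
move=> iW g1 bg /bounded_fctP[M gM]; apply: is_derive_line0.
have cg := C1_continuous g1.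
pose f h w := W w * g (affine (h *: delta_mx 0 k + x) w).
have df (h : R) w : is_derive h 1 (f ^~ w)
    (W w * a k w * pd k g (affine (h *: delta_mx 0 k + x) w)).
  have H : is_derive h 1 (fun s => g (s *: (a k w *: delta_mx 0 k) + affine x w))
      (pd k g (affine (h *: delta_mx 0 k + x) w) * a k w).
    apply: is_derive_line; rewrite -affine_line.
    by apply: is_derive_dirZ; exact: C1_is_derive.
  have -> : f ^~ w = cst (W w) * (fun s => g (s *: (a k w *: delta_mx 0 k) + affine x w)).
    by apply/funext => s; rewrite /f affine_line.
  apply: (@is_derive_eq _ _ _ _ _ _ _ _ (is_deriveM (is_derive_cst (W w) h 1) H)).
  by rewrite scaler0 addr0 /GRing.scale/= -mulrA; congr (_ * _); rewrite mulrC.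
have I0 : (`]-1, 1[%classic : set R) 0 by rewrite /= in_itv/= ltrN10 ltr01.
have M0 : 0 <= M by rewrite (le_trans _ (gM 0)).
have intf h : (`]-1, 1[%classic : set R) h -> mu.-integrable setT (EFin \o f h).
  by move=> _; exact: integrable_average.
have derf h w : (`]-1, 1[%classic : set R) h -> setT w -> derivable (f ^~ w) h 1.
  by move=> _ _; exact: (@ex_derive _ _ _ _ _ _ _ (df h w)).
have dfE h w : partial1of2 f h w = W w * a k w * pd k g (affine (h *: delta_mx 0 k + x) w).
  by rewrite partial1of2E; exact: (@derive_val _ _ _ _ _ _ _ (df h w)).
have G0 w : 0 <= M * `|W w| by rewrite mulr_ge0.
have Gub h w : (`]-1, 1[%classic : set R) h -> setT w ->
    `|partial1of2 f h w| <= M * `|W w|.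
  move=> _ _; rewrite dfE !normrM -mulrA mulrC ler_wpM2r//.
  by rewrite (le_trans (ler_piMl _ (a_le1 k w))).
have E : (fun s => average W g (s *: delta_mx 0 k + x)) = (fun s => \int[mu]_w f s w)%R by [].
rewrite E; apply: DeriveDef.
  exact: (derivable_under_integral measurableT I0 intf derf G0 (integrable_dom_average M iW) Gub).
rewrite -derive1E.
rewrite (differentiation_under_integral measurableT I0 intf derf G0
  (integrable_dom_average M iW) Gub).
by apply: eq_Rintegral => w _; rewrite dfE scale0r add0r.
Qed.

Lemma C1_average W g : mu.-integrable setT (EFin \o W) ->
  C1s g -> bounded_fun g -> (forall k, bounded_fun (pd k g)) ->
  C1s (average W g) /\
  forall k, pd k (average W g) = average (fun w => W w * a k w) (pd k g).
Proof.
move=> iW g1 bg bg1; apply: C1I.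
- by apply: continuous_average => //; exact: C1_continuous.
- by move=> k x; exact: is_derive_average.
- move=> k; apply: continuous_average => //; first exact: integrable_weight.
  exact: C1_continuous_pd.
Qed.

Lemma C2b_average W g : mu.-integrable setT (EFin \o W) -> C2bs g ->
  C2bs (average W g) /\ forall j k, pd j (pd k (average W g)) =
    average (fun w => W w * a k w * a j w) (pd j (pd k g)).
Proof.
move=> iW /C2bP[/C2P[g1 g2] bg bg1 bg2].
have [A1 A1E] := C1_average iW g1 bg bg1.
have A2 k := C1_average (integrable_weight k iW) (g2 k) (bg1 k) (bg2 ^~ k).
split; last by move=> j k; rewrite A1E (A2 k).2.
apply/C2bP; split.
- by apply/C2P; split=> // k; rewrite A1E; have [] := A2 k.
- by apply: bounded_average => //; exact: C1_continuous.
- move=> k; rewrite A1E; apply: bounded_average => //; first exact: integrable_weight.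
  exact: C1_continuous_pd.
- move=> j k; rewrite A1E (A2 k).2; apply: bounded_average => //.
    by do 2!apply: integrable_weight.
  exact: C1_continuous_pd.
Qed.

End averages.

(** * Gaussian integration by parts *)

Section line_integrals.
Context {R : realType}.
Local Notation leb := (@lebesgue_measure R).

Lemma cvg_Rintegral_exhaust d (T : measurableType d) (mu : {measure set T -> \bar R})
    (D : set T) (A : nat -> set T) (f : T -> R) : measurable D ->
  (forall n, measurable (A n)) -> (forall n, A n `<=` D) ->
  (forall t, D t -> \forall n \near \oo, A n t) ->
  mu.-integrable D (EFin \o f) ->
  (\int[mu]_(t in A n) f t)%R @[n --> \oo] --> (\int[mu]_(t in D) f t)%R.
Proof.
move=> mD mA AD Anear iF.
have mf : measurable_fun D f by move/integrableP: iF => [/measurable_EFinP].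
have E n : (\int[mu]_(t in A n) f t)%R = (\int[mu]_(t in D) (f \_ (A n)) t)%R.
  by rewrite -Rintegral_mkcondr (setIidr (@AD n)).
rewrite (eq_cvg _ _ E); apply: fine_cvg; rewrite fineK; last exact: integrable_fin_num.
apply: (@dominated_cvg _ _ _ mu D mD (fun n t => ((f \_ (A n)) t)%:E) _ (fun t => `|f t|%:E)) => //.
- move=> n; apply/measurable_EFinP/measurable_restrict => //.
  by apply: measurable_funS mf => //; exact: subIsetl.
- move=> t Dt; apply: cvg_EFin; first exact: nearW.
  apply: cvg_near_cst; apply: filterS (Anear t Dt) => n Ant.
  by rewrite /comp/= patchE mem_set.
- exact: (integrable_norm iF).
- move=> n t Dt; rewrite /= lee_fin patchE; case: ifPn => // _.
  by rewrite normr0.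
Qed.

Lemma Rintegral_itv_derive (F f : R -> R) (a b : R) : a < b -> continuous f -> continuous F ->
  (forall t : R, a < t -> t < b -> is_derive t 1 F (f t)) ->
  (\int[leb]_(t in `[a, b]) f t)%R = F b - F a.
Proof.
move=> ab cf cF dF; rewrite /Rintegral (continuous_FTC2 (F := F) ab)//.
- exact: continuous_subspaceT.
- split.
  + move=> t; rewrite in_itv/= => /andP[a_t tb].
    exact: (@ex_derive _ _ _ _ _ _ _ (dF t a_t tb)).
  + by apply: cvg_at_right_filter; exact: cF.
  + by apply: cvg_at_left_filter; exact: cF.
- move=> t; rewrite in_itv/= => /andP[a_t tb]; rewrite derive1E.
  exact: (@derive_val _ _ _ _ _ _ _ (dF t a_t tb)).
Qed.

Lemma Rintegral_line_derive (F f : R -> R) : continuous f ->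
  (forall t : R, is_derive t 1 F (f t)) -> leb.-integrable setT (EFin \o f) ->
  F t @[t --> +oo] --> 0 -> F t @[t --> -oo] --> 0 ->
  (\int[leb]_t f t)%R = 0.
Proof.
move=> cf dF iF Fy FNy.
have cF : continuous F.
  move=> t; apply: differentiable_continuous; apply/derivable1_diffP.
  exact: (@ex_derive _ _ _ _ _ _ _ (dF t)).
(* The successor keeps the interval nondegenerate for every n, as [Rintegral_itv_derive] demands. *)
have cvgI : (\int[leb]_(t in `[(- n.+1%:R)%R, n.+1%:R]) f t)%R @[n --> \oo] -->
    (\int[leb]_t f t)%R.
  apply: cvg_Rintegral_exhaust => // t _; near=> n; rewrite /= in_itv/= -ler_norml.
  apply: (@le_trans _ _ n%:R); last by rewrite ler_nat.
  by near: n; exact: nbhs_infty_ger.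
rewrite -(cvg_lim _ cvgI)//; apply: cvg_lim => //.
have E n : (\int[leb]_(t in `[(- n.+1%:R)%R, n.+1%:R]) f t)%R = F n.+1%:R - F (- n.+1%:R).
  by apply: Rintegral_itv_derive => //; rewrite gt0_cp.
rewrite (eq_cvg _ _ E).
have ny : (n.+1%:R : R) @[n --> \oo] --> +oo.
  apply/cvgryPge => A; near=> n; apply: (@le_trans _ _ n%:R); last by rewrite ler_nat.
  by near: n; exact: nbhs_infty_ger.
have nNy : (- n.+1%:R : R) @[n --> \oo] --> -oo by apply/cvgNrNy.
have h1 : F n.+1%:R @[n --> \oo] --> (0 : R) by exact: (cvg_comp _ _ ny Fy).
have h2 : F (- n.+1%:R) @[n --> \oo] --> (0 : R) by exact: (cvg_comp _ _ nNy FNy).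
by have := cvgB h1 h2; rewrite subr0; exact.
Unshelve. all: by end_near. Qed.

(** The derivative is asked for at positive times because the square roots in the Mehler formula are
    singular at t = 0; continuity takes care of the endpoint. *)
Lemma Rintegral_halfline_derive (F f : R -> R) : continuous f -> continuous F ->
  (forall t : R, 0 < t -> is_derive t 1 F (f t)) ->
  leb.-integrable `[0, +oo[ (EFin \o f) -> F t @[t --> +oo] --> 0 ->
  (\int[leb]_(t in `[0, +oo[) f t)%R = - F 0.
Proof.
move=> cf cF dF iF Fy.
have cvgI : (\int[leb]_(t in `[0%R, n.+1%:R]) f t)%R @[n --> \oo] -->
    (\int[leb]_(t in `[0%R, +oo[) f t)%R.
  apply: cvg_Rintegral_exhaust => //.
    by move=> n t /=; rewrite !in_itv/= andbT => /andP[].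
  move=> t /=; rewrite in_itv/= andbT => t0; near=> n; rewrite /= in_itv/= t0/=.
  apply: (@le_trans _ _ n%:R); last by rewrite ler_nat.
  by near: n; exact: nbhs_infty_ger.
rewrite -(cvg_lim _ cvgI)//; apply: cvg_lim => //.
have E n : (\int[leb]_(t in `[0%R, n.+1%:R]) f t)%R = F n.+1%:R - F 0.
  by apply: Rintegral_itv_derive => // t t0 _; exact: dF.
rewrite (eq_cvg _ _ E).
have ny : (n.+1%:R : R) @[n --> \oo] --> +oo.
  apply/cvgryPge => A; near=> n; apply: (@le_trans _ _ n%:R); last by rewrite ler_nat.
  by near: n; exact: nbhs_infty_ger.
have h1 : F n.+1%:R @[n --> \oo] --> (0 : R) by exact: (cvg_comp _ _ ny Fy).
have h2 : F 0 @[n --> \oo] --> F 0 by exact: cvg_cst.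
by have := cvgB h1 h2; rewrite sub0r; exact.
Unshelve. all: by end_near. Qed.

End line_integrals.

Section product_integrals.
Context {R : realType} d1 d2 (T1 : measurableType d1) (T2 : measurableType d2).
Variables (m1 : {sigma_finite_measure set T1 -> \bar R})
  (m2 : {sigma_finite_measure set T2 -> \bar R}).

(** Integrability of every section makes the inner integral finite at every point, so the
    real-valued inner integral agrees with the extended one. *)
Lemma Rintegral_prod1 (F : T1 * T2 -> R) :
  (m1 \x m2)%E.-integrable setT (EFin \o F) ->
  (forall t, m2.-integrable setT (EFin \o (fun y => F (t, y)))) ->
  (\int[(m1 \x m2)%E]_p F p)%R = (\int[m1]_t \int[m2]_y F (t, y))%R.
Proof.
move=> iF iFt; rewrite /Rintegral; congr fine.
rewrite -(integral12_prod_meas1 iF); apply: eq_integral => t _.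
by rewrite fineK//; exact: (integrable_fin_num measurableT (iFt t)).
Qed.

Lemma Rintegral_prod2 (F : T1 * T2 -> R) :
  (m1 \x m2)%E.-integrable setT (EFin \o F) ->
  (forall y, m1.-integrable setT (EFin \o (fun t => F (t, y)))) ->
  (\int[(m1 \x m2)%E]_p F p)%R = (\int[m2]_y \int[m1]_t F (t, y))%R.
Proof.
move=> iF iFt; rewrite /Rintegral; congr fine.
rewrite -(integral21_prod_meas1 iF); apply: eq_integral => y _.
by rewrite fineK//; exact: (integrable_fin_num measurableT (iFt y)).
Qed.

Lemma integrable_tensor (f : T1 -> R) (g : T2 -> R) :
  m1.-integrable setT (EFin \o f) -> m2.-integrable setT (EFin \o g) ->
  (m1 \x m2)%E.-integrable setT (EFin \o (fun p => f p.1 * g p.2)).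
Proof.
move=> i_f i_g.
have mf : measurable_fun setT f by move/integrableP: i_f => [/measurable_EFinP].
have mg : measurable_fun setT g by move/integrableP: i_g => [/measurable_EFinP].
apply/integrable12ltyP.
  apply/measurable_EFinP; apply: measurable_funM.
    exact: measurableT_comp.
  exact: measurableT_comp.
have -> : (fun t => (\int[m2]_y `|(f t * g y)%:E|)%E) =
    (fun t => `|(f t)%:E| * \int[m2]_y `|(g y)%:E|)%E.
  apply/funext => t; rewrite -ge0_integralZl//.
    by apply: eq_integral => y _; rewrite /= normrM EFinM.
  by apply/measurable_EFinP; exact: measurableT_comp.
rewrite ge0_integralZr//; last 2 first.
  by apply/measurable_EFinP; exact: measurableT_comp.
  exact: integral_ge0.
have /integrableP[_ fy] := i_f; have /integrableP[_ gy] := i_g.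
by rewrite lte_mul_pinfty// ?integral_ge0// ge0_fin_numE ?integral_ge0.
Qed.

Lemma Rintegral_tensor (f : T1 -> R) (g : T2 -> R) :
  m1.-integrable setT (EFin \o f) -> m2.-integrable setT (EFin \o g) ->
  (\int[(m1 \x m2)%E]_p (f p.1 * g p.2))%R =
  (\int[m1]_t f t)%R * (\int[m2]_y g y)%R.
Proof.
move=> i_f i_g; rewrite Rintegral_prod1; first last.
- by move=> t; apply: (integrableZl measurableT (f t) i_g).
- exact: integrable_tensor.
rewrite /=; under eq_Rintegral do rewrite RintegralZl//.
by rewrite RintegralZr.
Qed.

End product_integrals.

(** * Lebesgue and Gaussian integrals over tuples *)

Section tuples.
Context {R : realType}.
Local Notation RT := (measurableTypeR R).
Local Notation leb := (@lebesgue_measure R).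
Local Notation LT := (@lebesgue_tuple R).

Definition rowt n (y : n.-tuple RT) : 'rV[R]_n := \row_i tnth y i.

Lemma measurable_rowt n (h : 'rV[R]_n -> R) : continuous h ->
  measurable_fun setT (fun y : n.-tuple RT => h (rowt y)).
Proof.
move=> ch; apply: (@measurable_fun_row R n _ _ (fun i (y : n.-tuple RT) => tnth y i)) => // i.
exact: measurable_tnth.
Qed.

Lemma integral_tupleS n (F : n.+1.-tuple RT -> \bar R) : measurable_fun setT F ->
  (forall z, 0 <= F z)%E ->
  (\int[LT n.+1]_z F z = \int[(leb \x LT n)%E]_p F (tuple_cons p))%E.
Proof.
move=> mF F0.
have E := @ge0_integral_pushforward _ _ _ _ R _ (@measurable_tuple_cons R n)
  (leb \x LT n)%E setT F measurableT mF (fun z _ => F0 z).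
apply: etrans E; apply: eq_measure_integral => [|mT A mA _ //].
exact: measurable_tuple_cons.
Qed.

Lemma integrable_tupleS n (F : n.+1.-tuple RT -> R) : measurable_fun setT F ->
  (LT n.+1).-integrable setT (EFin \o F) <->
  (leb \x LT n)%E.-integrable setT (EFin \o (F \o @tuple_cons R n)).
Proof.
move=> mF; have mF' : measurable_fun setT (F \o @tuple_cons R n).
  by apply: measurableT_comp => //; exact: measurable_tuple_cons.
split=> /integrableP[_ Foo]; apply/integrableP; split; try exact/measurable_EFinP.
- apply: le_lt_trans Foo; rewrite integral_tupleS//.
  by apply/measurable_EFinP; exact: measurableT_comp.
- apply: le_lt_trans Foo; rewrite integral_tupleS//.
  by apply/measurable_EFinP; exact: measurableT_comp.
Qed.

Lemma Rintegral_tupleS n (F : n.+1.-tuple RT -> R) : measurable_fun setT F ->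
  (LT n.+1).-integrable setT (EFin \o F) ->
  (\int[LT n.+1]_z F z)%R = (\int[(leb \x LT n)%E]_p F (tuple_cons p))%R.
Proof.
move=> mF iF; rewrite /Rintegral; congr fine.
have mF' : measurable_fun setT (EFin \o F) by exact/measurable_EFinP.
have E := @integral_pushforward _ _ _ _ R _ (@measurable_tuple_cons R n)
  (leb \x LT n)%E setT (EFin \o F) mF' ((integrable_tupleS mF).1 iF) measurableT.
apply: etrans E; apply: eq_measure_integral => [|mT A mA _ //].
exact: measurable_tuple_cons.
Qed.

(** The rate is expressed by the standard deviation s of a normal density. It is used for s = 1, the
    Gaussian weight itself, and for s = sqrt 2, the dominating function. *)
Lemma expR_sq_integral (s : R) : 0 < s ->
  leb.-integrable setT (EFin \o (fun t => expR (- ((s ^+ 2 * 2)^-1 * t ^+ 2)))) /\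
  (\int[leb]_t expR (- ((s ^+ 2 * 2)^-1 * t ^+ 2)))%R = Num.sqrt (s ^+ 2 * pi * 2).
Proof.
move=> s0; have sn0 : s != 0 by rewrite gt_eqF.
have E t : expR (- ((s ^+ 2 * 2)^-1 * t ^+ 2)) = (normal_peak s)^-1 * normal_pdf 0 s t.
  rewrite normal_pdfE// mulrA mulVf ?mul1r ?gt_eqF ?normal_peak_gt0//.
  by rewrite /normal_fun subr0 mulr_natr mulNr mulrC.
have iE : leb.-integrable setT (EFin \o (fun t => (normal_peak s)^-1 * normal_pdf 0 s t)).
  by have := integrableZl measurableT (normal_peak s)^-1 (integrable_normal_pdf 0 s).
have -> : (fun t => expR (- ((s ^+ 2 * 2)^-1 * t ^+ 2))) =
    (fun t => (normal_peak s)^-1 * normal_pdf 0 s t) by apply/funext.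
split=> //; rewrite RintegralZl//; last exact: integrable_normal_pdf.
rewrite /Rintegral integral_normal_pdf mulr1 /normal_peak invrK.
by rewrite mulr_natr.
Qed.

Lemma blockE_consE c n (p : RT * n.-tuple RT) :
  blockE c xpredT (rowt (tuple_cons p)) =
  expR (- (c * p.1 ^+ 2)) * blockE c xpredT (rowt p.2) :> R.
Proof.
rewrite /blockE -expRD; congr expR.
rewrite /blockq big_ord_recl mxE tnth0 mulrDr opprD; congr (_ - _ * _).
by apply: eq_bigr => i _; rewrite !mxE tnthS.
Qed.

Lemma gauss_tuple_integral (s : R) n : 0 < s ->
  (LT n).-integrable setT (EFin \o (fun y => blockE (s ^+ 2 * 2)^-1 xpredT (rowt y))) /\
  (\int[LT n]_y blockE (s ^+ 2 * 2)^-1 xpredT (rowt y))%R =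
    Num.sqrt (s ^+ 2 * pi * 2) ^+ n.
Proof.
move=> s0; have c0 : 0 < (s ^+ 2 * 2)^-1 by rewrite invr_gt0 mulr_gt0// exprn_gt0.
have cE k : continuous (blockE (s ^+ 2 * 2)^-1 xpredT : 'rV[R]_k -> R).
  by apply: C1_continuous; have /C2b_C2/C2P[] := @C2b_blockE R k _ xpredT c0.
elim: n => [|n [IH1 IH2]].
  have E y : blockE (s ^+ 2 * 2)^-1 xpredT (rowt y : 'rV[R]_0) = 1.
    by rewrite /blockE /blockq big_ord0 mulr0 oppr0 expR0.
  have -> : (fun y : 0.-tuple RT => blockE (s ^+ 2 * 2)^-1 xpredT (rowt y)) = cst 1.
    by apply/funext => y; exact: E.
  have D1 : (LT 0 setT = 1)%E by rewrite /= diracT.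
  have D2 : (LT 0 setT < +oo)%E by rewrite /= diracT ltry.
  split.
    apply: (measurable_bounded_integrable measurableT D2) => //.
    by apply/bounded_fctP; exists 1 => y; rewrite normr1.
  by rewrite (Rintegral_cst _ measurableT) mul1r expr0 (congr1 fine D1).
have [i1 I1] := expR_sq_integral s0.
have mF := measurable_rowt (cE n.+1).
have it := integrable_tensor i1 IH1.
have iF : (LT n.+1).-integrable setT
    (EFin \o (fun y => blockE (s ^+ 2 * 2)^-1 xpredT (rowt y))).
  apply/(integrable_tupleS mF); apply: eq_integrable it => // p _.
  by rewrite /= blockE_consE.
split=> //; rewrite Rintegral_tupleS//.
have TT := Rintegral_tensor i1 IH1.
rewrite {}I1 {}IH2 -exprS in TT; apply: etrans TT.
by apply: eq_Rintegral => p _; rewrite blockE_consE.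
Qed.

End tuples.

Section gauss_decay.
Context {R : realType}.

(** By z exp(- z) <= 1 it suffices that c t^2 >= C / e, and t >= 1 gives t^2 >= t. *)
Lemma gauss_decay (C c e : R) : 0 < C -> 0 < c -> 0 < e ->
  exists2 A, 0 < A & forall t, A <= `|t| -> C * expR (- (c * t ^+ 2)) <= e.
Proof.
move=> C0 c0 e0; exists (1 + C / (c * e)).
  by rewrite ltr_wpDr// divr_ge0 ?mulr_ge0 ?ltW.
move=> t; rewrite -real_normK ?num_real//; move: (`|t|) => {}t At.
have D0 : 0 < C / (c * e) by rewrite divr_gt0// mulr_gt0.
have t1 : 1 <= t by lra.
have tt : C / (c * e) <= t ^+ 2.
  by apply: (@le_trans _ _ t); [lra|rewrite expr2 ler_peMr// (le_trans ler01)].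
have z0 : 0 < c * t ^+ 2 by rewrite mulr_gt0// exprn_gt0// (lt_le_trans ltr01).
have := mul_expRN_le1 (c * t ^+ 2).
rewrite ler_pdivrMr ?mulr_gt0// in tt.
have E0 := expR_ge0 (- (c * t ^+ 2)).
rewrite mulrC -ler_pdivlMr// => h.
apply: (le_trans (ler_wpM2l (ltW C0) h)).
rewrite div1r ler_pdivrMr//; move: tt; set T := t ^+ 2; nra.
Qed.

Lemma gauss_cvg0 (f : R -> R) (C c : R) : 0 < C -> 0 < c ->
  (forall t, `|f t| <= C * expR (- (c * t ^+ 2))) ->
  f t @[t --> +oo] --> 0 /\ f t @[t --> -oo] --> 0.
Proof.
move=> C0 c0 fC; split; apply/cvgr0Pnorm_le => e e0.
- have [A A0 HA] := gauss_decay C0 c0 e0; near=> t.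
  apply: (le_trans (fC t)); apply: HA.
  by apply: le_trans (ler_norm _); near: t; apply: nbhs_pinfty_ge; exact: num_real.
- have [A A0 HA] := gauss_decay C0 c0 e0; near=> t.
  apply: (le_trans (fC t)); apply: HA; rewrite -normrN.
  apply: le_trans (ler_norm _); rewrite lerNr.
  by near: t; apply: nbhs_ninfty_le; exact: num_real.
Unshelve. all: by end_near. Qed.

End gauss_decay.

Section stein.
Context {R : realType}.
Local Notation RT := (measurableTypeR R).
Local Notation leb := (@lebesgue_measure R).
Local Notation LT := (@lebesgue_tuple R).

Definition cons_row n (t : R) (z : 'rV[R]_n) : 'rV[R]_n.+1 :=
  \row_i (if unlift ord0 i is Some j then z 0 j else t).

Lemma rowt_cons n (p : RT * n.-tuple RT) :
  rowt (tuple_cons p) = cons_row p.1 (rowt p.2).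
Proof.
apply/rowP => i; rewrite !mxE; case: unliftP => [j ->|->].
  by rewrite tnthS mxE.
by rewrite tnth0.
Qed.

Lemma cons_row0 n (t : R) (z : 'rV[R]_n) :
  cons_row t z = t *: delta_mx 0 ord0 + cons_row 0 z.
Proof.
apply/rowP => i; rewrite !mxE eqxx/=; case: unliftP => [j ->|->].
  by rewrite -[lift _ _ == _]/(false) mulr0 add0r.
by rewrite eqxx mulr1 addr0.
Qed.

Lemma cons_row_line n (t s : R) j (z : 'rV[R]_n) :
  cons_row t (s *: delta_mx 0 j + z) = s *: delta_mx 0 (lift ord0 j) + cons_row t z.
Proof.
apply/rowP => i; rewrite !mxE; case: unliftP => [l ->|->].
  by rewrite !mxE (inj_eq (@lift_inj _ _)).
by rewrite -[ord0 == lift _ _]/(false) andbF mulr0 add0r.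
Qed.

Lemma C1_cons_row n (t : R) (h : 'rV[R]_n.+1 -> R) : C1s h ->
  C1s (h \o cons_row t) /\
  forall j, pd j (h \o cons_row t) = pd (lift ord0 j) h \o cons_row t.
Proof.
move=> h1.
have cc : continuous (cons_row t : 'rV[R]_n -> _).
  move=> z; apply: continuous_row => i.
  case: (unliftP ord0 i) => [j|] ->.
    have -> : (fun s : 'rV[R]_n => cons_row t s 0 (lift ord0 j)) = (fun s : 'rV[R]_n => s 0 j).
      by apply/funext => s; rewrite mxE liftK.
    exact: continuous_coord.
  have -> : (fun s : 'rV[R]_n => cons_row t s 0 ord0) = cst t.
    by apply/funext => s; rewrite mxE unlift_none.
  exact: cst_continuous.
apply: C1I.
- by move=> z; apply: continuous_comp; [exact: cc|exact: C1_continuous].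
- move=> j z; apply: is_derive_line0.
  have -> : (fun s => (h \o cons_row t) (s *: delta_mx 0 j + z)) =
     (fun s => h (s *: delta_mx 0 (lift ord0 j) + cons_row t z)).
    by apply/funext => s; rewrite /= cons_row_line.
  by apply: is_derive_line; rewrite scale0r add0r; exact: C1_is_derive.
- by move=> j z; apply: continuous_comp; [exact: cc|exact: C1_continuous_pd].
Qed.

(** The number 1/4, half the rate of the standard Gaussian: one half of the exponent absorbs
    polynomial factors, the other half stays integrable. *)
Definition c4 : R := (Num.sqrt 2 ^+ 2 * 2)^-1.

Lemma c4_gt0 : 0 < c4.
Proof. by rewrite invr_gt0 mulr_gt0// exprn_gt0// sqrtr_gt0. Qed.

Lemma c4E : c4 = 4^-1.
Proof. by rewrite /c4 sqr_sqrtr// -natrM. Qed.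

Lemma integrable_c4 n (h : 'rV[R]_n -> R) C : continuous h ->
  (forall z, `|h z| <= C * blockE c4 xpredT z) ->
  (LT n).-integrable setT (EFin \o (fun y => h (rowt y))).
Proof.
move=> ch hC; have s0 : 0 < Num.sqrt 2 :> R by rewrite sqrtr_gt0.
have [iE _] := @gauss_tuple_integral R (Num.sqrt 2) n s0.
apply: (integrable_dom measurableT (measurable_rowt ch) (integrableZl measurableT C iE)).
by move=> y _; exact: hC.
Qed.

Lemma blockE_cons_row n c (t : R) (z : 'rV[R]_n) :
  blockE c xpredT (cons_row t z) = expR (- (c * t ^+ 2)) * blockE c xpredT z.
Proof.
rewrite /blockE -expRD; congr expR.
rewrite /blockq big_ord_recl mxE unlift_none mulrDr opprD; congr (_ - _ * _).
by apply: eq_bigr => i _; rewrite !mxE liftK.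
Qed.

(** Induction on the dimension by Fubini. If k is the first coordinate, the inner integral runs
    along lines and vanishes by Gaussian decay. Otherwise the first coordinate is frozen, and the
    restriction satisfies the same bounds with a smaller C. *)
Lemma integral_pd0 n (h : 'rV[R]_n -> R) C k : C1s h -> 0 < C ->
  (forall z, `|h z| <= C * blockE c4 xpredT z) ->
  (forall z, `|pd k h z| <= C * blockE c4 xpredT z) ->
  (\int[LT n]_y pd k h (rowt y))%R = 0.
Proof.
elim: n h C k => [h C []//|n IH h C k h1 C0 hC dC].
have cd := C1_continuous_pd (k := k) h1.
have iF := integrable_c4 cd dC.
have mF := measurable_rowt cd.
have := (integrable_tupleS mF).1 iF; rewrite Rintegral_tupleS//= => iP.
have -> : (\int[(leb \x LT n)%E]_p pd k h (rowt (tuple_cons p)))%R =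
    (\int[(leb \x LT n)%E]_p pd k h (cons_row p.1 (rowt p.2)))%R.
  by apply: eq_Rintegral => p _; rewrite rowt_cons.
have {}iP : (leb \x LT n)%E.-integrable setT
    (EFin \o (fun p => pd k h (cons_row p.1 (rowt p.2)))).
  by apply: eq_integrable iP => // p _; rewrite /= rowt_cons.
have dC2 t z : `|pd k h (cons_row t z)| <= C * (expR (- (c4 * t ^+ 2)) * blockE c4 xpredT z).
  by rewrite -blockE_cons_row; exact: dC.
have hC2 t z : `|h (cons_row t z)| <= C * (expR (- (c4 * t ^+ 2)) * blockE c4 xpredT z).
  by rewrite -blockE_cons_row; exact: hC.
have [k0|[j kj]] : k = ord0 \/ exists j, k = lift ord0 j.
  by case: (unliftP ord0 k) => [j ->|->]; [right; exists j|left].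
- have lineE z : (fun t => pd k h (cons_row t z)) =
      (fun t => pd k h (t *: delta_mx 0 ord0 + cons_row 0 z)).
    by apply/funext => t; rewrite -cons_row0.
  have cl (z : 'rV[R]_n) : continuous (fun t => pd k h (cons_row t z)).
    rewrite lineE => t.
    have cl : {for t, continuous (fun t : R => t *: delta_mx 0 ord0 + cons_row 0 z : 'rV[R]_n.+1)}.
      by apply: cvgD; [apply: cvgZr_tmp; exact: cvg_id|exact: cvg_cst].
    exact: (continuous_comp cl (@cd _)).
  have s0 : 0 < Num.sqrt 2 :> R by rewrite sqrtr_gt0.
  have il (z : 'rV[R]_n) : leb.-integrable setT (EFin \o (fun t => pd k h (cons_row t z))).
    have [iE _] := expR_sq_integral s0.
    apply: (integrable_dom measurableT _
      (integrableZl measurableT (C * blockE c4 xpredT z) iE)).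
      exact: continuous_measurable_fun.
    by move=> t _; rewrite mulrAC -mulrA; exact: dC2.
  have dl z (t : R) : is_derive t 1 (fun t => h (cons_row t z)) (pd k h (cons_row t z)).
    have -> : (fun t => h (cons_row t z)) =
        (fun t => h (t *: delta_mx 0 ord0 + cons_row 0 z)).
      by apply/funext => s; rewrite -cons_row0.
    rewrite (cons_row0 t z) k0; apply: is_derive_line; exact: C1_is_derive.
  have E z : (\int[leb]_t pd k h (cons_row t z))%R = 0.
    have C'0 : 0 < C * blockE c4 xpredT z by rewrite mulr_gt0// blockE_gt0.
    have hCz t : `|h (cons_row t z)| <= C * blockE c4 xpredT z * expR (- (c4 * t ^+ 2)).
      by rewrite mulrAC -mulrA; exact: hC2.
    have [Fy FNy] := gauss_cvg0 C'0 c4_gt0 hCz.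
    exact: (Rintegral_line_derive (@cl z) (dl z) (il z) Fy FNy).
  rewrite (Rintegral_prod2 iP (fun y => il (rowt y))).
  under eq_Rintegral do rewrite /= E.
  by rewrite Rintegral_cst ?mul0r.
- have pE t y : pd k h (cons_row t y) = pd j (h \o cons_row t) y.
    by have [_ ->] := C1_cons_row t h1; rewrite kj.
  have Ct t : 0 < C * expR (- (c4 * t ^+ 2)) by rewrite mulr_gt0// expR_gt0.
  have ct t := C1_continuous_pd (k := j) (C1_cons_row t h1).1.
  have dCt t z : `|pd j (h \o cons_row t) z| <= C * expR (- (c4 * t ^+ 2)) * blockE c4 xpredT z.
    by rewrite -pE -mulrA.
  rewrite Rintegral_prod1//; last first.
    move=> t; apply: eq_integrable (integrable_c4 (ct t) (dCt t)) => // y _.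
    by rewrite /= -pE.
  have E t : (\int[LT n]_y pd k h (cons_row t (rowt y)))%R = 0.
    rewrite -(IH (h \o cons_row t) _ j (C1_cons_row t h1).1 (Ct t)) => [|z|z].
    + by apply: eq_Rintegral => y _; rewrite pE.
    + by rewrite -mulrA; exact: hC2.
    + exact: dCt.
  under eq_Rintegral do rewrite /= E.
  by rewrite Rintegral_cst ?mul0r.
Qed.

End stein.

Lemma cvg_sumr (R : realType) (T : Type) (Fl : set_system T) {FF : Filter Fl}
    (I : Type) (s : seq I) (F : I -> T -> R) (a : I -> R) :
  (forall i, F i x @[x --> Fl] --> a i) ->
  \sum_(i <- s) F i x @[x --> Fl] --> \sum_(i <- s) a i.
Proof.
move=> h; elim: s => [|i s IH].
  rewrite big_nil; under eq_cvg do rewrite big_nil; exact: cvg_cst.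
rewrite big_cons; under eq_cvg do rewrite big_cons.
exact: cvgD.
Qed.

(** * Chain rule along a curve *)

Section chain_rule.
Context {R : realType} {m : nat}.
Implicit Types (f : 'rV[R]_m -> R) (x z : 'rV[R]_m).

(** The condition |r| <= |s| covers both signs of s at once and is all that the limit in the chain
    rule uses. *)
Lemma MVT_coord f k z (s : R) : C1s f -> exists2 r, `|r| <= `|s| &
  f (s *: delta_mx 0 k + z) - f z = pd k f (r *: delta_mx 0 k + z) * s.
Proof.
move=> f1.
pose F r := f (r *: delta_mx 0 k + z); pose dF r := pd k f (r *: delta_mx 0 k + z).
have D (r : R) : is_derive r 1 F (dF r) by apply: is_derive_line; exact: C1_is_derive.
have cF (i : interval R) : {within [set` i], continuous F}.
  apply: derivable_within_continuous => r _; exact: (@ex_derive _ _ _ _ _ _ _ (D r)).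
have F0 : F 0 = f z by rewrite /F scale0r add0r.
have [s0|s0] := leP 0 s.
  have [r] := @MVT_segment R F dF 0 s s0 (fun r _ => D r) (cF _).
  rewrite in_itv/= F0 subr0 => /andP[r0 rs] E; exists r => //.
  by rewrite !ger0_norm.
have [r] := @MVT_segment R F dF s 0 (ltW s0) (fun r _ => D r) (cF _).
rewrite in_itv/= F0 sub0r => /andP[sr r0] E; exists r.
  by rewrite !ler0_norm ?lerN2// ltW.
by apply: oppr_inj; rewrite opprB E mulrN.
Qed.

Lemma is_derive_chain f (Z : R -> 'rV[R]_m) (dZ : 'I_m -> R) (t : R) : C1s f ->
  (forall i, is_derive t 1 (fun s => Z s 0 i) (dZ i)) ->
  is_derive t 1 (fun s => f (Z s)) (\sum_i pd i f (Z t) * dZ i).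
Proof.
move=> f1 dZi.
(* The first k coordinates are already moved to time t + h. Consecutive points differ in one
   coordinate, so the increment of f telescopes into one-variable mean values, for which continuous
   partial derivatives suffice. *)
pose P (k : nat) (h : R) : 'rV[R]_m :=
  \row_i (if (i < k)%N then Z (h + t) 0 i else Z t 0 i).
pose d (k : 'I_m) (h : R) := Z (h + t) 0 k - Z t 0 k.
have PS (k : 'I_m) h : P k.+1 h = d k h *: delta_mx 0 k + P k h.
  apply/rowP => i; rewrite !mxE eqxx/= ltnS leq_eqVlt val_eqE.
  have [->|ik] := eqVneq i k; last by rewrite mulr0 add0r.
  by rewrite ltnn mulr1 /d subrK.
have /choice[r hr] k : exists r : R -> R, forall h, `|r h| <= `|d k h| /\
    f (P k.+1 h) - f (P k h) = pd k f (r h *: delta_mx 0 k + P k h) * d k h.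
  have /choice[r hr] h : exists r : R, `|r| <= `|d k h| /\
      f (P k.+1 h) - f (P k h) = pd k f (r *: delta_mx 0 k + P k h) * d k h.
    by rewrite PS; have [r r1 r2] := MVT_coord k (P k h) (d k h) f1; exists r.
  by exists r.
have tel h : f (Z (h + t)) - f (Z t) =
    \sum_k pd k f (r k h *: delta_mx 0 k + P k h) * d k h.
  have -> : Z (h + t) = P m h by apply/rowP => i; rewrite mxE ltn_ord.
  have -> : Z t = P 0 h by apply/rowP => i; rewrite mxE.
  rewrite -(telescope_sumr (fun k => f (P k h)) (leq0n m)) big_mkord.
  by apply: eq_bigr => k _; have [_ ->] := hr k h.
have cZ i : Z (h + t) 0 i @[h --> (0 : R)^'] --> Z t 0 i.
  have cz : {for t, continuous (fun s => Z s 0 i)}.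
    apply: differentiable_continuous; apply/derivable1_diffP.
    exact: (@ex_derive _ _ _ _ _ _ _ (dZi i)).
  apply: cvg_within_filter; apply: (cvg_comp (fun h => h + t) (fun s => Z s 0 i) _ cz).
  have : h + t @[h --> (0 : R)] --> 0 + t by apply: cvgD; [exact: cvg_id|exact: cvg_cst].
  by rewrite add0r.
have cd k : d k h @[h --> (0 : R)^'] --> 0.
  have h2 : Z t 0 k @[h --> (0 : R)^'] --> Z t 0 k by exact: cvg_cst.
  by have := cvgB (cZ k) h2; rewrite subrr; exact.
have cq k : h^-1 * d k h @[h --> (0 : R)^'] --> dZ k.
  have [dz <-] := dZi k; move: dz; rewrite /derivable /derive => cz.
  apply: cvg_trans cz; apply: near_eq_cvg; apply: nearW => h.
  by rewrite /d /= [h *: 1]mulr1.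
(* In each coordinate i the intermediate point differs from Z t by at most |d i h|. *)
have cxi k : (r k h *: delta_mx 0 k + P k h : 'rV[R]_m) @[h --> (0 : R)^'] --> Z t.
  apply: cvg_row => i; apply/cvgrPdist_lt => e e0.
  have H : \forall h \near (0 : R)^', `|0 - d i h| < e.
    by move/cvgrPdist_lt : (cd i); apply.
  near=> h; have : `|0 - d i h| < e by near: h.
  rewrite sub0r normrN; apply: le_lt_trans.
  rewrite !mxE eqxx/=; have [->|ik] := eqVneq i k.
    rewrite ltnn mulr1 opprD addrCA subrr addr0 normrN.
    by have [] := hr k h.
  rewrite mulr0 add0r; case: ifP => _; last by rewrite subrr normr0.
  by rewrite distrC.
have c1 : h^-1 *: (f (Z (h + t)) - f (Z t)) @[h --> (0 : R)^'] -->
    \sum_i pd i f (Z t) * dZ i.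
  have -> : (fun h => h^-1 *: (f (Z (h + t)) - f (Z t))) =
      (fun h => \sum_k pd k f (r k h *: delta_mx 0 k + P k h) * (h^-1 * d k h)).
    apply/funext => h; rewrite tel /GRing.scale/= mulr_sumr.
    by apply: eq_bigr => k _; rewrite mulrCA.
  apply: cvg_sumr => k; apply: cvgM; last exact: cq.
  have ck : pd k f z @[z --> Z t] --> pd k f (Z t) by exact: C1_continuous_pd.
  exact: (cvg_comp _ _ (cxi k) ck).
have E : (fun h => h^-1 *: (((fun s => f (Z s)) \o shift t) (h *: 1) - f (Z t))) =
    (fun h => h^-1 *: (f (Z (h + t)) - f (Z t))).
  by apply/funext => h /=; rewrite [h *: 1]mulr1.
apply: DeriveDef; first by rewrite /derivable E; apply/cvg_ex; eexists; exact: c1.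
by rewrite /derive E; exact: cvg_lim.
Unshelve. all: by end_near. Qed.

End chain_rule.

Section stein.
Context {R : realType} {m : nat}.
Local Notation RT := (measurableTypeR R).
Local Notation LT := (@lebesgue_tuple R).
Implicit Types (f g : 'rV[R]_m -> R) (x z : 'rV[R]_m).

Definition diag_affine (al be : 'I_m -> R) z : 'rV[R]_m :=
  \row_i (al i + be i * z 0 i).

Lemma C1_diag_affine al be f : C1s f ->
  C1s (f \o diag_affine al be) /\
  forall k, pd k (f \o diag_affine al be) = cst (be k) * (pd k f \o diag_affine al be).
Proof.
move=> f1.
have cc : continuous (diag_affine al be).
  move=> z; apply: continuous_row => i.
  have -> : (fun s => diag_affine al be s 0 i) =
      cst (al i) + cst (be i) * (fun s : 'rV[R]_m => s 0 i).
    by apply/funext => s; rewrite mxE.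
  apply: continuousD; first exact: cst_continuous.
  by apply: continuousM; [exact: cst_continuous|exact: continuous_coord].
apply: C1I.
- by move=> z; apply: continuous_comp; [exact: cc|exact: C1_continuous].
- move=> k z; apply: is_derive_line0.
  have -> : (fun s => (f \o diag_affine al be) (s *: delta_mx 0 k + z)) =
     (fun s => f (s *: (be k *: delta_mx 0 k) + diag_affine al be z)).
    apply/funext => s /=; congr f; apply/rowP => i; rewrite !mxE eqxx/=.
    by have [->|_] := eqVneq i k; rewrite ?mulr1 ?mulr0 ?add0r//; ring.
  apply: is_derive_line; rewrite scale0r add0r.
  apply: (@is_derive_eq _ _ _ _ _ _ _ _ (is_derive_dirZ _ (C1_is_derive k _ f1))).
  by rewrite mulrC.
- move=> k z; apply: continuousM; first exact: cst_continuous.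
  by apply: continuous_comp; [exact: cc|exact: C1_continuous_pd].
Qed.

Definition gphi (y : m.-tuple RT) : R :=
  (Num.sqrt ((2 * pi) ^+ m))^-1 * blockE 2^-1 xpredT (rowt y).

Lemma C1_blockE (c : R) : 0 < c -> C1s (blockE c xpredT : 'rV[R]_m -> R).
Proof. by move=> c0; have /C2b_C2/C2P[] := @C2b_blockE R m c xpredT c0. Qed.

Lemma gphi_prefactor_gt0 : 0 < (Num.sqrt ((2 * pi) ^+ m))^-1 :> R.
Proof. by rewrite invr_gt0 sqrtr_gt0 exprn_gt0// mulr_gt0// pi_gt0. Qed.

Lemma gphi_ge0 y : 0 <= gphi y.
Proof. by rewrite mulr_ge0 ?(ltW gphi_prefactor_gt0)// ltW// blockE_gt0. Qed.

Lemma gphi_integral :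
  (LT m).-integrable setT (EFin \o gphi) /\ (\int[LT m]_y gphi y)%R = 1.
Proof.
have [] := @gauss_tuple_integral R 1 m ltr01.
rewrite expr1n !mul1r => iE IE.
have sqrtX n : Num.sqrt ((2 * pi : R) ^+ n) = Num.sqrt (pi * 2) ^+ n.
  elim: n => [|n IH]; first by rewrite !expr0 sqrtr1.
  have p0 : 0 <= 2 * pi :> R by rewrite mulr_ge0// pi_ge0.
  by rewrite [in LHS]exprS [in RHS]exprS (sqrtrM _ p0) IH [in LHS]mulrC [in LHS]mulrC [2 * pi]mulrC.
split; first exact: (integrableZl measurableT _ iE).
have -> : (\int[LT m]_y gphi y)%R =
    (Num.sqrt ((2 * pi) ^+ m))^-1 * (\int[LT m]_y blockE 2^-1 xpredT (rowt y))%R.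
  exact: RintegralZl.
by rewrite IE sqrtX mulVf// expf_eq0 gt_eqF ?andbF// sqrtr_gt0 mulr_gt0// pi_gt0.
Qed.

Lemma blockE_c4 z : blockE 2^-1 xpredT z = blockE c4 xpredT z * blockE c4 xpredT z :> R.
Proof. by rewrite /blockE -expRD c4E; congr expR; field. Qed.

(** |z_k| <= 1 + z_k^2 / 4 <= exp(z_k^2 / 4), the first step being (|z_k| - 2)^2 >= 0. *)
Lemma coord_blockE_c4 k z : `|z 0 k| * blockE c4 xpredT z <= 1 :> R.
Proof.
rewrite /blockE expRN ler_pdivrMr ?expR_gt0// mul1r.
apply: le_trans (expR_ge1Dx _); rewrite c4E /blockq (bigD1 k)//=.
have : 0 <= \sum_(i < m | i != k) z 0 i ^+ 2 by apply: sumr_ge0 => i _; exact: sqr_ge0.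
rewrite -[z 0 k ^+ 2]real_normK ?num_real//.
by move: (`|z 0 k|) (\sum_(_ | _) _) => a b b0; have := sqr_ge0 (a - 2); nra.
Qed.

Lemma blockE_c4_le1 z : blockE c4 xpredT z <= 1 :> R.
Proof. exact: blockE_le1 c4_gt0. Qed.

Lemma integrable_gphi_coord k :
  (LT m).-integrable setT (EFin \o (fun y => gphi y * tnth y k)).
Proof.
pose h z : R := (Num.sqrt ((2 * pi) ^+ m))^-1 * blockE 2^-1 xpredT z * z 0 k.
have ch : continuous h.
  have -> : h = cst (Num.sqrt ((2 * pi) ^+ m))^-1 * blockE 2^-1 xpredT *
    (fun z : 'rV[R]_m => z 0 k) by [].
  move=> z; apply: continuousM; last exact: continuous_coord.
  apply: continuousM; first exact: cst_continuous.
  by apply: C1_continuous; apply: C1_blockE.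
apply: eq_integrable (integrable_c4 ch (C := (Num.sqrt ((2 * pi) ^+ m))^-1) _) => //.
  by move=> y _; rewrite /= /h mxE.
move=> z; rewrite /h -mulrA normrM ger0_norm ?(ltW gphi_prefactor_gt0)//.
rewrite ler_wpM2l ?(ltW gphi_prefactor_gt0)// blockE_c4.
have E0 : 0 < blockE c4 xpredT z by exact: blockE_gt0.
rewrite !normrM (gtr0_norm E0) -mulrA (ler_piMr (ltW E0))// mulrC.
exact: coord_blockE_c4.
Qed.

(** The two sides differ by the integral of D_k of g times the Gaussian density, which vanishes by
    [integral_pd0]; half of the exponent absorbs the factor y_k. *)
Lemma stein g k : C1s g -> bounded_fun g -> bounded_fun (pd k g) ->
  (\int[LT m]_y (gphi y * (g (rowt y) * tnth y k)))%R =
  (\int[LT m]_y (gphi y * pd k g (rowt y)))%R.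
Proof.
move=> g1 /bounded_fctP[M gM] /bounded_fctP[M' gM'].
pose c : R := (Num.sqrt ((2 * pi) ^+ m))^-1; have c0 : 0 < c by exact: gphi_prefactor_gt0.
have M0 : 0 <= M by rewrite (le_trans _ (gM 0)).
have M'0 : 0 <= M' by rewrite (le_trans _ (gM' 0)).
have h2 : 0 < 2^-1 :> R by rewrite invr_gt0.
have B1 := C1_blockE h2.
pose h := g * blockE 2^-1 xpredT.
have h1 : C1s h by have [] := C1M g1 B1.
have B0 z : 0 < blockE c4 xpredT z by exact: blockE_gt0.
have dh z : pd k h z = blockE 2^-1 xpredT z * pd k g z -
    g z * z 0 k * blockE 2^-1 xpredT z.
  rewrite /h (pdM _ _ g1 B1) pd_blockE// !fctE/= /cst.
  by move: (blockE _ _ z) (g z) (pd k g z) (z 0 k) => *; field.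
have C0 : 0 < M + M' + 1 by rewrite ltr_wpDl// addr_ge0.
have zB z := coord_blockE_c4 k z.
have hC z : `|h z| <= (M + M' + 1) * blockE c4 xpredT z.
  rewrite /h fctE blockE_c4 mulrA normrM [X in _ * X]gtr0_norm// ler_pM2r//.
  rewrite normrM [X in _ * X]gtr0_norm//.
  have := ler_pM (normr_ge0 _) (ltW (B0 z)) (gM z) (blockE_c4_le1 z).
  lra.
have dC z : `|pd k h z| <= (M + M' + 1) * blockE c4 xpredT z.
  rewrite dh blockE_c4; set B := blockE _ _ _.
  rewrite (_ : _ - _ = (B * pd k g z - g z * (z 0 k * B)) * B); last by ring.
  rewrite normrM [X in _ * X]gtr0_norm; last exact: B0.
  rewrite ler_pM2r; last exact: B0.
  apply: le_trans (ler_normB _ _) _; rewrite !normrM [`|B|]gtr0_norm; last exact: B0.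
  have := ler_pM (ltW (B0 z)) (normr_ge0 _) (blockE_c4_le1 z) (gM' z).
  have := ler_pM (normr_ge0 (g z)) (mulr_ge0 (normr_ge0 (z 0 k)) (ltW (B0 z))) (gM z) (zB z).
  rewrite -/B; lra.
have I0 := integral_pd0 h1 C0 hC dC.
have [iphi _] := gphi_integral; have iphik := integrable_gphi_coord k.
have mg := measurable_rowt (C1_continuous g1).
have mg' := measurable_rowt (C1_continuous_pd (k := k) g1).
have bint (w q : m.-tuple RT -> R) (K : R) : (LT m).-integrable setT (EFin \o w) ->
    measurable_fun setT q -> (forall y, `|q y| <= K) ->
    (LT m).-integrable setT (EFin \o (fun y => w y * q y)).
  move=> iw mq qK; have mw : measurable_fun setT w.
    by move/integrableP: iw => [/measurable_EFinP].
  apply: (integrable_dom measurableT (measurable_funM mw mq)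
    (integrableZl measurableT K (integrable_norm iw))) => y _.
  by rewrite normrM mulrC ler_wpM2r// qK.
have i1 := bint _ _ M' iphi mg' (fun y => gM' _).
have i2 : (LT m).-integrable setT (EFin \o (fun y => gphi y * (g (rowt y) * tnth y k))).
  apply: eq_integrable (bint _ _ M iphik mg (fun y => gM _)) => // y _.
  by rewrite /= -mulrA [tnth y k * _]mulrC.
apply/esym/eqP; rewrite -subr_eq0 -RintegralB//; apply/eqP.
transitivity (\int[LT m]_y (c * pd k h (rowt y)))%R.
  apply: eq_Rintegral => y _; rewrite dh /gphi -/c mxE.
  by move: (blockE _ _ _) (g _) (pd k g _) (tnth y k) => *; ring.
rewrite RintegralZl ?I0 ?mulr0//.
exact: integrable_c4 (C1_continuous_pd (k := k) h1) dC.
Qed.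

End stein.

(** * The Mehler semigroup *)

Section mehler.
Context {R : realType} {m : nat}.
Local Notation RT := (measurableTypeR R).
Local Notation LT := (@lebesgue_tuple R).
Local Notation gphi := (@gphi R m).
Variable lam : nat -> R.
Hypothesis lam_gt0 : forall k : 'I_m, 0 < lam k.+1.
Implicit Types (f g u : 'rV[R]_m -> R) (x z : 'rV[R]_m) (k i : 'I_m) (t : R).

(** The absolute value keeps the factor at most 1 on the whole line, as the coefficients of
    [average] must be; the weight e^-t lives on t >= 0. *)
Definition decay k t : R := expR (- (lam k.+1 * `|t|)).

Local Notation scale := (@OU_scale R lam m).

Lemma decay_gt0 k t : 0 < decay k t. Proof. exact: expR_gt0. Qed.

Lemma decay_le1 k t : decay k t <= 1.
Proof. by rewrite -expR0 ler_expR oppr_le0 mulr_ge0// ltW. Qed.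

Lemma continuous_decay k : continuous (decay k).
Proof.
have -> : decay k = expR \o (- (cst (lam k.+1) * (fun t : R => `|t|))) by [].
move=> t; apply: continuous_comp; last exact: continuous_expR.
apply: continuousN; apply: continuousM; first exact: cst_continuous.
exact: norm_continuous.
Qed.

Lemma is_derive_decay k t : 0 < t -> is_derive t 1 (decay k) (- lam k.+1 * decay k t).
Proof.
move=> t0.
have D0 : is_derive t 1 (fun s => expR (- lam k.+1 * s)) (expR (- lam k.+1 * t) * (- lam k.+1)).
  have D1 := is_deriveM (is_derive_cst (- lam k.+1) t 1) (@is_derive_id R R t 1).
  apply: (@is_derive_eq _ _ _ _ _ _ _ _ (is_derive_comp1 (is_derive_expR _) D1)).
  by rewrite !fctE scaler0 addr0 [_ *: _]mulr1.
apply: (@near_eq_is_derive _ _ _ (fun s => expR (- lam k.+1 * s))).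
  near=> s; have s0 : 0 < s by near: s; exact: lt_nbhsr.
  by rewrite /decay gtr0_norm// mulNr.
apply: (@is_derive_eq _ _ _ _ _ _ _ _ D0).
by rewrite mulrC /decay gtr0_norm//; congr (_ * expR _); rewrite mulNr.
Unshelve. all: by end_near. Qed.

Lemma scale_inner_gt0 k t : 0 < t -> 0 < (1 - expR (- (2 * lam k.+1 * t))) / (2 * lam k.+1).
Proof.
move=> t0; rewrite divr_gt0 ?mulr_gt0// subr_gt0 -expR0 ltr_expR oppr_lt0.
by rewrite !mulr_gt0.
Qed.

Lemma scale_gt0 t k : 0 < t -> 0 < scale t k.
Proof. by move=> t0; rewrite sqrtr_gt0 scale_inner_gt0. Qed.

Lemma scale0 k : scale 0 k = 0.
Proof. by rewrite /OU_scale mulr0 oppr0 expR0 subrr mul0r sqrtr0. Qed.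

Lemma decay0 k : decay k 0 = 1.
Proof. by rewrite /decay normr0 mulr0 oppr0 expR0. Qed.

Lemma is_derive_scale_inner k t :
  is_derive t 1 (fun t => (1 - expR (- (2 * lam k.+1 * t))) / (2 * lam k.+1))
    (expR (- (2 * lam k.+1 * t))).
Proof.
set l := 2 * lam k.+1; have l0 : l != 0 by rewrite gt_eqF// mulr_gt0.
have -> : (fun t => (1 - expR (- (l * t))) / l) =
    cst l^-1 * (cst 1 - (fun t => expR (- l * t))).
  by apply/funext => s; rewrite !fctE mulrC mulNr.
have D1 := is_deriveM (is_derive_cst (- l) t 1) (@is_derive_id R R t 1).
have D2 : is_derive t 1 (fun s => expR (- l * s)) _ := is_derive_comp1 (is_derive_expR _) D1.
have D3 := is_deriveM (is_derive_cst l^-1 t 1) (is_deriveB (is_derive_cst (1 : R) t 1) D2).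
apply: (@is_derive_eq _ _ _ _ _ _ _ _ D3).
rewrite !fctE /cst /GRing.scale/= !mulr0 !addr0 mulr1 sub0r mulNr.
by move: (expR _) => e; field.
Qed.

Lemma continuous_scale k : continuous (scale ^~ k).
Proof.
have -> : scale ^~ k = Num.sqrt \o
  (fun t => (1 - expR (- (2 * lam k.+1 * t))) / (2 * lam k.+1)) by [].
move=> t; apply: continuous_comp; last exact: sqrt_continuous.
apply: differentiable_continuous; apply/derivable1_diffP.
exact: (@ex_derive _ _ _ _ _ _ _ (is_derive_scale_inner k t)).
Qed.

(** Obtained from (c_k^2)' = e^(- 2 lam_k t). It blows up as t tends to 0, whence the restriction to
    positive times below. *)
Definition OU_dscale k t : R := decay k t ^+ 2 / (2 * scale t k).

Lemma is_derive_scale k t : 0 < t -> is_derive t 1 (scale ^~ k) (OU_dscale k t).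
Proof.
move=> t0.
have D := @is_derive_comp1 R Num.sqrt
  (fun t => (1 - expR (- (2 * lam k.+1 * t))) / (2 * lam k.+1)) t _ _
  (is_derive1_sqrt (scale_inner_gt0 k t0)) (is_derive_scale_inner k t).
apply: (@is_derive_eq _ _ _ _ _ _ _ _ D).
rewrite -/(scale t k) mulrC /OU_dscale; congr (_ / _).
by rewrite /decay gtr0_norm// expr2 -expRD; congr expR; ring.
Qed.

Lemma scale_le k s t : s <= t -> scale s k <= scale t k.
Proof.
move=> st; rewrite /OU_scale ler_wsqrtr// ler_pM2r ?invr_gt0 ?mulr_gt0//.
by rewrite lerD2l lerN2 ler_expR lerN2 ler_pM2l// mulr_gt0.
Qed.

Definition mehler_pt t x (y : m.-tuple RT) : 'rV[R]_m :=
  diag_affine (fun i => decay i t * x 0 i) (scale t) (rowt y).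

(** The Mehler semigroup, with N(0, Q_t) written as the image of the standard Gaussian under the
    scaling by c_k(t), so that t enters only through the argument of g. *)
Definition Pt g t x : R := (\int[LT m]_y (gphi y * g (mehler_pt t x y)))%R.

Lemma mehler_ptE t x y i :
  mehler_pt t x y 0 i = decay i t * x 0 i + scale t i * tnth y i.
Proof. by rewrite !mxE. Qed.

Lemma measurable_mehler g t x : continuous g ->
  measurable_fun setT (fun y => g (mehler_pt t x y)).
Proof.
move=> cg.
have E : mehler_pt t x = (fun y => \row_i (decay i t * x 0 i + scale t i * tnth y i)).
  by apply/funext => y; apply/rowP => i; rewrite mehler_ptE mxE.
rewrite E; apply: (@measurable_fun_row _ _ _ _
  (fun i (y : m.-tuple RT) => decay i t * x 0 i + scale t i * tnth y i)) => // i.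
apply: measurable_funD => //; apply: measurable_funM => //; exact: measurable_tnth.
Qed.

Lemma measurable_gphi : measurable_fun setT gphi.
Proof. by have [/integrableP[/measurable_EFinP]] := @gphi_integral R m. Qed.

Lemma integrable_Mgphi (M : R) : (LT m).-integrable setT (EFin \o (fun y => M * gphi y)).
Proof. by have [i1 _] := @gphi_integral R m; exact: (integrableZl measurableT M i1). Qed.

Lemma integrable_mehler g t x : continuous g -> bounded_fun g ->
  (LT m).-integrable setT (EFin \o (fun y => gphi y * g (mehler_pt t x y))).
Proof.
move=> cg /bounded_fctP[M gM].
apply: (integrable_dom measurableT _ (integrable_Mgphi M)).
  by apply: measurable_funM; [exact: measurable_gphi|exact: measurable_mehler].
by move=> y _; rewrite normrM ger0_norm ?gphi_ge0// mulrC ler_wpM2r// gphi_ge0.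
Qed.

Lemma continuous_Pt g x : continuous g -> bounded_fun g -> continuous (Pt g ^~ x).
Proof.
move=> cg /bounded_fctP[M gM] t.
apply: (continuous_Rintegral measurableT (F := fun s y => gphi y * g (mehler_pt s x y))
  _ (integrable_Mgphi M)).
- by move=> s; apply: measurable_funM; [exact: measurable_gphi|exact: measurable_mehler].
- by move=> s y _; rewrite normrM ger0_norm ?gphi_ge0// mulrC ler_wpM2r// gphi_ge0.
- move=> y _; apply: (@continuousM _ _ (cst (gphi y)) (fun s => g (mehler_pt s x y))).
    exact: cst_continuous.
  apply: continuous_comp; last exact: cg.
  apply: continuous_row => i.
  have -> : (fun s => mehler_pt s x y 0 i) =
      (fun s => decay i s * x 0 i + scale s i * tnth y i).
    by apply/funext => s; rewrite mehler_ptE.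
  apply: (@continuousD _ R^o _ (fun s => decay i s * x 0 i) (fun s => scale s i * tnth y i)).
    apply: (@continuousM _ _ (decay i) (cst (x 0 i))); last exact: cst_continuous.
    exact: continuous_decay.
  apply: (@continuousM _ _ (scale ^~ i) (cst (tnth y i))); last exact: cst_continuous.
  exact: continuous_scale.
Qed.

Lemma Pt_le g t x M : continuous g -> (forall z, `|g z| <= M) -> `|Pt g t x| <= M.
Proof.
move=> cg gM; have bg : bounded_fun g by apply/bounded_fctP; exists M.
apply: le_trans (le_normr_Rintegral measurableT (integrable_mehler t x cg bg)) _.
have -> : M = (\int[LT m]_y (M * gphi y))%R.
  by have [i1 I1] := @gphi_integral R m; rewrite RintegralZl// I1 mulr1.
apply: le_Rintegral => //.
- exact: integrable_norm (integrable_mehler t x cg bg).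
- exact: integrable_Mgphi.
- by move=> y _; rewrite normrM ger0_norm ?gphi_ge0// mulrC ler_wpM2r// gphi_ge0.
Qed.

Lemma Pt0 g x : Pt g 0 x = g x.
Proof.
have E y : mehler_pt 0 x y = x.
  by apply/rowP => i; rewrite mehler_ptE decay0 scale0 mul1r mul0r addr0.
rewrite /Pt; under eq_Rintegral do rewrite E.
by have [i1 I1] := @gphi_integral R m; rewrite RintegralZr// I1 mul1r.
Qed.

(** The factor c_k(t) produced here cancels the singular 1 / c_k(t) of [OU_dscale] in the time
    derivative. *)
Lemma Pt_stein g k t x : C1s g -> bounded_fun g -> bounded_fun (pd k g) ->
  (\int[LT m]_y (gphi y * (g (mehler_pt t x y) * tnth y k)))%R =
  scale t k * Pt (pd k g) t x.
Proof.
move=> g1 /bounded_fctP[M gM] /bounded_fctP[M' gM'].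
have [G1 GE] := C1_diag_affine (fun i => decay i t * x 0 i) (scale t) g1.
rewrite (stein G1).
- rewrite GE /Pt -RintegralZl//; first by apply: eq_Rintegral => y _; rewrite !fctE mulrCA.
  apply: integrable_mehler; first exact: C1_continuous_pd.
  by apply/bounded_fctP; exists M'.
- by apply/bounded_fctP; exists M => z; exact: gM.
- rewrite GE; apply: bounded_fctM; first exact: bounded_fct_cst.
  by apply/bounded_fctP; exists M' => z; exact: gM'.
Qed.

End mehler.

Section integral_sums.
Context {R : realType} d (T : measurableType d) (mu : {measure set T -> \bar R}).

Lemma integrable_sumr (D : set T) (I : Type) (s : seq I) (f : I -> T -> R) : measurable D ->
  (forall i, mu.-integrable D (EFin \o f i)) ->
  mu.-integrable D (EFin \o (fun w => \sum_(i <- s) f i w)).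
Proof.
move=> mD fi.
have : mu.-integrable D (fun w => \sum_(i <- s) (f i w)%:E)%E.
  by apply: integrable_sum => // i _; exact: fi.
by apply: eq_integrable => // w _; rewrite /= sumEFin.
Qed.

Lemma Rintegral_sumr (D : set T) (I : Type) (s : seq I) (f : I -> T -> R) : measurable D ->
  (forall i, mu.-integrable D (EFin \o f i)) ->
  (\int[mu]_(w in D) \sum_(i <- s) f i w)%R = \sum_(i <- s) (\int[mu]_(w in D) f i w)%R.
Proof.
move=> mD fi; elim: s => [|i s IH].
  rewrite big_nil; under eq_Rintegral do rewrite big_nil.
  by rewrite Rintegral_cst// mul0r.
rewrite big_cons -IH -RintegralD//; last exact: integrable_sumr.
by apply: eq_Rintegral => w _; rewrite big_cons.
Qed.

End integral_sums.

(** * The time derivative of the semigroup *)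

Section mehler_derivative.
Context {R : realType} {m : nat}.
Local Notation RT := (measurableTypeR R).
Local Notation LT := (@lebesgue_tuple R).
Local Notation gphi := (@gphi R m).
Variable lam : nat -> R.
Hypothesis lam_gt0 : forall k : 'I_m, 0 < lam k.+1.
Local Notation scale := (@OU_scale R lam m).
Local Notation Pt := (@Pt R m lam).
Local Notation mehler_pt := (@mehler_pt R m lam).
Implicit Types (f g u : 'rV[R]_m -> R) (x z : 'rV[R]_m) (k i : 'I_m) (t : R).

(** L P_t f with the derivatives moved onto f by D_k P_t f = e^(- lam_k t) P_t D_k f. *)
Definition LP f t x : R := \sum_(k < m)
  (2^-1 * decay lam k t ^+ 2 * Pt (pd k (pd k f)) t x
   - lam k.+1 * decay lam k t * x 0 k * Pt (pd k f) t x).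

Lemma is_derive_Pt f t x : C2bs f -> 0 < t ->
  is_derive t 1 (Pt f ^~ x) (LP f t x).
Proof.
move=> /C2bP[/C2P[f1 f2] bf bf1 bf2] t0.
have cf := C1_continuous f1.
have hM0 k : exists r : R, forall z, `|pd k f z| <= r by exact/bounded_fctP.
have [M hM] := @choice _ R _ hM0.
have M0 k : 0 <= M k by rewrite (le_trans _ (hM k 0)).
pose F s (y : m.-tuple RT) := gphi y * f (mehler_pt s x y).
pose dF s (y : m.-tuple RT) := gphi y * \sum_k pd k f (mehler_pt s x y) *
   (- lam k.+1 * decay lam k s * x 0 k + OU_dscale lam k s * tnth y k).
have D (s : R) y : 0 < s -> is_derive s 1 (F ^~ y) (dF s y).
  move=> s0.
  have DZ i : is_derive s 1 (fun r => mehler_pt r x y 0 i)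
      (- lam i.+1 * decay lam i s * x 0 i + OU_dscale lam i s * tnth y i).
    have -> : (fun r => mehler_pt r x y 0 i) =
        decay lam i * cst (x 0 i) + (scale ^~ i) * cst (tnth y i).
      by apply/funext => r; rewrite mehler_ptE.
    have D1 := is_deriveM (is_derive_decay lam i s0) (is_derive_cst (x 0 i) s 1).
    have D2 := is_deriveM (is_derive_scale lam_gt0 i s0) (is_derive_cst (tnth y i) s 1).
    apply: (@is_derive_eq _ _ _ _ _ _ _ _ (is_deriveD D1 D2)).
    by rewrite !scaler0 !add0r /cst /GRing.scale/= mulrC [tnth y i * _]mulrC.
  have Dc := is_derive_chain f1 DZ.
  apply: (@is_derive_eq _ _ _ _ _ _ _ _ (is_deriveM (is_derive_cst (gphi y) s 1) Dc)).
  by rewrite scaler0 addr0.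
(* Staying above t / 2 bounds 1 / c_k by a constant, so the time derivative is dominated by a
   function of y that is affine in the |y_k| times the Gaussian. *)
pose I : set R := `]t / 2, t + 1[%classic.
have I0 s : I s -> 0 < s.
  by rewrite /I/= in_itv/= => /andP[+ _]; apply: lt_trans; rewrite divr_gt0.
have It : I t.
  by rewrite /I/= in_itv/= ltr_pdivrMr// ltr_pMr// ltr1n ltrDl ltr01.
have intF s : I s -> (LT m).-integrable setT (EFin \o F s).
  by move=> _; exact: integrable_mehler.
have derF s y : I s -> setT y -> derivable (F ^~ y) s 1.
  by move=> /I0 s0 _; exact: (@ex_derive _ _ _ _ _ _ _ (D s y s0)).
have dFE s y : I s -> partial1of2 F s y = dF s y.
  by move=> /I0 s0; rewrite partial1of2E; exact: (@derive_val _ _ _ _ _ _ _ (D s y s0)).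
pose K k := (2 * scale (t / 2) k)^-1.
pose G (y : m.-tuple RT) := \sum_k (M k * (lam k.+1 * `|x 0 k|) * gphi y +
   M k * K k * `|gphi y * tnth y k|).
have K0 k : 0 <= K k by rewrite invr_ge0 mulr_ge0// sqrtr_ge0.
have G0 y : 0 <= G y.
  apply: sumr_ge0 => k _; have l0 := ltW (lam_gt0 k); have g0 := gphi_ge0 y.
  apply: addr_ge0; first by do 2?apply: mulr_ge0 => //; exact: mulr_ge0.
  by apply: mulr_ge0 => //; exact: mulr_ge0.
have iG : (LT m).-integrable setT (EFin \o G).
  apply: (integrable_sumr _ measurableT) => j.
  apply: (@integrableD _ _ _ _ _ measurableT
    (EFin \o (fun y => M j * (lam j.+1 * `|x 0 j|) * gphi y))
    (EFin \o (fun y => M j * K j * `|gphi y * tnth y j|))).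
    exact: integrable_Mgphi.
  exact: (integrableZl measurableT _ (integrable_norm (integrable_gphi_coord j))).
have dscale_le k s : I s -> `|OU_dscale lam k s| <= K k.
  rewrite /I/= in_itv/= => /andP[ts _]; have t20 : 0 < t / 2 by rewrite divr_gt0.
  have c0 := scale_gt0 lam_gt0 k t20; have cs := scale_le lam_gt0 k (ltW ts).
  have sp : 0 < scale s k by exact: lt_le_trans cs.
  rewrite /OU_dscale ger0_norm; last by rewrite divr_ge0 ?sqr_ge0// mulr_ge0// ltW.
  rewrite /K ler_pdivrMr ?mulr_gt0// mulrC ler_pdivlMr ?mulr_gt0//.
  have d1 : decay lam k s ^+ 2 <= 1.
    by rewrite expr_le1// ?decay_le1// ltW// decay_gt0.
  apply: (@le_trans _ _ (1 * (2 * scale (t / 2) k))).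
    by rewrite ler_wpM2r// mulr_ge0// ltW.
  by rewrite mul1r ler_pM2l.
have Gub s y : I s -> setT y -> `|partial1of2 F s y| <= G y.
  move=> Is _; rewrite dFE// /dF mulr_sumr (le_trans (ler_norm_sum _ _ _))//.
  apply: ler_sum => k _; have g0 := gphi_ge0 y.
  rewrite (normrM (gphi y) (_ * _)) (normrM (gphi y) (tnth y k)) (ger0_norm g0).
  rewrite (normrM (pd k f _)).
  have h1 : `|- lam k.+1 * decay lam k s * x 0 k + OU_dscale lam k s * tnth y k| <=
      lam k.+1 * `|x 0 k| + K k * `|tnth y k|.
    apply: (le_trans (ler_normD _ _)); apply: lerD.
      rewrite (normrM (- _ * _)) (normrM (- _)) normrN (gtr0_norm (lam_gt0 k)).
      rewrite (ger0_norm (ltW (decay_gt0 _ _ _))) ler_wpM2r//.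
      by rewrite ler_piMr ?decay_le1// ltW.
    by rewrite (normrM (OU_dscale _ _ _)) ler_wpM2r// dscale_le.
  have h2 := ler_pM (normr_ge0 _) (normr_ge0 _) (hM k (mehler_pt s x y)) h1.
  apply: (le_trans (ler_wpM2l g0 h2)).
  by move: (gphi y) (M k) (K k) (lam k.+1) (`|x 0 k|) (`|tnth y k|) => *; lra.
have E : (Pt f ^~ x) = (fun s => \int[LT m]_y F s y)%R by [].
have D1 : is_derive t 1 (Pt f ^~ x) ('D_1 (Pt f ^~ x) t).
  apply: derivableP; rewrite E.
  exact: (derivable_under_integral measurableT It intF derF G0 iG Gub).
apply: (@is_derive_eq _ _ _ _ _ _ _ _ D1).
rewrite -derive1E E.
rewrite (differentiation_under_integral measurableT It intF derF G0 iG Gub).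
transitivity (\int[LT m]_y \sum_(k < m) ((- lam k.+1 * decay lam k t * x 0 k) *
     (gphi y * pd k f (mehler_pt t x y)) +
     OU_dscale lam k t * (gphi y * (pd k f (mehler_pt t x y) * tnth y k))))%R.
  apply: eq_Rintegral => y _; rewrite dFE// /dF mulr_sumr.
  apply: eq_bigr => k _.
  by move: (gphi y) (pd k f _) (tnth y k) (OU_dscale _ _ _) => *; ring.
have i1 k : (LT m).-integrable setT
    (EFin \o (fun y => gphi y * pd k f (mehler_pt t x y))).
  by apply: integrable_mehler => //; exact: C1_continuous_pd.
have i2 k : (LT m).-integrable setT
    (EFin \o (fun y => gphi y * (pd k f (mehler_pt t x y) * tnth y k))).
  have mp := measurable_mehler lam t x (C1_continuous_pd (k := k) f1).
  have ik := @integrable_gphi_coord R m k.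
  have i3 : (LT m).-integrable setT (EFin \o (fun y => M k * `|gphi y * tnth y k|)).
    exact: (integrableZl measurableT _ (integrable_norm ik)).
  apply: (integrable_dom measurableT _ i3).
    apply: measurable_funM; first exact: measurable_gphi.
    by apply: measurable_funM => //; exact: measurable_tnth.
  by move=> y _; rewrite mulrCA normrM; apply: ler_wpM2r.
rewrite Rintegral_sumr//; last first.
  move=> k; apply: (@integrableD _ _ _ _ _ measurableT
    (EFin \o (fun y => _ * (gphi y * pd k f (mehler_pt t x y))))
    (EFin \o (fun y => OU_dscale lam k t * (gphi y * (pd k f (mehler_pt t x y) * tnth y k))))).
    exact: (integrableZl measurableT _ (i1 k)).
  exact: (integrableZl measurableT _ (i2 k)).
apply: eq_bigr => k _.
rewrite RintegralD//; [|exact: (integrableZl measurableT _ (i1 k))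
  |exact: (integrableZl measurableT _ (i2 k))].
(* Integration by parts removes y_k, and c_k times e^(- 2 lam_k t) / (2 c_k) leaves the coefficient
   1/2 of the second derivative. *)
rewrite RintegralZl// RintegralZl// (Pt_stein lam t x (f2 k) (bf1 k) (bf2 k k)) -/(Pt _ t x).
have c0 := scale_gt0 lam_gt0 k t0; rewrite /OU_dscale.
by move: (Pt _ _ _) (Pt _ _ _) => *; field; rewrite gt_eqF.
Qed.

End mehler_derivative.

(** * The bounded classical solution *)

Section resolvent.
Context {R : realType} {m : nat}.
Local Notation RT := (measurableTypeR R).
Local Notation leb := (@lebesgue_measure R).
Local Notation LT := (@lebesgue_tuple R).
Local Notation gphi := (@gphi R m).
Variable lam : nat -> R.
Hypothesis lam_gt0 : forall k : 'I_m, 0 < lam k.+1.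
Local Notation scale := (@OU_scale R lam m).
Local Notation Pt := (@Pt R m lam).
Local Notation decay := (@decay R m lam).
Local Notation eW := (@exponential_pdf R 1).
Implicit Types (f g u : 'rV[R]_m -> R) (x z : 'rV[R]_m) (k i : 'I_m) (t : R) (w : R -> R).

(** Time and Gaussian noise are averaged jointly on the product space, so the derivative rules for
    [average] apply. For w = [eW], the density e^-t on t >= 0, this is the integral representation
    of u^f. *)
Definition time_average w g : 'rV[R]_m -> R :=
  average (leb \x LT m)%E (fun i p => decay i p.1) (fun i p => scale p.1 i * tnth p.2 i)
    (fun p => w p.1 * gphi p.2) g.

Let ma i : measurable_fun setT (fun p : RT * m.-tuple RT => decay i p.1).
Proof.
apply: measurableT_comp => //.
exact: (continuous_measurable_fun (@continuous_decay R m lam i)).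
Qed.

Let mb i : measurable_fun setT (fun p : RT * m.-tuple RT => scale p.1 i * tnth p.2 i).
Proof.
apply: measurable_funM.
  apply: (measurableT_comp (f := scale ^~ i)) => //.
  exact: (continuous_measurable_fun (@continuous_scale R m lam lam_gt0 i)).
by apply: (measurableT_comp (f := fun y : m.-tuple RT => tnth y i)) => //; exact: measurable_tnth.
Qed.

Let a_le1 i (p : RT * m.-tuple RT) : `|decay i p.1| <= 1.
Proof. by rewrite (gtr0_norm (decay_gt0 _ _ _)) decay_le1. Qed.

Lemma integrable_time_weight w : leb.-integrable setT (EFin \o w) ->
  (leb \x LT m)%E.-integrable setT (EFin \o (fun p => w p.1 * gphi p.2)).
Proof. by move=> iw; apply: integrable_tensor => //; have [] := @gphi_integral R m. Qed.

Lemma time_averageE w g x : leb.-integrable setT (EFin \o w) ->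
  continuous g -> bounded_fun g ->
  time_average w g x = (\int[leb]_t (w t * Pt g t x))%R.
Proof.
move=> iw cg bg.
have E t y : affine (fun i p => decay i p.1) (fun i p => scale p.1 i * tnth p.2 i) x (t, y) =
    mehler_pt lam t x y.
  by apply/rowP => i; rewrite mehler_ptE mxE.
rewrite /time_average /average Rintegral_prod1.
- apply: eq_Rintegral => t _; rewrite /Pt -RintegralZl//.
    by apply: eq_Rintegral => y _; rewrite -E [RHS]mulrA.
  exact: integrable_mehler.
- by apply: integrable_average => //; exact: integrable_time_weight.
- move=> t; have iZ := integrableZl measurableT (w t) (integrable_mehler lam t x cg bg).
  by apply: eq_integrable iZ => // y _; rewrite /= -E -EFinM mulrA.
Qed.

Lemma integrable_Pt w g x : leb.-integrable setT (EFin \o w) ->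
  continuous g -> bounded_fun g ->
  leb.-integrable setT (EFin \o (fun t => w t * Pt g t x)).
Proof.
move=> iw cg bg; have /bounded_fctP[M gM] := bg.
apply: (integrable_dom measurableT _ (integrable_dom_average M iw)).
  apply: measurable_funM; first exact: (integrable_measurable iw).
  exact: (continuous_measurable_fun (@continuous_Pt R m lam lam_gt0 g x cg bg)).
by move=> t _; rewrite normrM mulrC; apply: ler_wpM2r => //; exact: Pt_le.
Qed.

Lemma integrable_decay w k : leb.-integrable setT (EFin \o w) ->
  leb.-integrable setT (EFin \o (fun t => w t * decay k t)).
Proof.
move=> iw; apply: (integrable_dom measurableT _ (integrable_dom_average 1 iw)).
  apply: measurable_funM; first exact: (integrable_measurable iw).
  exact: (continuous_measurable_fun (@continuous_decay R m lam k)).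
by move=> t _; rewrite normrM mul1r ler_piMr// (gtr0_norm (decay_gt0 _ _ _)) decay_le1.
Qed.

Lemma time_average_decay w g k :
  average (leb \x LT m)%E (fun i p => decay i p.1) (fun i p => scale p.1 i * tnth p.2 i)
    (fun p => w p.1 * gphi p.2 * decay k p.1) g = time_average (fun t => w t * decay k t) g.
Proof.
apply/funext => x; apply: eq_Rintegral => p _; congr (_ * _).
exact: mulrAC.
Qed.

Lemma C2b_time_average w g : leb.-integrable setT (EFin \o w) -> C2bs g ->
  [/\ C2bs (time_average w g),
      forall k, pd k (time_average w g) = time_average (fun t => w t * decay k t) (pd k g) &
      forall j k, pd j (pd k (time_average w g)) =
        time_average (fun t => w t * decay k t * decay j t) (pd j (pd k g))].
Proof.
move=> iw g2; have iW := integrable_time_weight iw.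
have /C2bP[/C2P[g1 g1'] bg bg1 bg2] := g2.
have [A1 A1E] := C1_average ma mb a_le1 iW g1 bg bg1.
have E k : pd k (time_average w g) = time_average (fun t => w t * decay k t) (pd k g).
  by rewrite /time_average A1E time_average_decay.
split=> //; first by have [] := C2b_average ma mb a_le1 iW g2.
move=> j k; rewrite E.
have iW' := integrable_time_weight (integrable_decay k iw).
have [_ ->] := C1_average ma mb a_le1 iW' (g1' k) (bg1 k) (bg2 ^~ k).
exact: time_average_decay.
Qed.

Lemma Rintegral_eW (h : R -> R) :
  (\int[leb]_t (eW t * h t))%R = (\int[leb]_(t in `[0, +oo[) (expR (- t) * h t))%R.
Proof.
rewrite [RHS]Rintegral_mkcond; apply: eq_Rintegral => t _.
rewrite patchE /exponential_pdf patchE mul1r mulN1r.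
by case: ifP => // _; rewrite mul0r.
Qed.

Lemma integrable_eW_mul (h : R -> R) :
  leb.-integrable setT (EFin \o (fun t => eW t * h t)) ->
  leb.-integrable `[0, +oo[ (EFin \o (fun t => expR (- t) * h t)).
Proof.
move=> ih; apply: (integrable_mkcond _ _).2 => //.
apply: eq_integrable ih => // t _; rewrite patchE /= /exponential_pdf patchE mul1r mulN1r.
by case: ifP => // _; rewrite mul0r.
Qed.

Lemma integrable_eW : leb.-integrable setT (EFin \o eW).
Proof. exact: integrable_exponential_pdf. Qed.

(** Each derivative in direction k multiplies the time weight by [decay k], so L of the time average
    is the time average of [LP]. *)
Lemma OU_resolvent f x : C2bs f ->
  leb.-integrable `[0, +oo[ (EFin \o (fun t => expR (- t) * (Pt f t x - LP lam f t x))) /\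
  time_average eW f x - OU lam (time_average eW f) x =
  (\int[leb]_(t in `[0, +oo[) (expR (- t) * (Pt f t x - LP lam f t x)))%R.
Proof.
move=> f2b; have /C2bP[/C2P[f1 f2] bf bf1 bf2] := f2b.
have [u2 D1 D2] := C2b_time_average integrable_eW f2b.
have iW := integrable_eW.
have cf := C1_continuous f1.
have cf1 k := C1_continuous_pd (k := k) f1.
have cf2 j k := C1_continuous_pd (k := j) (f2 k).
pose h1 k t := eW t * decay k t * Pt (pd k f) t x.
pose h2 k t := eW t * decay k t * decay k t * Pt (pd k (pd k f)) t x.
have i1 k : leb.-integrable setT (EFin \o h1 k).
  by apply: integrable_Pt => //; exact: integrable_decay.
have i2 k : leb.-integrable setT (EFin \o h2 k).
  by apply: integrable_Pt => //; do 2!apply: integrable_decay.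
have I1 k : pd k (time_average eW f) x = (\int[leb]_t h1 k t)%R.
  by rewrite D1 time_averageE//; exact: integrable_decay.
have I2 k : pd k (pd k (time_average eW f)) x = (\int[leb]_t h2 k t)%R.
  by rewrite D2 time_averageE//; do 2!apply: integrable_decay.
pose h k t := 2^-1 * h2 k t - lam k.+1 * x 0 k * h1 k t.
have ih k : leb.-integrable setT (EFin \o h k).
  have j2 := integrableZl measurableT 2^-1 (i2 k).
  have j1 := integrableZl measurableT (lam k.+1 * x 0 k) (i1 k).
  by have := integrableB measurableT j2 j1; apply: eq_integrable.
have IO : OU lam (time_average eW f) x = (\int[leb]_t \sum_(k < m) h k t)%R.
  rewrite Rintegral_sumr// /OU mulr_sumr -sumrB; apply: eq_bigr => k _.
  rewrite I1 I2 RintegralB//.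
  - by rewrite !RintegralZl.
  - exact: (integrableZl measurableT _ (i2 k)).
  - exact: (integrableZl measurableT _ (i1 k)).
have iS := integrable_sumr (index_enum 'I_m) measurableT ih.
have iP := integrable_Pt x iW cf bf.
have E t : eW t * (Pt f t x - LP lam f t x) = eW t * Pt f t x - \sum_(k < m) h k t.
  rewrite mulrBr; congr (_ - _); rewrite /LP mulr_sumr; apply: eq_bigr => k _.
  by rewrite /h /h1 /h2; move: (Pt _ _ _) (Pt _ _ _) => *; ring.
split.
  apply: integrable_eW_mul.
  have := integrableB measurableT iP iS; apply: eq_integrable => // t _ /=.
  by rewrite E.
rewrite IO time_averageE// -RintegralB//.
by rewrite -Rintegral_eW; apply: eq_Rintegral => t _; rewrite E.
Qed.

End resolvent.

(** * Existence and uniqueness of the bounded classical solution *)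

Section solution.
Context {R : realType} {m : nat}.
Variable lam : nat -> R.
Hypothesis lam_gt0 : forall k : 'I_m, 0 < lam k.+1.
Local Notation scale := (@OU_scale R lam m).
Local Notation Pt := (@Pt R m lam).
Local Notation decay := (@decay R m lam).
Local Notation eW := (@exponential_pdf R 1).
Implicit Types (f g u v : 'rV[R]_m -> R) (x z : 'rV[R]_m) (k i : 'I_m) (t : R) (w : R -> R).

Lemma continuous_LP f x : C2bs f -> continuous (LP lam f ^~ x).
Proof.
move=> /C2bP[/C2P[f1 f2] bf bf1 bf2] t; rewrite /LP.
have cf1 k := C1_continuous_pd (k := k) f1.
have cf2 j k := C1_continuous_pd (k := j) (f2 k).
apply: cvg_sumr => k.
have c0 : decay k s @[s --> t] --> decay k t by exact: (@continuous_decay R m lam k t).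
have c1 : Pt (pd k f) s x @[s --> t] --> Pt (pd k f) t x.
  exact: (@continuous_Pt R m lam lam_gt0 _ x (cf1 k) (bf1 k) t).
have c2 : Pt (pd k (pd k f)) s x @[s --> t] --> Pt (pd k (pd k f)) t x.
  exact: (@continuous_Pt R m lam lam_gt0 _ x (cf2 k k) (bf2 k k) t).
apply: cvgB; apply: cvgM => //; apply: cvgM => //; try exact: cvg_cst.
  exact: cvgM.
by apply: cvgM => //; exact: cvg_cst.
Qed.

Lemma resolvent_eq f x : C2bs f ->
  time_average lam eW f x - OU lam (time_average lam eW f) x = f x.
Proof.
move=> f2b; have [iI ->] := OU_resolvent lam_gt0 x f2b.
have /C2bP[/C2P[f1 f2] bf bf1 bf2] := f2b.
have cf := C1_continuous f1; have /bounded_fctP[M fM] := bf.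
have cP := @continuous_Pt R m lam lam_gt0 f x cf bf.
have cL := @continuous_LP f x f2b.
have De t : is_derive t 1 (fun s => expR (- s)) (- expR (- t)).
  have D := is_derive_comp1 (is_derive_expR _) (is_deriveN (@is_derive_id R R t 1)).
  by apply: (@is_derive_eq _ _ _ _ _ _ _ _ D); rewrite mulrN1.
have ce : continuous (fun s : R => expR (- s)).
  move=> t; apply: differentiable_continuous; apply/derivable1_diffP.
  exact: (@ex_derive _ _ _ _ _ _ _ (De t)).
pose F t := - (expR (- t) * Pt f t x).
have -> : f x = - F 0 by rewrite /F opprK oppr0 expR0 mul1r Pt0.
apply: Rintegral_halfline_derive => //.
- by move=> t; apply: cvgM; [exact: ce|apply: cvgB; [exact: cP|exact: cL]].
- by move=> t; apply: cvgN; apply: cvgM; [exact: ce|exact: cP].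
- move=> t t0; have D := is_deriveN (is_deriveM (De t) (is_derive_Pt lam_gt0 x f2b t0)).
  apply: (@is_derive_eq _ _ _ _ _ _ _ _ D).
  rewrite /GRing.scale/=; move: (Pt _ _ _) (LP _ _ _ _) => *; ring.
- have e0 : expR (- t) @[t --> +oo] --> (0 : R) by exact: cvgr_expR.
  have h : (M * expR (- t)) @[t --> +oo] --> (0 : R).
    by rewrite -(mulr0 M); exact: cvgMl_tmp.
  have hN : (- (M * expR (- t))) @[t --> +oo] --> (0 : R).
    by rewrite -oppr0; exact: cvgN.
  apply: (squeeze_cvgr _ hN h); apply: nearW => t.
  rewrite -ler_norml /F normrN normrM gtr0_norm ?expR_gt0// mulrC.
  by apply: ler_wpM2r; [exact: expR_ge0|exact: Pt_le].
Qed.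

Lemma classical_solutionP f u : bounded_classical_solution lam f u <->
  [/\ C2s u, bounded_fun u & forall x, u x - OU lam u x = f x].
Proof.
rewrite /bounded_classical_solution C2sE /OU pdE.
by split=> -[u2 bu eu]; split=> // x; rewrite -eu opprB addrA addrAC.
Qed.

Lemma C2_sub u v : C2s u -> C2s v -> C2s (u - v).
Proof.
move=> u2 v2; have -> : u - v = u + cst (-1) * v.
  by apply/funext => x; rewrite !fctE /cst mulN1r.
by apply: C2D => //; apply: C2M => //; exact: C2_cst.
Qed.

Lemma OU_sub u v x : C2s u -> C2s v -> OU lam (u - v) x = OU lam u x - OU lam v x.
Proof.
move=> u2 v2; have -> : u - v = u + cst (-1) * v.
  by apply/funext => y; rewrite !fctE /cst mulN1r.
rewrite OU_D//; last by apply: C2M => //; exact: C2_cst.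
by rewrite OU_Z// mulN1r.
Qed.

Lemma classical_solution_le f u v : bounded_classical_solution lam f u ->
  bounded_classical_solution lam f v -> forall x, u x <= v x.
Proof.
move=> /classical_solutionP[u2 bu eu] /classical_solutionP[v2 bv ev] x.
rewrite -subr_le0 -[u x - v x]/((u - v) x).
have lam_ge0 k := ltW (lam_gt0 k).
apply: (max_principle lam_ge0 (D := setT)) => //.
- exact: C2_sub.
- move: bu bv => /bounded_fctP[A hA] /bounded_fctP[B hB]; apply/bounded_fctP.
  by exists (A + B) => y; apply: le_trans (ler_normB _ _) _; exact: lerD.
- move=> y _ _; split; first exact: filterT.
  rewrite OU_sub//; have := eu y; have := ev y; rewrite !fctE.
  by move: (OU lam u y) (OU lam v y) (u y) (v y) => *; lra.
Qed.

Lemma classical_solution_unique f u v : bounded_classical_solution lam f u ->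
  bounded_classical_solution lam f v -> u = v.
Proof.
by move=> uf vf; apply/funext => x; apply/eqP; rewrite eq_le !(@classical_solution_le f).
Qed.

Lemma OU_solutionE f : C2bs f -> C2bs (time_average lam eW f) /\
  bounded_classical_solution lam f (time_average lam eW f) /\
  OU_solution lam f = time_average lam eW f.
Proof.
move=> f2b; have [u2b _ _] := C2b_time_average lam_gt0 integrable_eW f2b.
have S : bounded_classical_solution lam f (time_average lam eW f).
  apply/classical_solutionP; split; first exact: C2b_C2.
    by have /C2bP[] := u2b.
  by move=> x; exact: resolvent_eq.
split=> //; split=> //; rewrite /OU_solution; case: xgetP => [v _ vf|/(_ _ S)//].
exact: classical_solution_unique vf S.
Qed.

End solution.

(** * The explicit sum in terms of the gradient of the solution *)

Section explicit_form.
Context {R : realType} {m : nat}.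
Local Notation RT := (measurableTypeR R).
Local Notation leb := (@lebesgue_measure R).
Local Notation LT := (@lebesgue_tuple R).
Local Notation gphi := (@gphi R m).
Variable lam : nat -> R.
Hypothesis lam_gt0 : forall k : 'I_m, 0 < lam k.+1.
Local Notation scale := (@OU_scale R lam m).
Local Notation Pt := (@Pt R m lam).
Local Notation decay := (@decay R m lam).
Local Notation eW := (@exponential_pdf R 1).
Implicit Types (f g u v : 'rV[R]_m -> R) (x z : 'rV[R]_m) (k i : 'I_m) (t : R) (w : R -> R).

(** At x = 0 the Mehler point has coordinates c_i(t) y_i, so the moment is the left side of
    [Pt_stein]. *)
Lemma gaussian_momentE f t k : C2bs f ->
  gaussian_moment lam f t k = scale t k * Pt (pd k f) t 0.
Proof.
move=> /C2bP[/C2P[f1 f2] bf bf1 bf2].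
have cf := C1_continuous f1; have /bounded_fctP[M fM] := bf.
rewrite -(Pt_stein lam t 0 f1 bf (bf1 k)).
set c := (Num.sqrt ((2 * pi) ^+ m))^-1 : R.
have ik : (LT m).-integrable setT
    (EFin \o (fun y => gphi y * (f (mehler_pt lam t 0 y) * tnth y k))).
  have i0 := @integrable_gphi_coord R m k.
  have i1 : (LT m).-integrable setT (EFin \o (fun y => M * `|gphi y * tnth y k|)).
    exact: (integrableZl measurableT _ (integrable_norm i0)).
  apply: (integrable_dom measurableT _ i1).
    apply: measurable_funM; first exact: measurable_gphi.
    apply: measurable_funM; first exact: measurable_mehler.
    exact: measurable_tnth.
  by move=> y _; rewrite mulrCA normrM; apply: ler_wpM2r.
have c0 : c != 0 by rewrite gt_eqF// gphi_prefactor_gt0.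
rewrite /gaussian_moment -/c.
apply: (mulfI (invr_neq0 c0)); rewrite mulKf// -RintegralZl//.
apply: eq_Rintegral => y _.
have -> : gphi y = c * blockE 2^-1 xpredT (rowt y) by [].
rewrite -[in RHS]mulrA mulKf// mulrC; congr (_ * (f _ * _)).
  rewrite /blockE /blockq; congr expR; rewrite mulNr mulrC; congr (- (_ * _)).
  by apply: eq_bigr => i _; rewrite mxE.
by apply/rowP => i; rewrite mehler_ptE !mxE mulr0 add0r.
Qed.

(** The root of 1 - e^(- 2 lam_k t) cancels against the one in c_k(t), leaving lam_k / sqrt(2 lam_k)
    = sqrt(lam_k / 2). *)
Lemma kernel_scale k t : 0 < t ->
  lam k.+1 * expR (- t) * expR (- (lam k.+1 * t)) /
    Num.sqrt (1 - expR (- (2 * lam k.+1 * t))) * scale t k =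
  Num.sqrt (lam k.+1 / 2) * (expR (- t) * decay k t).
Proof.
move=> t0; have l0 := lam_gt0 k.
set s := 1 - expR (- (2 * lam k.+1 * t)).
have s0 : 0 < s by rewrite subr_gt0 -expR0 ltr_expR oppr_lt0 !mulr_gt0.
rewrite /OU_scale -/s sqrtrM; last exact: ltW.
rewrite /decay (gtr0_norm t0).
have r0 : Num.sqrt s != 0 by rewrite gt_eqF// sqrtr_gt0.
have -> : lam k.+1 / 2 = lam k.+1 ^+ 2 * (2 * lam k.+1)^-1.
  by move: (lam k.+1) l0 => l l0; field; rewrite gt_eqF.
rewrite sqrtrM ?sqr_ge0// sqrtr_sqr (gtr0_norm l0).
move: (lam k.+1) (expR _) (expR _) (Num.sqrt (2 * lam k.+1)^-1) (Num.sqrt s) r0.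
move=> l a b c r r0.
by field.
Qed.

Lemma explicit_termE f k : C2bs f ->
  (\int[leb]_(t in `[0, +oo[)
       (lam k.+1 * expR (- t) * expR (- (lam k.+1 * t)) /
        Num.sqrt (1 - expR (- (2 * lam k.+1 * t))) *
        gaussian_moment lam f t k))%R =
  Num.sqrt (lam k.+1 / 2) * partial k (OU_solution lam f) 0.
Proof.
move=> f2b; have /C2bP[/C2P[f1 f2] bf bf1 bf2] := f2b.
have [_ [_ ->]] := OU_solutionE lam_gt0 f2b.
have [_ D1 _] := C2b_time_average lam_gt0 integrable_eW f2b.
have cf1 := C1_continuous_pd (k := k) f1.
have id := integrable_decay lam_gt0 k integrable_eW.
pose h t := expR (- t) * (decay k t * Pt (pd k f) t 0).
have ih : leb.-integrable `[0, +oo[ (EFin \o h).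
  apply: integrable_eW_mul.
  have := integrable_Pt lam_gt0 0 id cf1 (bf1 k); apply: eq_integrable => // t _ /=.
  by rewrite mulrA.
have -> : partial k (time_average lam eW f) 0 = (\int[leb]_(t in `[0, +oo[) h t)%R.
  rewrite -pdE D1 time_averageE// -Rintegral_eW.
  by apply: eq_Rintegral => t _; rewrite mulrA.
rewrite -RintegralZl//.
(* At t = 0 the left side is 0 by division by zero while the right side need not be, so both
   integrals are first restricted to the open half line. *)
have E t : t \in `]0, +oo[%classic ->
    lam k.+1 * expR (- t) * expR (- (lam k.+1 * t)) /
        Num.sqrt (1 - expR (- (2 * lam k.+1 * t))) * gaussian_moment lam f t k =
    Num.sqrt (lam k.+1 / 2) * h t.
  rewrite inE/= in_itv/= andbT => t0.
  by rewrite gaussian_momentE// mulrA kernel_scale// /h !mulrA.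
have ih' : leb.-integrable `]0, +oo[ (EFin \o (fun t => Num.sqrt (lam k.+1 / 2) * h t)).
  have h0 : leb.-integrable `[0, +oo[ (EFin \o (fun t => Num.sqrt (lam k.+1 / 2) * h t)).
    have mI : measurable (`[0%R, +oo[%classic : set RT) by [].
    by have := integrableZl mI (Num.sqrt (lam k.+1 / 2)) ih; apply: eq_integrable.
  apply: integrableS h0 => //.
  by move=> t /=; rewrite !in_itv/= !andbT; exact: ltW.
rewrite -Rintegral_itv_obnd_cbnd; last first.
  by apply: eq_integrable ih' => // t tI; rewrite /= E.
rewrite -[RHS]Rintegral_itv_obnd_cbnd//.
by apply: eq_Rintegral => t tI; exact: E.
Qed.

Lemma explicit_sumE f : C2bs f -> explicit_sum lam f = gradient_sum lam f / 2.
Proof.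
move=> f2b; rewrite /explicit_sum /gradient_sum mulr_suml; apply: eq_bigr => k _.
rewrite explicit_termE// exprMn sqr_sqrtr; first by rewrite mulrAC.
by rewrite divr_ge0 ?ltW.
Qed.

End explicit_form.

(** * Choice of the coordinates *)

Section selection.
Context {R : realType} (lam : nat -> R).
Hypothesis lam_gt0 : forall k, (1 <= k)%N -> 0 < lam k.
Hypothesis lam_incr : forall j k, (1 <= j)%N -> (j < k)%N -> lam j < lam k.
Hypothesis lam_sim : (fun k : nat => lam k / k%:R ^+ 2) @ \oo --> (1 : R).

Lemma lam_le j k : (1 <= j)%N -> (j <= k)%N -> lam j <= lam k.
Proof. by move=> j1; rewrite leq_eqVlt => /predU1P[->//|jk]; rewrite ltW ?lam_incr. Qed.

(** For large k the ratio exceeds 1/2, hence lam_k >= k^2 / 2 >= k / 2 >= A. *)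
Lemma lam_unbounded (A : R) c : exists k, (c < k)%N /\ A <= lam k.
Proof.
have h2 : 0 < 2^-1 :> R by rewrite invr_gt0.
have n1 : \forall k \near \oo, `|1 - lam k / k%:R ^+ 2| < 2^-1.
  by move/cvgrPdist_lt: lam_sim => /(_ _ h2).
have n2 : \forall k \near \oo, 2 * A <= k%:R by exact: nbhs_infty_ger.
have n3 : \forall k \near \oo, (c < k)%N by exact: nbhs_infty_gt.
have [k [[h Ak] ck]] := filter_ex (filterI (filterI n1 n2) n3).
exists k; split=> //; have k1 : 1 <= k%:R :> R by rewrite ler1n; exact: leq_ltn_trans ck.
have kk0 : 0 < k%:R ^+ 2 :> R by rewrite exprn_gt0// (lt_le_trans ltr01).
have : 2^-1 < lam k / k%:R ^+ 2 by move/ltr_normlP: h => [_]; move: (_ / _) => *; lra.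
rewrite ltr_pdivlMr// => h'; have k2 : k%:R <= k%:R ^+ 2 :> R by rewrite expr2 ler_peMl.
by move: (k%:R : R) (k%:R ^+ 2) (lam k) h' k2 Ak => *; lra.
Qed.

Variables N : nat.

(** Block j consists of the coordinates from n j to n j + N - 1. Coordinate l carries lam_(l+1), so
    [lam (n j + N)] is the largest eigenvalue in the block and [lam (k j).+1] is mu_j. *)
Lemma selection : exists n k : nat -> nat, forall j,
  [/\ (n j + N <= k j)%N, (k j < n j.+1)%N,
      1 <= lam (k j).+1, lam (n j + N) * N%:R <= lam (k j).+1 &
      4 * lam (k j).+1 <= lam (n j.+1)].
Proof.
have hK a : exists k, [/\ (a <= k)%N, 1 <= lam k.+1 & lam a * N%:R <= lam k.+1].
  have [k [ak]] := lam_unbounded (Num.max 1 (lam a * N%:R)) a.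
  by rewrite ge_max => /andP[]; case: k ak => // k ak; exists k.
have [K KP] := choice hK.
have [T TP] := choice (fun c => lam_unbounded (4 * lam c.+1) c).
(* K picks the single coordinate beyond a block, and T starts the next block where the eigenvalues
   have reached 4 mu_j. *)
pose n := fix n j := if j is i.+1 then T (K (n i + N)%N) else 0%N.
exists n, (fun j => K (n j + N)%N) => j.
have [k1 k2 k3] := KP (n j + N)%N; have [t1 t2] := TP (K (n j + N)%N).
by split.
Qed.

End selection.

(** * The lower bound in all large dimensions *)

Section large_gradient.
Context {R : realType} (lam : nat -> R).
Hypothesis lam_gt0 : forall k, (1 <= k)%N -> 0 < lam k.
Hypothesis lam_incr : forall j k, (1 <= j)%N -> (j < k)%N -> lam j < lam k.
Hypothesis lam_sim : (fun k : nat => lam k / k%:R ^+ 2) @ \oo --> (1 : R).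

Lemma sum_ord_interval m a b : (b <= m)%N ->
  \sum_(l < m | (a <= l < b)%N) (1 : R) = (b - a)%:R.
Proof.
move=> bm; rewrite -sumr_const_nat (big_nat_widenl a 0)// (big_nat_widen 0 b m)//.
by rewrite big_mkord.
Qed.

Lemma sup_norm_le1 m (f : 'rV[R]_m -> R) : (forall x, `|f x| <= 1) -> sup_norm f <= 1.
Proof.
move=> f1; apply: ge_sup; first by exists `|f 0|; exists 0.
by move=> _ [x _ <-].
Qed.

(** All coordinates used by the test function lie below n J, so one selection serves every larger
    dimension; divergence as m grows requires this uniformity. *)
Lemma gradient_sum_large J : (0 < J)%N -> exists M, forall m, (M <= m.+1)%N ->
  exists f : 'rV[R]_m.+1 -> R,
    [/\ C2bs f, C2b_unit_ball f & J%:R / 324 <= gradient_sum lam f].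
Proof.
move=> J0; pose N := (8 * J)%N; have N0 : (0 < N)%N by rewrite /N; lia.
have [n [k nk]] := selection lam_sim N; exists (n J) => m nJm.
have lam0 (i : 'I_m.+1) : 0 < lam i.+1 by exact: lam_gt0.
have nk1 j : (n j + N <= k j)%N by have [] := nk j.
have nk2 j : (k j < n j.+1)%N by have [] := nk j.
have n_le : {homo n : i j / (i <= j)%N}.
  by apply: homo_leq => [//|y x z|i]; [exact: leq_trans|have := nk1 i; have := nk2 i; lia].
have kn i j : (i < j)%N -> (k i < n j)%N by move=> ij; exact: leq_trans (nk2 i) (n_le _ _ ij).
have km j : (j < J)%N -> (k j < m.+1)%N by move=> jJ; apply: leq_trans nJm; exact: kn.
pose B j : pred 'I_m.+1 := fun l => (n j <= l < n j + N)%N.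
(* [inord] agrees with [k j] only in range, which [km] ensures for j < J; it also needs a nonempty
   ordinal type, hence the dimension m.+1. *)
pose kk j : 'I_m.+1 := inord (k j).
pose La j := lam (n j + N)%N.
have kkE j : (j < J)%N -> kk j = k j :> nat by move=> jJ; rewrite inordK// km.
have La_gt0 j : 0 < La j by apply: lam_gt0; lia.
pose f := cascade lam J B kk La.
have f2b : C2bs f by exact: C2b_cascade.
have f1 x : `|f x| <= 1 by exact: cascade_le1.
exists f; split=> //.
  by split; [rewrite -C2bsE|exact: sup_norm_le1].
have [u2b [/classical_solutionP[u2 bu eu] uE]] := OU_solutionE lam0 f2b.
rewrite /gradient_sum uE -pdE.
apply: (@sum_pd_ge R m.+1 lam lam0 J N B kk La) => //.
- move=> j jJ; rewrite sum_ord_interval ?addKn//.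
  by have := km j jJ; have := nk1 j; lia.
- by move=> j l _ /andP[_ ln]; exact: lam_le.
- move=> i j l /andP[ij _] /andP[_ li]; rewrite /B negb_and -ltnNge.
  by have := kn i j ij; have := nk1 i; lia.
- move=> i j iJ jJ; rewrite /B kkE//.
  have [ij|ji|->] := ltngtP i j; last by have := nk1 j; lia.
    by have := kn i j ij; have := nk1 i; have := nk1 j; lia.
  by have := kn j i ji; lia.
- move=> i j iJ jJ kij; have {kij} : k i = k j by rewrite -!kkE// kij.
  have [ij|ji|//] := ltngtP i j; first by have := kn i j ij; have := nk1 j; lia.
  by have := kn j i ji; have := nk1 i; lia.
- by move=> j jJ; rewrite kkE//; have [] := nk j.
- by move=> j jJ; rewrite kkE//; have [] := nk j.
- move=> i j /andP[ji iJ]; rewrite kkE; last exact: ltn_trans iJ.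
  have [_ _ _ _ h] := nk j; apply: (le_trans h); apply: lam_le => //.
    by have := nk2 j; lia.
  by have := n_le _ _ ji; lia.
Qed.

End large_gradient.

Lemma large_nat (R : realType) (A c : R) : 0 < c -> exists2 J : nat, (0 < J)%N & A <= J%:R / c.
Proof.
move=> c0; have n1 : \forall k \near \oo, A * c <= k%:R by exact: nbhs_infty_ger.
have n2 : \forall k \near \oo, (0 < k)%N by exact: nbhs_infty_gt.
have [J [hJ J0]] := filter_ex (filterI n1 n2).
by exists J => //; rewrite ler_pdivlMr.
Qed.

Theorem theorem2p2 (R : realType) (lam : nat -> R)
  (lam_gt0 : forall k, (1 <= k)%N -> 0 < lam k)
  (lam_incr : forall j k, (1 <= j)%N -> (j < k)%N -> lam j < lam k)
  (lam_sim : (fun k : nat => lam k / k%:R ^+ 2) @ \oo --> (1 : R)) :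
  [/\ forall m (f : 'rV[R]_m -> R), (1 <= m)%N -> C2b f ->
        [/\ C2b (OU_solution lam f),
            bounded_classical_solution lam f (OU_solution lam f) &
            forall v, bounded_classical_solution lam f v ->
              v = OU_solution lam f],
      (fun m => ereal_sup [set (gradient_sum lam f)%:E | f in @C2b_unit_ball R m])
        @ \oo --> +oo%E
    & ereal_sup [set ereal_sup [set (explicit_sum lam f)%:E | f in @C2b_unit_ball R m]
                | m in [set m | (1 <= m)%N]] = +oo%E].
Proof.
have lam0 m (k : 'I_m) : 0 < lam k.+1 by exact: lam_gt0.
split.
- move=> m f _; rewrite -C2bsE => f2b.
  have [u2b [S ->]] := OU_solutionE (lam0 m) f2b.
  by split=> // v vS; exact: classical_solution_unique vS S.
- apply/cvgeyPge => A; have [J J0 AJ] := @large_nat R A 324 (ltr0n _ 324).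
  have [M hM] := gradient_sum_large lam_gt0 lam_incr lam_sim J0.
  (* The threshold [M.+1] excludes dimension 0, as [gradient_sum_large] speaks of dimensions
     m.+1. *)
  exists M.+1 => // -[//|m] /= /ltnW Mm.
  have [f [_ f1 fJ]] := hM m Mm.
  apply: (@le_trans _ _ (gradient_sum lam f)%:E); first by rewrite lee_fin (le_trans AJ).
  by apply: ereal_sup_ubound; exists f.
(* The target is doubled because the explicit sum is half of the gradient sum; one dimension per A
   then suffices for the double supremum. *)
- apply: eq_infty => A; have [J J0 AJ] := @large_nat R (A * 2) 324 (ltr0n _ 324).
  have [M hM] := gradient_sum_large lam_gt0 lam_incr lam_sim J0.
  have [f [f2b f1 fJ]] := hM M (leqnSn M).
  apply: (@le_trans _ _ (explicit_sum lam f)%:E).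
    by rewrite lee_fin (explicit_sumE (lam0 _))// ler_pdivlMr// (le_trans AJ).
  apply: (@le_trans _ _ (ereal_sup [set (explicit_sum lam f)%:E | f in @C2b_unit_ball R M.+1])).
    by apply: ereal_sup_ubound; exists f.
  by apply: ereal_sup_ubound; exists M.+1.
Qed.
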